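(* Let $\widehat Q=(0,1)^2$ and let $\widehat\Pi_{\rm RT}$ be the lowest-order Raviart-Thomas interpolation operator on $\widehat Q$. (i) Let $s>1/2$. There is a constant $C>0$ such that for all $\mathbf{u}=(u_1,u_2)\in\mathbf{H}^s(\widehat Q)$ and $l=1,2$, $$\|(\widehat\Pi_{\rm RT}\mathbf{u})_l\|_{0,\widehat Q}\le C\,\|u_l\|_{H^s(\widehat Q)}.$$ (ii) Let $0<s\le1/2$. There is a constant $C>0$ such that for all $\mathbf{u}=(u_1,u_2)\in\mathbf{H}^s(\widehat Q)\cap\mathbf{H}(\mathrm{div},\widehat Q)$ and $l=1,2$, with $m=3-l$ denoting the other index, $$\|(\widehat\Pi_{\rm RT}\mathbf{u})_l\|_{0,\widehat Q}\le C\left(\|u_l\|_{H^s(\widehat Q)}+|u_m|_{AH^s_m(\widehat Q)}+\|\mathrm{div}\,\mathbf{u}\|_{0,\widehat Q}\right).$$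
   Context: $\mathbf{H}^s(D)=(H^s(D))^2$; $\mathbf{H}(\mathrm{div},D)=\{\mathbf{u}\in (L^2(D))^2:\mathrm{div}\,\mathbf{u}\in L^2(D)\}$; $\|\cdot\|_{0,D}$ is the $L^2(D)$-norm. For $0<s<1$ and $D\subset\mathbb{R}^n$, $|v|^2_{H^s(D)}=\int_D\int_D\frac{|v(x)-v(y)|^2}{|x-y|^{n+2s}}\,dx\,dy$ and $\|v\|^2_{H^s(D)}=\|v\|^2_{0,D}+|v|^2_{H^s(D)}$. Anisotropic seminorms on $\widehat Q$: $|u|^2_{AH^s_1(\widehat Q)}=\int_0^1|u(\cdot,x_2)|^2_{H^s(0,1)}\,dx_2$ and $|u|^2_{AH^s_2(\widehat Q)}=\int_0^1|u(x_1,\cdot)|^2_{H^s(0,1)}\,dx_1$ (both finite for $u\in H^s(\widehat Q)$). Raviart-Thomas interpolation: $\mathcal{RT}_0(\widehat Q)=\{(a+cx_1,\,b+dx_2)^\top: a,b,c,d\in\mathbb{R}\}$, and $\widehat\Pi_{\rm RT}\mathbf{u}\in\mathcal{RT}_0(\widehat Q)$ is the unique element with $\int_{e}\widehat\Pi_{\rm RT}\mathbf{u}\cdot\mathbf{n}\,ds=(\mathbf{u}\cdot\mathbf{n},1)_{0,e}$ for each of the four edges $e$ of $\widehat Q$, where $\mathbf{n}$ is the outward unit normal. If $s>1/2$, $(\mathbf{u}\cdot\mathbf{n},1)_{0,e}$ is the integral over $e$ of the normal trace. If $0<s\le1/2$ and $\mathbf{u}\in\mathbf{H}^s(\widehat Q)\cap\mathbf{H}(\mathrm{div},\widehat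 Q)$, it is defined by Green's formula: $(\mathbf{u}\cdot\mathbf{n},1)_{0,e}:=(\mathbf{u},\nabla\varphi)_{0,\widehat Q}+\int_{\widehat Q}\mathrm{div}\,\mathbf{u}\,\varphi$, where $\varphi\in H^{1-\varepsilon}(\widehat Q)$ for some $\varepsilon\in(0,s)$ with $\varphi=1$ on $e$ and $\varphi=0$ on $\partial\widehat Q\setminus e$, and $(\cdot,\cdot)_{0,\widehat Q}$ is the duality pairing of $\mathbf{H}^{\varepsilon}(\widehat Q)$ and $\mathbf{H}^{-\varepsilon}(\widehat Q)$ extending the $L^2$ inner product (the value does not depend on the choice of $\varphi$). *)

(* Defs.v *)
From HB Require Import structures.
From mathcomp Require Import all_boot all_order all_algebra.
From mathcomp Require Import all_classical all_reals all_analysis.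
Import Order.TTheory GRing.Theory Num.Theory.
Import numFieldNormedType.Exports.

Set Implicit Arguments.
Unset Strict Implicit.
Unset Printing Implicit Defensive.

Local Open Scope classical_set_scope.
Local Open Scope ring_scope.

(* The coordinate directions 1, 2 are the elements 0, 1 of 'I_2.  Functions on
   the unit square are total functions R * R -> R of which only the values on Qhat
   (or on its closure) matter. *)

Section RaviartThomas.
Context {R : realType}.

Implicit Types (s eps : R) (u v w phi psi : R * R -> R) (j l : 'I_2).
Implicit Types (U V P : 'I_2 -> R * R -> R).

Definition xcoord j (x : R * R) : R := if j == ord0 then x.1 else x.2.

(* the point whose coordinate of index j is t, the other one being y *)
Definition mkpt j (t y : R) : R * R := if j == ord0 then (t, y) else (y, t).

Definition I01 : set R := `]0, 1[%classic.

Definition Qhat : set (R * R) := I01 `*` I01.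

Definition Qhat_bar : set (R * R) := `[0, 1]%classic `*` `[0, 1]%classic.

Definition leb2 := ((@lebesgue_measure R) \x (@lebesgue_measure R))%E.

Definition pd j u : R * R -> R := fun x => 'D_(mkpt j 1 0) u x.

Definition pderiv (a b : nat) u : R * R -> R :=
  iter a (pd ord0) (iter b (pd ord_max) u).

(* For an open set O this is C^oo(O): every iterated partial derivative is
   differentiable (hence continuous) on O. *)
Definition smooth_on (O : set (R * R)) u : Prop :=
  forall (ds : seq 'I_2) x, O x -> differentiable (foldr pd u ds) x.

(* C^oo(closure of Qhat): smooth in a neighbourhood of the closed square *)
Definition smooth_closure u : Prop :=
  exists O : set (R * R), [/\ open O, Qhat_bar `<=` O & smooth_on O u].

(* C_c^oo(Qhat) *)
Definition test_fun phi : Prop :=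
  smooth_on setT phi /\
  exists K : set (R * R),
    [/\ compact K, K `<=` Qhat & forall x, ~ K x -> phi x = 0].

Definition L2sq u : \bar R := (\int[leb2]_(x in Qhat) ((u x) ^+ 2)%:E)%E.

Definition L2norm u : \bar R := sqrte (L2sq u).

Definition in_L2 u : Prop := measurable_fun Qhat u /\ (L2sq u < +oo)%E.

Definition is_wderiv (a b : nat) u w : Prop :=
  in_L2 w /\
  forall phi, test_fun phi ->
    \int[leb2]_(x in Qhat) (u x * pderiv a b phi x) =
    (-1) ^+ (a + b) * \int[leb2]_(x in Qhat) (w x * phi x).

Definition wderiv (a b : nat) u : R * R -> R :=
  if (a + b == 0)%N then u else xget (fun=> 0) [set w | is_wderiv a b u w].

(* the Euclidean distance; the norm of the library on R * R is the max norm *)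
Definition edist (x y : R * R) : R :=
  Num.sqrt ((x.1 - y.1) ^+ 2 + (x.2 - y.2) ^+ 2).

(* |u|_{H^s(Qhat)}^2 for 0 < s < 1 *)
Definition gagliardo_sq s u : \bar R :=
  (\int[leb2]_(x in Qhat) \int[leb2]_(y in Qhat)
     ((u x - u y) ^+ 2 / edist x y `^ (2 + 2 * s))%:E)%E.

(* ||u||_{H^s(Qhat)}^2 for s > 0: with m the integer part of s, the sum of the
   squared L^2 norms of the weak derivatives of order at most m and, if s is not
   an integer, of the squared seminorms of order s - m of those of order m.
   For s < 1 only L2sq u + gagliardo_sq s u remains. *)
Definition Hs_sqnorm s u : \bar R :=
  let m := Num.truncn s in
  (\sum_(a < m.+1) \sum_(b < m.+1 | (a + b <= m)%N) L2sq (wderiv a b u)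
   + if s == m%:R then 0
     else \sum_(a < m.+1) \sum_(b < m.+1 | (a + b == m)%N)
            gagliardo_sq (s - m%:R) (wderiv a b u))%E.

Definition Hs_norm s u : \bar R := sqrte (Hs_sqnorm s u).

Definition in_Hs s u : Prop :=
  [/\ in_L2 u,
      forall a b : nat, (0 < a + b <= Num.truncn s)%N ->
        exists w, is_wderiv a b u w
    & (Hs_sqnorm s u < +oo)%E].

(* |f|_{H^s(0,1)}^2 for 0 < s < 1 *)
Definition gagliardo1_sq s (f : R -> R) : \bar R :=
  (\int[lebesgue_measure]_(x in I01) \int[lebesgue_measure]_(y in I01)
     ((f x - f y) ^+ 2 / `|x - y| `^ (1 + 2 * s))%:E)%E.

Definition AHs_seminorm j s u : \bar R :=
  sqrte (\int[lebesgue_measure]_(y in I01)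
           gagliardo1_sq s (fun t => u (mkpt j t y)))%E.

Definition is_wdiv U d : Prop :=
  in_L2 d /\
  forall phi, test_fun phi ->
    \int[leb2]_(x in Qhat) (\sum_j U j x * pd j phi x) =
    - \int[leb2]_(x in Qhat) (d x * phi x).

Definition in_Hdiv U : Prop :=
  (forall j, in_L2 (U j)) /\ exists d, is_wdiv U d.

Definition divg U : R * R -> R := xget (fun=> 0) [set d | is_wdiv U d].

(* (j, false) and (j, true) are the edges {x_j = 0} and {x_j = 1} *)
Definition edge : Type := ('I_2 * bool)%type.

Definition edge_pt (e : edge) (t : R) : R * R := mkpt e.1 (e.2 : nat)%:R t.

Definition edge_normal (e : edge) j : R :=
  if j == e.1 then (if e.2 then 1 else -1) else 0.

Definition normal_comp U (e : edge) : R * R -> R :=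
  fun x => \sum_j U j x * edge_normal e j.

(* g is the trace on e of v, for v in H^s(Qhat) and s > 1/2: the trace operator
   is the extension by continuity, from H^s(Qhat) to L^2(e), of the restriction
   to e of functions that are smooth up to the boundary *)
Definition is_trace s (e : edge) v (g : R -> R) : Prop :=
  (measurable_fun I01 g /\
   (\int[lebesgue_measure]_(t in I01) ((g t) ^+ 2)%:E < +oo)%E) /\
  exists phi : nat -> R * R -> R,
    [/\ forall k, smooth_closure (phi k),
        (fun k => Hs_sqnorm s (fun x => phi k x - v x)) @ \oo --> 0%E
      & (fun k => \int[lebesgue_measure]_(t in I01)
           ((phi k (edge_pt e t) - g t) ^+ 2)%:E)%E @ \oo --> 0%E].

Definition edge_trace s (e : edge) v : R -> R :=
  xget (fun=> 0) [set g | is_trace s e v g].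

Definition in_Hs_vec s U : Prop := forall j, in_Hs s (U j).

(* L is an element of the dual space of (H^eps(Qhat))^2, that is, of the space of
   vector fields with components in H^{-eps}(Qhat) *)
Definition in_Hs_dual eps (L : ('I_2 -> R * R -> R) -> R) : Prop :=
  (forall (c : R) U V, in_Hs_vec eps U -> in_Hs_vec eps V ->
     L (fun j x => c * U j x + V j x) = c * L U + L V) /\
  exists K : R, forall U, in_Hs_vec eps U ->
    (`|L U|%:E <= K%:E * sqrte (\sum_j Hs_sqnorm eps (U j)))%E.

(* L is the gradient of phi, in the sense of distributions, as an element of
   the dual space of (H^eps(Qhat))^2; the pairing (U, grad phi) is then L U *)
Definition is_dual_grad eps phi (L : ('I_2 -> R * R -> R) -> R) : Prop :=
  in_Hs_dual eps L /\
  forall U, (forall j, test_fun (U j)) ->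
    L U = - \int[leb2]_(x in Qhat) (phi x * \sum_j pd j (U j) x).

(* phi is in H^{1-eps}(Qhat), its trace is 1 on e and 0 on the other edges *)
Definition is_lifting eps (e : edge) phi : Prop :=
  in_Hs (1 - eps) phi /\
  forall e' : edge, is_trace (1 - eps) e' phi (fun=> (e' == e)%:R).

Definition trace_moment s U (e : edge) : R :=
  \int[lebesgue_measure]_(t in I01) edge_trace s e (normal_comp U e) t.

(* Green's formula.  Its value does not depend on eps, on the lifting phi or on
   the representation L of grad phi: the moment is the common value. *)
Definition green_moment s U (e : edge) : R :=
  xget 0 [set r | forall eps phi (L : ('I_2 -> R * R -> R) -> R),
    0 < eps < s -> is_lifting eps e phi -> is_dual_grad eps phi L ->
    r = L U + \int[leb2]_(x in Qhat) (divg U x * phi x)].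

Definition edge_moment s U (e : edge) : R :=
  if 2^-1 < s then trace_moment s U e else green_moment s U e.

Definition in_RT0 P : Prop :=
  exists a c : 'I_2 -> R, forall j x, P j x = a j + c j * xcoord j x.

Definition is_RT_interp s U P : Prop :=
  in_RT0 P /\
  forall e : edge,
    \int[lebesgue_measure]_(t in I01) normal_comp P e (edge_pt e t) =
    edge_moment s U e.

Definition RT_interp s U : 'I_2 -> R * R -> R :=
  xget (fun _ _ => 0) [set P | is_RT_interp s U P].

End RaviartThomas.

(* Main.v *)
(** On Qhat the l-th component of the interpolant is affine in x_l and constant in
    the other variable, with end values the two moments over the edges orthogonal
    to the direction l: it suffices to bound these moments.

    (i) If f is continuous up to 0, Hardy's averaging argument on (0,1) gives
    |f(0)| <= \int |f| + \int\int_{r<t} |f(t) - f(r)| / t^2.  Apply this on the lines in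
    direction l to a smooth approximation of u_l.  Cauchy-Schwarz bounds the double
    integral by the Gagliardo seminorm of any order s' in (1/2, s) of u_l on the
    lines, and averaging over intermediate points of the square bounds the latter by
    the two-dimensional seminorm of order s.  If s >= 1, Green's formula with a linear
    weight reduces the moment to integrals of u_l and of its l-th derivative.

    (ii) With q(t) = t (1 - t) and for the edge x = 1, the function
    phi(x, y) = x q(y) / (q(x) + q(y)) lifts the edge data.  Its increments between two
    points are at most a constant times min(1, distance / distance to the corners), so
    it is in H^{1-eps} and is the limit there of the smooth functions with
    denominators q(x) + q(y) + delta.  Its partial derivatives are dominated by the
    Hardy weight q(y) / (q(x) + q(y))^2 or the symmetric one; hence they pair with H^eps.
    In the direction m the function phi vanishes at both ends of every line, so its m-th
    derivative has mean zero there, only the oscillation of u_m on the lines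
    matters, and this is controlled by the anisotropic seminorm. *)
Require Import Defs.
From HB Require Import structures.
From mathcomp Require Import all_boot all_order all_algebra.
From mathcomp Require Import all_classical all_reals all_analysis.
From mathcomp Require Import measurable_realfun ring lra.
Import Order.TTheory GRing.Theory Num.Theory.
Import numFieldNormedType.Exports.

Set Implicit Arguments.
Unset Strict Implicit.
Unset Printing Implicit Defensive.

Local Open Scope ring_scope.
Local Open Scope classical_set_scope.

(** The edge data, 1 on one edge and 0 on the others, jump at two corners. Hence no lifting is in
    H^1, and the gradient of phi grows like the inverse distance to these corners; everything
    depends on whether such a weight pairs with fields of low order. Hardy's inequality is therefore
    taken in L^1 form, with a kernel [kap] of size (x + t)^-2, where x is the distance to the end in
    the other variable. Against a seminorm of order e on the lines, it remains to integrate kap^2 |t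
    - r|^(1 + 2 e), which is at most of size (x + t)^(2 e - 3). On the square this power is shared
    by x, t and r, each with exponent 2 e / 3 - 1 > -1, so every e > 0 is admissible: this gives
    (ii). For a value on an edge x = 0, only t and r share it, with exponent e - 3/2, which exceeds
    -1 exactly when e > 1/2: this gives (i). Passing from the norm of order s on the square to the
    lines costs some order, so e < s there; the component u_m in (ii) is measured on the lines from
    the start and is used at the order s itself. *)

Lemma eqW_le (d : Order.disp_t) (T : porderType d) (x y : T) : x = y -> (x <= y)%O.
Proof. by move=> ->. Qed.

(** * Tonelli and Fubini on the square *)

Section Tonelli.
Local Open Scope ereal_scope.
Context d1 d2 (T1 : measurableType d1) (T2 : measurableType d2) (R : realType).

(** Holds for arbitrary functions: the integral of a nonnegative function is a supremum over the
    simple functions below it, a family that grows with the function. *)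
Lemma le_integral_ge0 (mu : {measure set T1 -> \bar R}) (D : set T1)
    (f1 f2 : T1 -> \bar R) :
  (forall x, D x -> 0 <= f1 x) -> (forall x, D x -> f1 x <= f2 x) ->
  \int[mu]_(x in D) f1 x <= \int[mu]_(x in D) f2 x.
Proof.
move=> f10 f12; rewrite !(integral_mkcond D) !ge0_integralTE; first last.
- by apply: erestrict_ge0.
- by apply: erestrict_ge0 => // x Dx; exact: le_trans (f10 _ Dx) (f12 _ Dx).
apply: le_ereal_sup => _ [h hf <-]; exists h => // x.
apply: (le_trans (hf x)); rewrite !patchE; case: ifPn => // /set_mem Dx.
exact: f12.
Qed.

Section rect.
Variables (D1 : set T1) (D2 : set T2).
Hypotheses (mD1 : measurable D1) (mD2 : measurable D2).
Variable f : T1 * T2 -> \bar R.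
Hypothesis mf : measurable_fun (D1 `*` D2) f.

Let patch_inner (m2 : {measure set T2 -> \bar R}) x : D1 x ->
  \int[m2]_y (f \_ (D1 `*` D2)) (x, y) = \int[m2]_(y in D2) f (x, y).
Proof.
move=> D1x; rewrite [RHS]integral_mkcond; apply: eq_integral => y _.
rewrite !patchE; congr (if _ then _ else _).
by apply/idP/idP; rewrite !inE //= => -[].
Qed.

Let patch_inner' (m1 : {measure set T1 -> \bar R}) y : D2 y ->
  \int[m1]_x (f \_ (D1 `*` D2)) (x, y) = \int[m1]_(x in D1) f (x, y).
Proof.
move=> D2y; rewrite [RHS]integral_mkcond; apply: eq_integral => x _.
rewrite !patchE; congr (if _ then _ else _).
by apply/idP/idP; rewrite !inE //= => -[].
Qed.

Let patch_iterated (m1 : {sigma_finite_measure set T1 -> \bar R})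
    (m2 : {sigma_finite_measure set T2 -> \bar R}) :
  \int[m1]_(x in D1) \int[m2]_(y in D2) f (x, y) =
  \int[m1]_x \int[m2]_y (f \_ (D1 `*` D2)) (x, y).
Proof.
rewrite [LHS]integral_mkcond; apply: eq_integral => x _.
rewrite patchE; case: ifPn => [/set_mem D1x|]; first by rewrite patch_inner.
move=> /negP D1x; rewrite integral0_eq// => y _.
by rewrite patchE; case: ifPn => // /set_mem [] /= /mem_set.
Qed.

Let patch_iterated' (m1 : {sigma_finite_measure set T1 -> \bar R})
    (m2 : {sigma_finite_measure set T2 -> \bar R}) :
  \int[m2]_(y in D2) \int[m1]_(x in D1) f (x, y) =
  \int[m2]_y \int[m1]_x (f \_ (D1 `*` D2)) (x, y).
Proof.
rewrite [LHS]integral_mkcond; apply: eq_integral => y _.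
rewrite patchE; case: ifPn => [/set_mem D2y|]; first by rewrite patch_inner'.
move=> /negP D2y; rewrite integral0_eq// => x _.
by rewrite patchE; case: ifPn => // /set_mem [] /= _ /mem_set.
Qed.

Let mD12 : measurable (D1 `*` D2). Proof. exact: measurableX. Qed.

Let mfp : measurable_fun setT (f \_ (D1 `*` D2)).
Proof. exact/(measurable_restrictT _ _).1. Qed.

Lemma measurable_rect_F (m2 : {sigma_finite_measure set T2 -> \bar R}) :
  (forall x y, D1 x -> D2 y -> 0 <= f (x, y)) ->
  measurable_fun D1 (fun x => \int[m2]_(y in D2) f (x, y)).
Proof.
move=> f0; apply: (eq_measurable_fun
    (fun x => \int[m2]_y (f \_ (D1 `*` D2)) (x, y))).
  by move=> x /set_mem D1x; rewrite patch_inner.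
apply: (measurable_funS measurableT) => //.
apply: (measurable_fun_fubini_tonelli_F (f \_ (D1 `*` D2))) => //.
by apply: erestrict_ge0 => -[x y] [] /=; exact: f0.
Qed.

(** The theorem on the whole product is applied to [f] extended by 0; the sections of this extension
    are the sections of [f] extended by 0. *)
Lemma tonelli_rect (m1 : {sigma_finite_measure set T1 -> \bar R})
    (m2 : {sigma_finite_measure set T2 -> \bar R}) :
  (forall x y, D1 x -> D2 y -> 0 <= f (x, y)) ->
  (\int[m1 \x m2]_(z in D1 `*` D2) f z =
     \int[m1]_(x in D1) \int[m2]_(y in D2) f (x, y)) *
  (\int[m1]_(x in D1) \int[m2]_(y in D2) f (x, y) =
   \int[m2]_(y in D2) \int[m1]_(x in D1) f (x, y)).
Proof.
move=> f0.
have g0 z : 0 <= (f \_ (D1 `*` D2)) z.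
  by apply: erestrict_ge0 => -[x y] [] /=; exact: f0.
have E1 := patch_iterated m1 m2; have E2 := patch_iterated' m1 m2.
split; first by rewrite E1 integral_mkcond fubini_tonelli1.
by rewrite E1 E2 fubini_tonelli.
Qed.

Lemma fubini_rect (m1 : {sigma_finite_measure set T1 -> \bar R})
    (m2 : {sigma_finite_measure set T2 -> \bar R}) :
  (m1 \x m2).-integrable (D1 `*` D2) f ->
  (\int[m1 \x m2]_(z in D1 `*` D2) f z =
     \int[m1]_(x in D1) \int[m2]_(y in D2) f (x, y)) *
  (\int[m1 \x m2]_(z in D1 `*` D2) f z =
   \int[m2]_(y in D2) \int[m1]_(x in D1) f (x, y)).
Proof.
move=> intf.
have intp : (m1 \x m2).-integrable setT (f \_ (D1 `*` D2)).
  by apply/(integrable_mkcond f mD12).1.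
have E1 := patch_iterated m1 m2; have E2 := patch_iterated' m1 m2.
split.
- by rewrite E1 integral_mkcond -integral12_prod_meas1.
- by rewrite E2 integral_mkcond -integral21_prod_meas1.
Qed.

End rect.
End Tonelli.

Section Square.
Context {R : realType}.
Implicit Types (j : 'I_2) (x y t r : R) (z w : R * R).
Notation mu := (@lebesgue_measure R).

Lemma measurable_I01 : measurable (@I01 R).
Proof. exact: measurable_itv. Qed.

Lemma measurable_Qhat : measurable (@Qhat R).
Proof. by apply: measurableX; exact: measurable_I01. Qed.

Lemma mu_I01 : mu (@I01 R) = 1%E.
Proof. by rewrite /I01 lebesgue_measure_itv/= lte01 oppr0 adde0. Qed.

Lemma I01E t : I01 t <-> 0 < t < 1.
Proof. by rewrite /I01 /= in_itv. Qed.

Lemma QhatE j t y : Qhat (mkpt j t y) <-> I01 t /\ I01 y.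
Proof. by rewrite /mkpt /Qhat; case: ifP => _ /=; split => -[]. Qed.

Lemma xcoord_mkpt j t y : xcoord j (mkpt j t y) = t.
Proof. by rewrite /xcoord /mkpt; case: (j == ord0). Qed.

Lemma xcoord_mkpt_rev j t y : xcoord (rev_ord j) (mkpt j t y) = y.
Proof.
rewrite /xcoord /mkpt.
by case: j => -[|[|//]] ?.
Qed.

Lemma mkpt_xcoord j z : mkpt j (xcoord j z) (xcoord (rev_ord j) z) = z.
Proof. by case: z => a b; rewrite /xcoord /mkpt; case: j => -[|[|//]] ?. Qed.

Lemma Qhat_xcoord j z : Qhat z -> I01 (xcoord j z).
Proof. by move=> [? ?]; rewrite /xcoord; case: ifP. Qed.

Lemma measurable_xcoord j D : measurable_fun D (@xcoord R j).
Proof.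
apply: (measurable_funS measurableT) => //; rewrite /xcoord.
case: (j == ord0) => /=; [exact: measurable_fst|exact: measurable_snd].
Qed.

Lemma measurable_pair d (T : measurableType d) (D : set T) (f g : T -> R) :
  measurable D -> measurable_fun D f -> measurable_fun D g ->
  measurable_fun D (fun p => (f p, g p)).
Proof.
move=> mD mf mg; apply: (eq_measurable_fun (fun p => ((f \_ D) p, (g \_ D) p))).
  by move=> p pD; rewrite !patchE pD.
apply: (measurable_funS measurableT) => //.
by apply: measurable_fun_pair; exact/(measurable_restrictT _ _).1.
Qed.

Lemma measurable_mkpt d (T : measurableType d) D j (f g : T -> R) :
  measurable D -> measurable_fun D f -> measurable_fun D g ->
  measurable_fun D (fun p => mkpt j (f p) (g p)).
Proof.
by move=> mD mf mg; rewrite /mkpt; case: (j == ord0); exact: measurable_pair.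
Qed.

(** The inner integral runs along the lines in direction [j], so that a one-dimensional estimate can
    be inserted for either coordinate. *)
Lemma integral_Qhat j (f : R * R -> \bar R) : measurable_fun Qhat f ->
  (forall z, Qhat z -> (0 <= f z)%E) ->
  (\int[leb2]_(z in Qhat) f z =
    \int[mu]_(y in I01) \int[mu]_(t in I01) f (mkpt j t y))%E.
Proof.
move=> mf f0; rewrite /leb2.
have mI := measurable_I01.
have F := @tonelli_rect _ _ (measurableTypeR R) (measurableTypeR R) R _ _
  mI mI f mf mu mu.
have {}F := F (fun x y Ix Iy => f0 (x, y) (conj Ix Iy)).
by rewrite F.1 /mkpt; case: (j == ord0) => //; rewrite F.2.
Qed.

Lemma integrable_Qhat j (f : R * R -> \bar R) :
  leb2.-integrable Qhat f ->
  (\int[leb2]_(z in Qhat) f z =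
    \int[mu]_(y in I01) \int[mu]_(t in I01) f (mkpt j t y))%E.
Proof.
move=> fi; rewrite /leb2.
have mI := measurable_I01.
have F := @fubini_rect _ _ (measurableTypeR R) (measurableTypeR R) R _ _
  mI mI f mu mu fi.
by rewrite /mkpt; case: (j == ord0) => //; rewrite -?F.1 -?F.2.
Qed.

End Square.

Section Slices.
Context {R : realType}.
Implicit Types (j : 'I_2) (x y t r : R) (z w : R * R).
Notation mu := (@lebesgue_measure R).
Notation RR := (measurableTypeR R).

Lemma measurable_comp_sub d1 d2 d3 (T1 : measurableType d1)
    (T2 : measurableType d2) (T3 : measurableType d3) (E : set T2)
    (D : set T1) (f : T2 -> T3) (g : T1 -> T2) :
  measurable D -> measurable E -> measurable_fun setT g ->
  (forall p, D p -> E (g p)) -> measurable_fun E f ->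
  measurable_fun D (f \o g).
Proof.
move=> mD mE mg DE mf; apply: (measurable_comp mE _ mf).
  by move=> _ [p Dp <-]; exact: DE.
exact: (measurable_funS measurableT).
Qed.

(** A pair of points on a line in direction [j] is written as [z] and [setc j z r]. Double integrals
    over lines thereby become integrals over [QI], the square times an interval. *)
Definition setc j z r : R * R := mkpt j r (xcoord (rev_ord j) z).

Lemma setc_mkpt j t y r : setc j (mkpt j t y) r = mkpt j r y.
Proof. by rewrite /setc xcoord_mkpt_rev. Qed.

Lemma xcoord_setc j z r : xcoord j (setc j z r) = r.
Proof. exact: xcoord_mkpt. Qed.

Lemma setcK j z : setc j z (xcoord j z) = z.
Proof. exact: mkpt_xcoord. Qed.

Lemma Qhat_setc j z r : Qhat z -> I01 r -> Qhat (setc j z r).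
Proof. by move=> Qz Ir; apply/QhatE; split=> //; exact: Qhat_xcoord. Qed.

Definition QI : set ((R * R) * R) := Qhat `*` I01.

Lemma measurable_QI : measurable QI.
Proof. by apply: measurableX; [exact: measurable_Qhat|exact: measurable_I01]. Qed.

Lemma measurable_II : measurable (@I01 R `*` @I01 R).
Proof. by apply: measurableX; exact: measurable_I01. Qed.

Lemma measurable_mkptT d (T : measurableType d) j (f g : T -> R) :
  measurable_fun setT f -> measurable_fun setT g ->
  measurable_fun setT (fun p => mkpt j (f p) (g p)).
Proof. by move=> mf mg; exact: measurable_mkpt. Qed.

Lemma measurable_QI_fst d (T : measurableType d) (u : R * R -> T) :
  measurable_fun Qhat u -> measurable_fun QI (fun p => u p.1).
Proof.
apply: (measurable_comp_sub measurable_QI measurable_Qhat (g := fst)).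
- exact: measurable_fst.
- by move=> p [].
Qed.

Lemma measurable_QI_setc d (T : measurableType d) j (u : R * R -> T) :
  measurable_fun Qhat u -> measurable_fun QI (fun p => u (setc j p.1 p.2)).
Proof.
apply: (measurable_comp_sub measurable_QI measurable_Qhat
  (g := fun p => setc j p.1 p.2)).
- apply: measurable_mkptT; first exact: measurable_snd.
  by apply: measurableT_comp; [exact: measurable_xcoord|exact: measurable_fst].
- by move=> [z r] [Qz Ir]; exact: Qhat_setc.
Qed.

Lemma measurable_QI_swap j (f : R * R -> R -> \bar R) :
  measurable_fun QI (fun p => f p.1 p.2) ->
  measurable_fun QI (fun p => f (setc j p.1 p.2) (xcoord j p.1)).
Proof.
apply: (measurable_comp_sub measurable_QI measurable_QI
  (g := fun p => (setc j p.1 p.2, xcoord j p.1))).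
- apply: measurable_fun_pair.
    apply: measurable_mkptT; first exact: measurable_snd.
    by apply: measurableT_comp; [exact: measurable_xcoord|exact: measurable_fst].
  by apply: measurableT_comp; [exact: measurable_xcoord|exact: measurable_fst].
- by move=> [z r] [Qz Ir]; split; [exact: Qhat_setc|exact: Qhat_xcoord].
Qed.

Lemma measurable_QI_fiber j y (f : R * R -> R -> \bar R) : I01 y ->
  measurable_fun QI (fun p => f p.1 p.2) ->
  measurable_fun (@I01 R `*` @I01 R) (fun p => f (mkpt j p.1 y) p.2).
Proof.
move=> Iy; apply: (measurable_comp_sub measurable_II measurable_QI
  (g := fun p => (mkpt j p.1 y, p.2))).
- apply: measurable_fun_pair; last exact: measurable_snd.
  by apply: measurable_mkptT; first exact: measurable_fst.
- by move=> [t r] [It Ir]; split=> //; exact/QhatE.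
Qed.

Local Open Scope ereal_scope.

Lemma tonelli_I01 (f : R -> R -> \bar R) :
  measurable_fun (@I01 R `*` @I01 R) (fun p => f p.1 p.2) ->
  (forall t r, I01 t -> I01 r -> 0 <= f t r) ->
  \int[mu]_(t in I01) \int[mu]_(r in I01) f t r =
  \int[mu]_(r in I01) \int[mu]_(t in I01) f t r.
Proof.
move=> mf f0.
have := @tonelli_rect _ _ RR RR R _ _ measurable_I01 measurable_I01 _ mf mu mu f0.
by move=> -[_ ->].
Qed.

Lemma measurable_inner_I01 (f : R -> R -> \bar R) :
  measurable_fun (@I01 R `*` @I01 R) (fun p => f p.1 p.2) ->
  (forall t r, I01 t -> I01 r -> 0 <= f t r) ->
  measurable_fun I01 (fun t => \int[mu]_(r in I01) f t r).
Proof.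
move=> mf f0.
exact (@measurable_rect_F _ _ RR RR R _ _ measurable_I01 measurable_I01
  (fun p => f p.1 p.2) mf mu f0).
Qed.

Definition T3 (f : R * R -> R -> \bar R) : \bar R :=
  \int[leb2]_(z in Qhat) \int[mu]_(r in I01) f z r.

Lemma measurable_inner_QI (f : R * R -> R -> \bar R) :
  measurable_fun QI (fun p => f p.1 p.2) ->
  (forall z r, Qhat z -> I01 r -> 0 <= f z r) ->
  measurable_fun Qhat (fun z => \int[mu]_(r in I01) f z r).
Proof.
move=> mf f0.
have H := @measurable_rect_F _ _ (RR * RR)%type RR R _ _ measurable_Qhat
  measurable_I01 (fun p => f p.1 p.2) mf mu f0.
exact H.
Qed.

Lemma T3_fiber j (f : R * R -> R -> \bar R) :
  measurable_fun QI (fun p => f p.1 p.2) ->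
  (forall z r, Qhat z -> I01 r -> 0 <= f z r) ->
  T3 f = \int[mu]_(y in I01) \int[mu]_(t in I01) \int[mu]_(r in I01)
           f (mkpt j t y) r.
Proof.
move=> mf f0; have mF := measurable_inner_QI mf f0.
have F0 z : Qhat z -> 0 <= \int[mu]_(r in I01) f z r.
  by move=> Qz; apply: integral_ge0 => r Ir; exact: f0.
exact (integral_Qhat j mF F0).
Qed.

(** The change of variables exchanges the two points of a pair on the same line; on each line it is
    Tonelli's theorem. *)
Lemma T3_swap j (f : R * R -> R -> \bar R) :
  measurable_fun QI (fun p => f p.1 p.2) ->
  (forall z r, Qhat z -> I01 r -> 0 <= f z r) ->
  T3 (fun z r => f (setc j z r) (xcoord j z)) = T3 f.
Proof.
move=> mf f0; have mg := measurable_QI_swap j mf.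
have g0 z r : Qhat z -> I01 r -> 0 <= f (setc j z r) (xcoord j z).
  by move=> Qz Ir; apply: f0; [exact: Qhat_setc|exact: Qhat_xcoord].
rewrite (T3_fiber j mg g0) (T3_fiber j mf f0).
apply: eq_integral => y /set_mem Iy; rewrite [RHS]tonelli_I01.
- apply: eq_integral => t _; apply: eq_integral => r _.
  by rewrite setc_mkpt xcoord_mkpt.
- exact: measurable_QI_fiber.
- by move=> t r It Ir; apply: f0 => //; exact/QhatE.
Qed.

Lemma T3_le (f g : R * R -> R -> \bar R) :
  (forall z r, Qhat z -> I01 r -> 0 <= f z r) ->
  (forall z r, Qhat z -> I01 r -> f z r <= g z r) -> T3 f <= T3 g.
Proof.
move=> f0 fg; apply: le_integral_ge0 => z Qz.
  by apply: integral_ge0 => r Ir; exact: f0.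
by apply: le_integral_ge0 => r Ir; [exact: f0|exact: fg].
Qed.

Lemma T3_ge0 (f : R * R -> R -> \bar R) :
  (forall z r, Qhat z -> I01 r -> 0 <= f z r) -> 0 <= T3 f.
Proof.
by move=> f0; apply: integral_ge0 => z Qz; apply: integral_ge0 => r; exact: f0.
Qed.

Lemma T3D (f g : R * R -> R -> \bar R) :
  measurable_fun QI (fun p => f p.1 p.2) ->
  measurable_fun QI (fun p => g p.1 p.2) ->
  (forall z r, Qhat z -> I01 r -> 0 <= f z r) ->
  (forall z r, Qhat z -> I01 r -> 0 <= g z r) ->
  T3 (fun z r => f z r + g z r) = T3 f + T3 g.
Proof.
move=> mf mg f0 g0; have mF := measurable_inner_QI mf f0.
have mG := measurable_inner_QI mg g0.
have F0 z : Qhat z -> 0 <= \int[mu]_(r in I01) f z r.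
  by move=> Qz; apply: integral_ge0 => r Ir; exact: f0.
have G0 z : Qhat z -> 0 <= \int[mu]_(r in I01) g z r.
  by move=> Qz; apply: integral_ge0 => r Ir; exact: g0.
rewrite /T3 -(@ge0_integralD _ _ _ leb2 _ measurable_Qhat _ _ F0 mF G0 mG).
have slice (h : R * R -> R -> \bar R) z :
    measurable_fun QI (fun p => h p.1 p.2) -> Qhat z -> measurable_fun I01 (h z).
  move=> mh Qz.
  apply: (measurable_comp_sub measurable_I01 measurable_QI
    (g := fun r => (z, r)) _ _ mh); last by [].
  by apply: measurable_fun_pair => //; exact: measurable_id.
apply: eq_integral => z /set_mem Qz; rewrite -ge0_integralD//.
- exact: measurable_I01.
- by move=> r; exact: f0.
- exact: slice.
- by move=> r; exact: g0.
- exact: slice.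
Qed.

Lemma T3Z (k : R) (f : R * R -> R -> \bar R) : (0 <= k)%R ->
  measurable_fun QI (fun p => f p.1 p.2) ->
  (forall z r, Qhat z -> I01 r -> 0 <= f z r) ->
  T3 (fun z r => k%:E * f z r) = k%:E * T3 f.
Proof.
move=> k0 mf f0; have mF := measurable_inner_QI mf f0.
have F0 z : Qhat z -> 0 <= \int[mu]_(r in I01) f z r.
  by move=> Qz; apply: integral_ge0 => r Ir; exact: f0.
rewrite /T3 -(@ge0_integralZl_EFin _ _ _ leb2 _ measurable_Qhat _ F0 mF _ k0).
apply: eq_integral => z /set_mem Qz; rewrite -ge0_integralZl_EFin//.
- exact: measurable_I01.
- by move=> r; exact: f0.
- apply: (measurable_comp_sub measurable_I01 measurable_QI
    (g := fun r => (z, r)) _ _ mf); last by [].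
  by apply: measurable_fun_pair => //; exact: measurable_id.
Qed.

End Slices.

(** * One-dimensional calculus *)

Section OneDim.
Context {R : realType}.
Implicit Types (a b c d t r x y : R) (f F : R -> R).
Notation mu := (@lebesgue_measure R).

Lemma is_derive_continuous f F t : is_derive t 1 F (f t) -> {for t, continuous F}.
Proof.
by move=> dF; apply/differentiable_continuous/derivable1_diffP; exact: ex_derive.
Qed.

Lemma FTC2_closed f F a b : a < b ->
  (forall t, a <= t <= b -> is_derive t 1 F (f t)) ->
  (forall t, a <= t <= b -> {for t, continuous f}) ->
  (\int[mu]_(t in `[a, b]) (f t)%:E = (F b - F a)%:E)%E.
Proof.
move=> ab dF cf; rewrite EFinB; apply: continuous_FTC2 => //.
- apply: continuous_in_subspaceT => t /set_mem/=; rewrite in_itv/= => tab.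
  exact: cf.
- split.
  + move=> t; rewrite in_itv/= => /andP[at_ tb].
    by apply: ex_derive; apply: dF; rewrite !ltW.
  + apply: cvg_at_right_filter; apply: (@is_derive_continuous f).
    by apply: dF; rewrite lexx ltW.
  + apply: cvg_at_left_filter; apply: (@is_derive_continuous f).
    by apply: dF; rewrite lexx ltW.
- move=> t; rewrite in_itv/= => /andP[at_ tb].
  by rewrite derive1E; apply: derive_val; apply: dF; rewrite !ltW.
Qed.

Lemma FTC2_open f F a b : a < b ->
  (forall t, a <= t <= b -> is_derive t 1 F (f t)) ->
  (forall t, a <= t <= b -> {for t, continuous f}) ->
  (\int[mu]_(t in `]a, b[) (f t)%:E = (F b - F a)%:E)%E.
Proof.
move=> ab dF cf; rewrite -(FTC2_closed ab dF cf).
rewrite (@integral_itv_bndoo _ a b _ true false)//.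
apply/measurable_EFinP; apply: open_continuous_measurable_fun.
  exact: interval_open.
move=> t /set_mem/=; rewrite in_itv/= => /andP[ta tb].
by apply: cf; rewrite !ltW.
Qed.

(* only an inequality, but [f] may blow up at both ends *)
Lemma FTC2_le f F a b m M : a < b ->
  (forall t, a < t < b -> is_derive t 1 F (f t)) ->
  (forall t, a < t < b -> {for t, continuous f}) ->
  (forall t, a < t < b -> 0 <= f t) ->
  (forall t, a < t < b -> m <= F t <= M) ->
  (\int[mu]_(t in `]a, b[) (f t)%:E <= (M - m)%:E)%E.
Proof.
move=> ab dF cf f0 Fb.
(* The intervals [A n] exhaust ]a, b[ from inside. The denominator n + 2 keeps a + e n <= b - e n,
   with equality for n = 0 only. *)
pose e n : R := (b - a) / (n.+2)%:R.
have e_gt0 n : 0 < e n by rewrite divr_gt0// subr_gt0.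
have ele n : e n <= (b - a) / 2.
  by rewrite ler_pM2l ?subr_gt0// lef_pV2 ?posrE// ler_nat.
pose A n := `]a + e n, b - e n[%classic.
have Aab n t : A n t -> a < t < b.
  rewrite /A/= in_itv/= => /andP[at_ tb]; have en0 := e_gt0 n.
  by apply/andP; split; lra.
have UA : `]a, b[%classic = \bigcup_n A n.
  apply/seteqP; split => t; last by move=> [n _ /Aab]; rewrite /= in_itv.
  rewrite /= in_itv/= => /andP[at_ tb].
  pose dl := Num.min (t - a) (b - t).
  have dl0 : 0 < dl by rewrite lt_min !subr_gt0 at_ tb.
  exists (Num.truncn ((b - a) / dl)) => //.
  rewrite /A/= in_itv/=.
  suff : e (Num.truncn ((b - a) / dl)) < dl.
    by rewrite /dl lt_min => /andP[? ?]; apply/andP; split; lra.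
  rewrite /e ltr_pdivrMr// mulrC -ltr_pdivrMr//.
  by apply: (lt_le_trans (truncnS_gt _)); rewrite ler_nat.
have mf t : a < t < b -> {for t, continuous f} by exact: cf.
have mA n : measurable (A n) by exact: measurable_itv.
have mfA n : measurable_fun (A n) (EFin \o f).
  apply/measurable_EFinP; apply: open_continuous_measurable_fun.
    exact: interval_open.
  by move=> t /set_mem /Aab; exact: cf.
have ndA : nondecreasing_seq A.
  move=> n k nk; rewrite subsetEset /A => t /=; rewrite !in_itv/= => /andP[ta tb].
  have : e k <= e n.
    by rewrite /e ler_pM2l ?subr_gt0// lef_pV2 ?posrE// ler_nat.
  by move=> ?; apply/andP; split; lra.
have fA0 n t : A n t -> (0 <= (EFin \o f) t)%E.
  by move=> /Aab abt; rewrite /= lee_fin f0.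
have cv := @ge0_nondecreasing_set_cvg_integral _ _ _ _ _ mu ndA mA mfA fA0.
rewrite UA -(cvg_lim _ cv)//.
apply: lime_le; first by apply/cvg_ex; eexists; exact: cv.
near=> n; have := ele n; have := e_gt0 n => en0 en2.
have nn : e n != (b - a) / 2 -> a + e n < b - e n.
  by move=> ne; have : e n < (b - a) / 2 by [rewrite lt_neqAle ne|]; lra.
have /nn ab' : e n != (b - a) / 2.
  rewrite lt_eqF// /e ltr_pM2l ?subr_gt0// ltf_pV2 ?posrE// ltr_nat.
  by near: n; exists 1%N.
have abt t : a + e n <= t <= b - e n -> a < t < b.
  by move=> /andP[? ?]; apply/andP; split; lra.
have dF' t : a + e n <= t <= b - e n -> is_derive t 1 F (f t) by move=> /abt /dF.
have cf' t : a + e n <= t <= b - e n -> {for t, continuous f} by move=> /abt /cf.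
rewrite (FTC2_open ab' dF' cf') lee_fin lerB//.
- have /Fb/andP[]// : a < b - e n < b by apply/andP; split; lra.
- have /Fb/andP[]// : a < a + e n < b by apply/andP; split; lra.
Unshelve. all: by end_near. Qed.

Lemma is_derive_powR_shift (p c : R) t : c < t ->
  is_derive t 1 (fun t => (t - c) `^ p) (p * (t - c) `^ (p - 1)).
Proof.
move=> ct; have ct0 : 0 < t - c by rewrite subr_gt0.
have d1 : is_derive t 1 (fun t : R => t - c) (1 - 0) by apply: is_deriveB.
have d2 := @is_derive1_powR _ p _ ct0.
have := @is_derive1_comp _ (@powR R ^~ p) (fun t : R => t - c) t _ _ d2 d1.
by move=> H; apply: is_derive_eq; rewrite subr0 mulr1.
Qed.

Lemma integral_powR_right (p c d : R) : 0 < p -> c < d ->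
  (\int[mu]_(t in `]c, d[) ((t - c) `^ (p - 1))%:E <= ((d - c) `^ p / p)%:E)%E.
Proof.
move=> p0 cd; rewrite -[leRHS]/(EFin _) -[X in EFin X]subr0.
apply: (@FTC2_le _ (fun t => (t - c) `^ p / p)) => //.
- move=> t /andP[ct td].
  have H := is_derive_powR_shift p ct.
  have -> : (t - c) `^ (p - 1) = p^-1 *: (p * (t - c) `^ (p - 1)).
    by rewrite /GRing.scale/= mulrA mulVf ?mul1r// gt_eqF.
  rewrite [X in is_derive _ _ X _](_ : _ = p^-1 \*: (fun t => (t - c) `^ p)).
    exact: is_deriveZ.
  by apply/funext => z; rewrite /= mulrC.
- move=> t /andP[ct td].
  exact: (is_derive_continuous
    (f := fun t => (p - 1) * (t - c) `^ (p - 1 - 1)) (is_derive_powR_shift _ ct)).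
- by move=> t _; exact: powR_ge0.
- move=> t /andP[ct td]; rewrite divr_ge0 ?powR_ge0 ?(ltW p0)//=.
  rewrite ler_pM2r ?invr_gt0// ge0_ler_powR ?nnegrE ?subr_ge0 ?(ltW p0)//.
  - exact: ltW.
  - exact: ltW.
  - by rewrite lerD2r ltW.
Qed.

End OneDim.

Section Reflect.
Context {R : realType}.
Notation mu := (@lebesgue_measure R).
Notation RR := (measurableTypeR R).
Implicit Types (p c d t : R).

Let onemR : RR -> RR := fun t => 1 - t.

Let measurable_onemR : measurable_fun setT onemR.
Proof.
apply: continuous_measurable_fun => t.
by apply: continuousB; [exact: cst_continuous|exact: cvg_id].
Qed.

(** The pushforward under t -> 1 - t gives ]x, y] the length of [1 - y, 1 - x[, and Lebesgue measure
    is determined by its values on half-open intervals. *)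
Let mu_onem : forall A : set RR, measurable A -> mu A = mu (onemR @^-1` A).
Proof.
pose m : {measure set RR -> \bar R} :=
  @measure_function_pushforward__canonical__measure_function_Measure
    _ _ RR RR R mu _ measurable_onemR.
move=> A mA; rewrite (@lebesgue_measure_unique R m)// => X /ocitvP[->|].
  by rewrite !measure0.
move=> [[x y] /= xy ->] /=; rewrite /m /= /pushforward.
rewrite (_ : onemR @^-1` _ = `[1 - y, 1 - x[%classic).
  by rewrite !lebesgue_measure_itv/= !lte_fin ltrD2l ltrN2 -!EFinB xy; congr EFin; ring.
apply/seteqP; split => t /=; rewrite !in_itv/= /onemR => /andP[? ?].
  by apply/andP; split; lra.
by apply/andP; split; lra.
Qed.

Lemma integral_I01_onem (g : R -> \bar R) : measurable_fun I01 g ->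
  (forall t, I01 t -> (0 <= g t)%E) ->
  (\int[mu]_(t in I01) g (1 - t)%R = \int[mu]_(t in I01) g t)%E.
Proof.
move=> mg g0.
have E : onemR @^-1` I01 = I01.
  apply/seteqP; split => t; rewrite /preimage/= /onemR => /I01E /andP[? ?];
    apply/I01E; by apply/andP; split; lra.
transitivity (\int[pushforward mu onemR]_(t in I01) g t)%E.
  have H := @ge0_integral_pushforward _ _ RR RR R onemR measurable_onemR mu _ g
    measurable_I01 mg.
  by rewrite H ?E// => t /set_mem; exact: g0.
by apply: eq_measure_integral => A mA _; rewrite [RHS]mu_onem.
Qed.

End Reflect.

(** Inversion is total, with value 0 at 0, and discontinuous there; on each half line it is a power
    function of exponent -1 up to sign. *)
Lemma measurable_invr (R : realType) : measurable_fun setT (@GRing.inv R).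
Proof.
rewrite (_ : @GRing.inv R = fun t => if 0 <= t then t `^ (- 1) else - (- t) `^ (- 1)).
  apply: measurable_fun_ifT.
  - exact: measurable_fun_ler.
  - exact: measurable_powR.
  - apply: measurableT_comp => //.
    by apply: (measurableT_comp (measurable_powR _)); exact: oppr_measurable.
apply/funext => t; case: ifPn => [t0|]; first by rewrite powR_inv1.
by rewrite -ltNge => t0; rewrite powR_inv1 ?invrN ?opprK// oppr_ge0 ltW.
Qed.

Lemma measurable_natb (R : realType) d (T : measurableType d) D (b : T -> bool) :
  measurable_fun D b -> measurable_fun D (fun p => (b p)%:R : R).
Proof. by apply: (measurableT_comp (f := fun b : bool => b%:R : R)). Qed.

(** The choice l = A^(-1/2) balances the two terms; for A = 0 let l tend to infinity. Together with
    a pointwise Young inequality with parameter l, this does the work of Cauchy-Schwarz for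
    integrals that may be infinite. *)
Lemma lin_of_quad (R : realType) (X A : \bar R) (B : R) :
  (0 <= A)%E -> 0 <= B ->
  (forall l : R, 0 < l -> (X <= l%:E * A + (B / l)%:E)%E) ->
  (X <= (1 + B)%:E * sqrte A)%E.
Proof.
case: A => [a| |] //; last first.
  by move=> _ B0 _; rewrite /= gt0_muley ?leey// lte_fin; lra.
rewrite lee_fin le_eqVlt => /predU1P[<-|a0] B0 XB.
  rewrite sqrte0 mule0; apply/lee_addgt0Pr => e e0; rewrite add0e.
  apply: (le_trans (XB ((B + 1) / e) _)); first by rewrite divr_gt0//; lra.
  rewrite mule0 add0e lee_fin ler_pdivrMr; last by rewrite divr_gt0//; lra.
  by rewrite mulrCA mulfV ?gt_eqF// mulr1; lra.
have sa : 0 < Num.sqrt a by rewrite sqrtr_gt0.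
apply: (le_trans (XB (Num.sqrt a)^-1 _)); first by rewrite invr_gt0.
rewrite /= -!EFinM -EFinD lee_fin invrK -[X in _ * X + _](sqr_sqrtr (ltW a0)).
by rewrite expr2 mulrA mulVf ?gt_eqF// mul1r; lra.
Qed.

Section Weights.
Context {R : realType}.
Notation mu := (@lebesgue_measure R).
Implicit Types (a p c d t : R).

Lemma is_derive_powR_shiftN p c t : t < c ->
  is_derive t 1 (fun t => (c - t) `^ p) (- (p * (c - t) `^ (p - 1))).
Proof.
move=> ct; have ct0 : 0 < c - t by rewrite subr_gt0.
have d1 : is_derive t 1 (fun t : R => c - t) (0 - 1) by apply: is_deriveB.
have d2 := @is_derive1_powR _ p _ ct0.
have H := @is_derive1_comp _ (@powR R ^~ p) (fun t : R => c - t) t _ _ d2 d1.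
by apply: is_derive_eq; rewrite sub0r mulrN1.
Qed.

Lemma integral_powR_left p c d : 0 < p -> c < d ->
  (\int[mu]_(t in `]c, d[) ((d - t) `^ (p - 1))%:E <= ((d - c) `^ p / p)%:E)%E.
Proof.
move=> p0 cd; rewrite (_ : (d - c) `^ p / p = 0 - - ((d - c) `^ p / p)); last first.
  by rewrite opprK add0r.
apply: (@FTC2_le _ (fun t => (d - t) `^ (p - 1)) (fun t => - p^-1 * (d - t) `^ p)
  c d (- ((d - c) `^ p / p)) 0 cd).
- move=> t /andP[ct td].
  have H := is_derive_powR_shiftN p td.
  have -> : (d - t) `^ (p - 1) = (- p^-1) *: (- (p * (d - t) `^ (p - 1))).
    by rewrite /GRing.scale/= mulrNN mulrA mulVf ?mul1r// gt_eqF.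
  exact: is_deriveZ.
- move=> t /andP[ct td].
  exact: (is_derive_continuous
    (f := fun t => - ((p - 1) * (d - t) `^ (p - 1 - 1))) (is_derive_powR_shiftN _ td)).
- by move=> t _; exact: powR_ge0.
- move=> t /andP[ct td]; rewrite mulNr lerN2 oppr_le0 mulr_ge0 ?invr_ge0 ?powR_ge0 ?(ltW p0)// andbT.
  rewrite mulrC ler_pM2r ?invr_gt0// ge0_ler_powR ?nnegrE ?subr_ge0 ?(ltW p0)//.
  - exact: ltW.
  - exact: ltW.
  - by rewrite lerD2l lerN2 ltW.
Qed.

(** One weight for both ends: it dominates t^(a - 1) and (1 - t)^(a - 1), and it is integrable for
    every a > 0. *)
Definition wt a t : R := t `^ (a - 1) + (1 - t) `^ (a - 1).

Lemma wt_ge0 a t : 0 <= wt a t. Proof. by rewrite addr_ge0 ?powR_ge0. Qed.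

Lemma measurable_powRc disp (T : measurableType disp) D (f : T -> R) a :
  measurable_fun D f -> measurable_fun D (fun w => f w `^ a).
Proof. exact: (measurableT_comp (measurable_powR a)). Qed.

Lemma measurable_wt a D : measurable_fun D (wt a).
Proof.
apply: (measurable_funS measurableT) => //; apply: measurable_funD.
  exact: measurable_powR.
by apply: measurable_powRc; exact: measurable_funB.
Qed.

Lemma integral_wt a : 0 < a ->
  (\int[mu]_(t in I01) (wt a t)%:E <= (2 / a)%:E)%E.
Proof.
move=> a0; under eq_integral do rewrite EFinD.
have mI := @measurable_I01 R.
have m1 : measurable_fun (@I01 R) (fun t => (t `^ (a - 1))%:E).
  by apply/measurable_EFinP/measurable_powRc.
have m2 : measurable_fun (@I01 R) (fun t => ((1 - t) `^ (a - 1))%:E).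
  by apply/measurable_EFinP/measurable_powRc; exact: measurable_funB.
have p1 t : (@I01 R) t -> (0 <= (t `^ (a - 1))%:E)%E by rewrite lee_fin powR_ge0.
have p2 t : (@I01 R) t -> (0 <= ((1 - t) `^ (a - 1))%:E)%E by rewrite lee_fin powR_ge0.
rewrite (ge0_integralD mu mI p1 m1 p2 m2).
have -> : 2 / a = (1 - 0) `^ a / a + (1 - 0) `^ a / a :> R by rewrite subr0 powR1; lra.
rewrite EFinD; apply: leeD; last exact: integral_powR_left.
apply: (le_trans _ (integral_powR_right a0 ltr01)).
by apply: le_integral_ge0 => t It; [exact: p1|rewrite subr0].
Qed.

(** The point c splits the interval into two pieces contributing at most c^a / a and (1 - c)^a / a,
    so the bound is uniform in c. *)
Lemma integral_absB_powR a c : 0 < a -> I01 c ->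
  (\int[mu]_(t in I01) (`|t - c| `^ (a - 1))%:E <= (2 / a)%:E)%E.
Proof.
move=> a0 /I01E /andP[c0 c1].
have mf D : measurable_fun D (fun t => (`|t - c| `^ (a - 1))%:E).
  apply/measurable_EFinP/measurable_powRc; apply: measurableT_comp => //.
  exact: measurable_funB.
have -> : @I01 R = `]0, c] `|` `]c, 1[.
  by rewrite /I01 -itv_bndbnd_setU// bnd_simp ltW.
have dis : [disjoint `]0, c]%classic & `]c, 1[%classic].
  apply/disj_setPS => t [] /=; rewrite !in_itv/= => /andP[_ tc] /andP[ct _].
  by move: (lt_le_trans ct tc); rewrite ltxx.
rewrite (@ge0_integral_setU _ _ _ mu _ _ (measurable_itv _) (measurable_itv _) _
  (mf _) _ dis); last by move=> t _; rewrite lee_fin powR_ge0.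
have -> : 2 / a = 1 / a + 1 / a :> R by lra.
have le1 r : 0 <= r <= 1 -> r `^ a / a <= 1 / a.
  move=> /andP[r0 r1]; rewrite ler_pM2r ?invr_gt0// -(congr1 (fun f => f a) (@powR1 R)).
  by rewrite ge0_ler_powR ?nnegrE// ltW.
rewrite EFinD; apply: leeD.
- rewrite (@integral_itv_bndoo _ 0 c _ false false)//.
  apply: (@le_trans _ _ ((c - 0) `^ a / a)%:E); last first.
    by rewrite lee_fin le1// subr0 !ltW.
  apply: (le_trans _ (integral_powR_left a0 c0)).
  apply: le_integral_ge0 => t /=; first by rewrite lee_fin powR_ge0.
  by rewrite in_itv/= => /andP[t0 tc]; rewrite distrC gtr0_norm ?subr_gt0.
- apply: (@le_trans _ _ ((1 - c) `^ a / a)%:E); last first.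
    by rewrite lee_fin le1//; apply/andP; split; lra.
  apply: (le_trans _ (integral_powR_right a0 c1)).
  apply: le_integral_ge0 => t /=; first by rewrite lee_fin powR_ge0.
  by rewrite in_itv/= => /andP[tc t1]; rewrite gtr0_norm ?subr_gt0.
Qed.

End Weights.

Lemma measurable_fstD d1 d2 (T1 : measurableType d1) (T2 : measurableType d2)
  (D : set (T1 * T2)) : measurable_fun D fst.
Proof. by apply: (measurable_funS measurableT) => //; exact: measurable_fst. Qed.

Lemma measurable_sndD d1 d2 (T1 : measurableType d1) (T2 : measurableType d2)
  (D : set (T1 * T2)) : measurable_fun D snd.
Proof. by apply: (measurable_funS measurableT) => //; exact: measurable_snd. Qed.

(** Each step peels one operation off an expression. Unknown functions at the leaves are settled by
    hypotheses, which is why the proofs below first collect measurability facts in the context. *)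
Ltac meas_step :=
  lazymatch goal with
  | |- measurable_fun _ (fun x => x.1) => exact: measurable_fstD
  | |- measurable_fun _ (fun x => x.2) => exact: measurable_sndD
  | |- measurable_fun _ (fun x => @GRing.add _ (@?f x) (@GRing.opp _ (@?g x))) =>
      apply: (@measurable_funB _ _ _ _ f g)
  | |- measurable_fun _ (fun x => @GRing.add _ (@?f x) (@?g x)) =>
      apply: (@measurable_funD _ _ _ _ f g)
  | |- measurable_fun _ (fun x => @GRing.opp _ (@?f x)) =>
      apply: (measurableT_comp (@oppr_measurable _ setT) (g := f))
  | |- measurable_fun _ (fun x => @GRing.mul _ (@?f x) (@?g x)) =>
      apply: (@measurable_funM _ _ _ _ f g)
  | |- measurable_fun _ (fun x => @GRing.inv _ (@?f x)) =>
      apply: (measurableT_comp (@measurable_invr _) (g := f))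
  | |- measurable_fun _ (fun x => @GRing.exp _ (@?f x) ?n) =>
      apply: (@measurable_funX _ _ _ _ f n)
  | |- measurable_fun _ (fun x => Num.norm (@?f x)) =>
      apply: (measurableT_comp (@normr_measurable _ setT) (g := f))
  | |- measurable_fun _ (fun x => powR (@?f x) ?a) =>
      apply: (@measurable_powRc _ _ _ _ f a)
  | |- measurable_fun _ (fun x => @GRing.natmul _ _ (nat_of_bool (@?b x))) =>
      apply: (@measurable_natb _ _ _ _ b)
  | |- measurable_fun _ (fun x => @Order.lt _ _ (@?f x) (@?g x)) =>
      apply: (@measurable_fun_ltr _ _ _ _ f g)
  | |- measurable_fun _ (fun x => wt ?a (@?f x)) =>
      apply: (measurableT_comp (@measurable_wt _ a setT) (g := f))
  | |- measurable_fun _ (fun x => xcoord ?j (@?f x)) =>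
      apply: (measurableT_comp (@measurable_xcoord _ j setT) (g := f))
  | |- measurable_fun _ _ =>
      first [assumption | exact: measurable_id | exact: measurable_cst]
  end.
Ltac meas := repeat meas_step.
Ltac measE := apply/measurable_EFinP; meas.

(** * Hardy inequalities on an interval *)

Section Hardy.
Context {R : realType}.
Notation mu := (@lebesgue_measure R).
Implicit Types (t r x y : R) (f : R -> R).

Lemma measurable_II_fst d (T : measurableType d) (f : R -> T) :
  measurable_fun I01 f -> measurable_fun (@I01 R `*` @I01 R) (fun p => f p.1).
Proof.
apply: (measurable_comp_sub measurable_II measurable_I01 (g := fst)).
- exact: measurable_fst.
- by move=> p [].
Qed.

Lemma measurable_II_snd d (T : measurableType d) (f : R -> T) :
  measurable_fun I01 f -> measurable_fun (@I01 R `*` @I01 R) (fun p => f p.2).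
Proof.
apply: (measurable_comp_sub measurable_II measurable_I01 (g := snd)).
- exact: measurable_snd.
- by move=> p [].
Qed.

Lemma integral_ltl (x r : R) : 0 < x -> I01 r ->
  (\int[mu]_(t in I01) ((r < t)%R%:R / (x + t) ^+ 2)%:E =
   ((x + r)^-1 - (x + 1)^-1)%:E)%E.
Proof.
move=> x0 /I01E /andP[r0 r1].
transitivity (\int[mu]_(t in `]r, 1%R[) (((x + t) ^+ 2)^-1)%:E)%E.
  have -> : `]r, 1%R[%classic = @I01 R `&` `]r, 1%R[%classic.
    apply/seteqP; split => t /=; rewrite /I01/= !in_itv/=; last by move=> [].
    by move=> /andP[rt t1]; rewrite rt t1; split => //; rewrite andbT (lt_trans r0).
  rewrite integral_mkcondr; apply: eq_integral => t /set_mem; rewrite /I01/= in_itv/=.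
  move=> /andP[t0 t1]; rewrite patchE mem_setE in_itv/= t1 andbT.
  by case: ifPn; rewrite ?mul1r ?mul0r.
have xt t : r <= t -> 0 < x + t by move=> ?; lra.
have -> : (x + r)^-1 - (x + 1)^-1 = - (x + 1)^-1 - - (x + r)^-1 by ring.
have dxt t : is_derive t 1 (fun t : R => x + t) 1.
  have H : is_derive t 1 (fun t : R => x + t) (0 + 1) by apply: is_deriveD.
  by rewrite add0r in H.
apply: (@FTC2_open _ (fun t => ((x + t) ^+ 2)^-1) (fun t => - (x + t)^-1)) => //.
- move=> t /andP[rt t1]; have xt0 := xt _ rt.
  have xtn0 : x + t != 0 by rewrite gt_eqF.
  have H := is_deriveN (is_deriveV xtn0 (dxt t)).
  by apply: is_derive_eq; rewrite /GRing.scale/= mulr1 opprK.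
- move=> t /andP[rt t1]; have xt0 := xt _ rt.
  apply: continuousV; first by rewrite expf_neq0// gt_eqF.
  have cxt : {for t, continuous (fun t : R => x + t)}.
    exact: (is_derive_continuous (f := fun=> 1)).
  rewrite (_ : (fun t => _) = (fun t : R => x + t) * (fun t : R => x + t)).
    exact: continuousM.
  by apply/funext => z; rewrite expr2.
Qed.

Lemma integral_ltr r : I01 r -> (\int[mu]_(t in I01) ((t < r)%R%:R)%:E = r%:E)%E.
Proof.
move=> /I01E /andP[r0 r1].
transitivity (\int[mu]_(t in `]0%R, r[) 1%:E)%E; last first.
  by rewrite integral_cst//= lebesgue_measure_itv/= lte_fin r0 oppr0 mul1e adde0.
have -> : `]0%R, r[%classic = @I01 R `&` `]0%R, r[%classic.
  apply/seteqP; split => t /=; rewrite /I01/= !in_itv/=; last by move=> [].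
  by move=> /andP[t0 tr]; rewrite t0 tr; split => //; rewrite (lt_trans tr).
rewrite integral_mkcondr; apply: eq_integral => t /set_mem; rewrite /I01/= in_itv/=.
move=> /andP[t0 t1]; rewrite patchE mem_setE in_itv/= t0/=.
by case: ifPn.
Qed.

Local Open Scope ereal_scope.

(* Let J := \int |f t| t/(x + t)^2. The double integral with |f r| in place of
   |f t - f r| is at most J plus the one below; integrated in t first, it equals
   \int |f r| (1/(x + r) - 1/(x + 1)), which is at least the left-hand side plus J
   minus the L^1 norm. The finite J cancels. *)
Lemma hardy_half (f : R -> R) x : (0 < x)%R -> measurable_fun I01 f ->
  \int[mu]_(t in I01) (`|f t| * (x / (x + t) ^+ 2))%:E <=
  \int[mu]_(t in I01) (`|f t|)%:E +
  \int[mu]_(t in I01) \int[mu]_(r in I01)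
     (`|f t - f r| * ((r < t)%R%:R / (x + t) ^+ 2))%:E.
Proof.
move=> x0 mf; set N := \int[mu]_(t in I01) (`|f t|)%:E; set E := (X in _ <= _ + X).
have mI := @measurable_I01 R.
have N0 : 0 <= N by apply: integral_ge0 => t _; rewrite lee_fin.
have E0 : 0 <= E.
  apply: integral_ge0 => t _; apply: integral_ge0 => r _.
  by rewrite lee_fin mulr_ge0// mulr_ge0// invr_ge0 sqr_ge0.
have [->|Nfin] := eqVneq N +oo; first by rewrite addye ?leey// gt_eqF// (lt_le_trans _ E0).
have {}Nfin : N \is a fin_num by rewrite ge0_fin_numE// ltey.
have mf1 := measurable_II_fst mf; have mf2 := measurable_II_snd mf.
pose K t r : R := ((r < t)%R%:R / (x + t) ^+ 2)%R.
have K0 t r : (0 <= K t r)%R by rewrite mulr_ge0// invr_ge0 sqr_ge0.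
have mK : measurable_fun (@I01 R `*` @I01 R) (fun p => K p.1 p.2).
  by rewrite /K; meas.
pose J := \int[mu]_(t in I01) (`|f t| * (t / (x + t) ^+ 2))%:E.
pose Q := \int[mu]_(t in I01) \int[mu]_(r in I01) (`|f r| * K t r)%:E.
pose W := \int[mu]_(t in I01) (`|f t| * (x / (x + t) ^+ 2))%:E.
have bnd t : I01 t -> [/\ (0 < x + t)%R, (0 < t)%R & (t < 1)%R].
  by move=> /I01E /andP[t0 t1]; split; lra.
have J0 : 0 <= J.
  apply: integral_ge0 => t /bnd[xt t0 t1].
  by rewrite lee_fin mulr_ge0// divr_ge0 ?sqr_ge0// ltW.
have Q1 : Q <= J + E.
  have -> : J = \int[mu]_(t in I01) \int[mu]_(r in I01) (`|f t| * K t r)%:E.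
    apply: eq_integral => t /set_mem It; rewrite /K.
    under [RHS]eq_integral do rewrite mulrA mulrAC EFinM.
    rewrite ge0_integralZl_EFin//.
    - by rewrite integral_ltr// -EFinM; congr EFin; ring.
    - by measE.
    - by rewrite mulr_ge0// invr_ge0 sqr_ge0.
  have m1 : measurable_fun I01 (fun t => \int[mu]_(r in I01) (`|f t| * K t r)%:E).
    apply: measurable_inner_I01; first by measE.
    by move=> t r _ _; rewrite lee_fin mulr_ge0.
  have m2 : measurable_fun I01 (fun t => \int[mu]_(r in I01) (`|f t - f r| * K t r)%:E).
    apply: measurable_inner_I01; first by measE.
    by move=> t r _ _; rewrite lee_fin mulr_ge0.
  have p1 t : I01 t -> 0 <= \int[mu]_(r in I01) (`|f t| * K t r)%:E.
    by move=> _; apply: integral_ge0 => r _; rewrite lee_fin mulr_ge0.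
  have p2 t : I01 t -> 0 <= \int[mu]_(r in I01) (`|f t - f r| * K t r)%:E.
    by move=> _; apply: integral_ge0 => r _; rewrite lee_fin mulr_ge0.
  rewrite /E -(ge0_integralD mu mI p1 m1 p2 m2).
  apply: le_integral_ge0 => t It.
    by apply: integral_ge0 => r _; rewrite lee_fin mulr_ge0.
  have mKt : measurable_fun I01 (K t) by rewrite /K; meas.
  have mq1 : measurable_fun I01 (fun r => (`|f t| * K t r)%:E).
    by measE.
  have mq2 : measurable_fun I01 (fun r => (`|f t - f r| * K t r)%:E).
    by measE.
  have q1 r : I01 r -> 0 <= (`|f t| * K t r)%:E by rewrite lee_fin mulr_ge0.
  have q2 r : I01 r -> 0 <= (`|f t - f r| * K t r)%:E by rewrite lee_fin mulr_ge0.
  rewrite -(ge0_integralD mu mI q1 mq1 q2 mq2).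
  apply: le_integral_ge0 => r Ir; first by rewrite lee_fin mulr_ge0.
  rewrite -EFinD lee_fin -mulrDl ler_wpM2r//.
  by rewrite -[X in (`|X| <= _)%R](subKr (f t)) (le_trans (ler_normB _ _)).
have Q2 : W + J <= Q + N.
  have -> : Q = \int[mu]_(r in I01) (`|f r| * ((x + r)^-1 - (x + 1)^-1))%:E.
    rewrite /Q tonelli_I01; first last.
    - by move=> t r _ _; rewrite lee_fin mulr_ge0.
    - by measE.
    apply: eq_integral => r /set_mem Ir.
    under [LHS]eq_integral do rewrite EFinM.
    rewrite ge0_integralZl_EFin//.
    - by rewrite /K integral_ltl.
    - by move=> t _; rewrite lee_fin.
    - by apply/measurable_EFinP; rewrite /K; meas.
  have k0 r : I01 r -> (0 <= (x + r)^-1 - (x + 1)^-1)%R.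
    move=> /bnd[xr r0 r1]; rewrite subr_ge0 lef_pV2 ?posrE//; lra.
  have mW : measurable_fun I01 (fun t => (`|f t| * (x / (x + t) ^+ 2))%:E).
    by measE.
  have mJ : measurable_fun I01 (fun t => (`|f t| * (t / (x + t) ^+ 2))%:E).
    by measE.
  have mQ : measurable_fun I01 (fun t => (`|f t| * ((x + t)^-1 - (x + 1)^-1))%:E).
    by measE.
  have mN : measurable_fun I01 (fun t => (`|f t|)%:E).
    by measE.
  have pW t : I01 t -> 0 <= (`|f t| * (x / (x + t) ^+ 2))%:E.
    by move=> /bnd[xt t0 t1]; rewrite lee_fin mulr_ge0// divr_ge0 ?sqr_ge0// ltW.
  have pJ t : I01 t -> 0 <= (`|f t| * (t / (x + t) ^+ 2))%:E.
    by move=> /bnd[xt t0 t1]; rewrite lee_fin mulr_ge0// divr_ge0 ?sqr_ge0// ltW.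
  have pQ t : I01 t -> 0 <= (`|f t| * ((x + t)^-1 - (x + 1)^-1))%:E.
    by move=> It; rewrite lee_fin mulr_ge0// k0.
  have pN t : I01 t -> 0 <= (`|f t|)%:E by rewrite lee_fin.
  rewrite /W /J /N -(ge0_integralD mu mI pW mW pJ mJ).
  rewrite -(ge0_integralD mu mI pQ mQ pN mN).
  apply: le_integral_ge0 => t It; have [xt t0 t1] := bnd _ It.
    by rewrite adde_ge0// lee_fin mulr_ge0// divr_ge0 ?sqr_ge0// ltW.
  rewrite -!EFinD lee_fin -mulrDr.
  have -> : (`|f t| * ((x + t)^-1 - (x + 1)^-1) + `|f t| =
    `|f t| * ((x + t)^-1 - (x + 1)^-1 + 1))%R by ring.
  rewrite ler_wpM2l//.
  have -> : (x / (x + t) ^+ 2 + t / (x + t) ^+ 2 = (x + t)^-1)%R.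
    by field; rewrite gt_eqF.
  rewrite -addrA lerDl addrC subr_ge0 invf_le1; lra.
(* The weight t / (x + t)^2 is at most x^-2. This crude bound degenerates as x tends to 0, but it
   only serves to make the subtraction of J legitimate. *)
have Jfin : J \is a fin_num.
  rewrite ge0_fin_numE//; apply: (@le_lt_trans _ _ ((x ^- 2)%:E * N)); last first.
    by rewrite -(fineK Nfin) -EFinM ltry.
  have mN : measurable_fun I01 (fun t => (`|f t|)%:E).
    by measE.
  have x2 : (0 <= x ^- 2)%R by rewrite invr_ge0 sqr_ge0.
  rewrite -ge0_integralZl_EFin//.
  apply: le_integral_ge0 => t /bnd[xt t0 t1].
    by rewrite lee_fin mulr_ge0// divr_ge0 ?sqr_ge0// ltW.
  rewrite -EFinM lee_fin mulrC ler_wpM2r// -[leRHS]mul1r.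
  apply: ler_pM; [exact: ltW| |exact: ltW|]; first by rewrite invr_ge0 sqr_ge0.
  rewrite lef_pV2 ?posrE ?exprn_gt0// lerXn2r ?nnegrE; lra.
have cancel (w j q n e : \bar R) : j \is a fin_num ->
    w + j <= q + n -> q <= j + e -> w <= n + e.
  move=> jf wq qe; rewrite -(leeD2rE _ _ jf); apply: (le_trans wq).
  by rewrite addeC -addeA; apply: leeD => //; rewrite addeC.
exact (cancel W J Q N E Jfin Q2 Q1).
Qed.

End Hardy.

Section HardyFull.
Context {R : realType}.
Notation mu := (@lebesgue_measure R).
Implicit Types (t r x y a : R) (f : R -> R).

Lemma measurable_I01_onem d (T : measurableType d) (f : R -> T) :
  measurable_fun I01 f -> measurable_fun I01 (fun t => f (1 - t)).
Proof.
apply: (measurable_comp_sub measurable_I01 measurable_I01 (g := fun t => 1 - t)).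
- by meas.
- by move=> t /I01E /andP[? ?]; apply/I01E; apply/andP; split; lra.
Qed.

Definition quad t : R := t * (1 - t).
Definition dmin t : R := Num.min t (1 - t).
(* The kernel of the Hardy inequality at both ends of (0, 1); x is the distance
   to the end in the other variable, and x = 0 yields the end values themselves. *)
Definition kap x t r : R :=
  (r < t)%R%:R / (x + t) ^+ 2 + (t < r)%R%:R / (x + (1 - t)) ^+ 2.

Lemma kap_ge0 x t r : 0 <= kap x t r.
Proof. by rewrite addr_ge0// mulr_ge0// invr_ge0 sqr_ge0. Qed.

Lemma quad_dmin t : 0 < t < 1 -> dmin t / 2 <= quad t <= dmin t.
Proof.
move=> /andP[t0 t1]; rewrite /quad /dmin; case: (leP t (1 - t)) => h.
  by apply/andP; split; nra.
by apply/andP; split; nra.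
Qed.

Lemma dmin_gt0 t : 0 < t < 1 -> 0 < dmin t.
Proof. by move=> /andP[t0 t1]; rewrite lt_min t0 subr_gt0. Qed.

Lemma quad_gt0 t : 0 < t < 1 -> 0 < quad t.
Proof. by move=> /andP[t0 t1]; rewrite mulr_gt0// subr_gt0. Qed.

(** [quad] and the distance to the nearer end differ by a factor of at most 2, which the square
    turns into 4. Of the two terms on the right, the one for the end nearer to t already
    suffices. *)
Lemma hardy_weight_le t y : 0 < t < 1 -> 0 < y < 1 ->
  quad y / (quad y + quad t) ^+ 2 <=
  4 * (dmin y / (dmin y + t) ^+ 2 + dmin y / (dmin y + (1 - t)) ^+ 2).
Proof.
move=> t01 y01; have /andP[y1 y2] := quad_dmin y01.
have /andP[t1 _] := quad_dmin t01; have y0 := dmin_gt0 y01.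
have qy := quad_gt0 y01; have qt := quad_gt0 t01.
have key s : 0 < s -> s <= 2 * quad t ->
    quad y / (quad y + quad t) ^+ 2 <= 4 * (dmin y / (dmin y + s) ^+ 2).
  move=> s0 st.
  have -> : 4 * (dmin y / (dmin y + s) ^+ 2) = dmin y / ((dmin y + s) / 2) ^+ 2.
    by field; rewrite gt_eqF//; lra.
  apply: ler_pM => //; first exact: ltW.
    by rewrite invr_ge0 sqr_ge0.
  by rewrite lef_pV2 ?posrE ?exprn_gt0 ?lerXn2r ?nnegrE//; lra.
have p1 s : 0 <= dmin y / (dmin y + s) ^+ 2.
  by rewrite mulr_ge0 ?invr_ge0 ?sqr_ge0// ltW.
rewrite mulrDr; move: t01 => /andP[t0 tt1].
have [th|th] := leP t (1 - t).
- apply: (le_trans (key t t0 _)); first by rewrite /quad; nra.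
  by rewrite lerDl mulr_ge0.
- apply: (le_trans (key (1 - t) _ _)); first by rewrite subr_gt0.
    by rewrite /quad; nra.
  by rewrite lerDr mulr_ge0.
Qed.

Lemma powR_nincr (p u v : R) : p <= 0 -> 0 < u -> u <= v -> v `^ p <= u `^ p.
Proof.
move=> p0 u0 uv; rewrite -[p]opprK [v `^ _]powRN [u `^ _]powRN.
have v0 : 0 < v by apply: lt_le_trans uv.
rewrite lef_pV2 ?posrE ?powR_gt0// ge0_ler_powR ?nnegrE ?oppr_ge0// ltW//.
Qed.

(** The exponent a = 2 e / 3 solves 3 (a - 1) = -4 + (1 + 2 e). For r < t the left-hand side is at
    most (x + t)^(3 (a - 1)), and since x, t and r are all at most x + t while a - 1 is negative,
    each of them can take one factor. The case t < r is its mirror image. *)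
Lemma kap_sq_le (e t r y : R) : 0 < e <= 1 -> 0 < t < 1 -> 0 < r < 1 -> 0 < y < 1 ->
  kap (dmin y) t r ^+ 2 * `|t - r| `^ (1 + 2 * e) <=
  wt (2 * e / 3) y * wt (2 * e / 3) t * wt (2 * e / 3) r.
Proof.
move=> /andP[e0 e1] t01 r01 y01; set a := 2 * e / 3; set x := dmin y.
have x0 : 0 < x := dmin_gt0 y01.
have a1 : a - 1 <= 0 by rewrite /a; lra.
have core s q : 0 < q -> q < s ->
    ((x + s) ^+ 2)^-1 ^+ 2 * (s - q) `^ (1 + 2 * e) <=
    x `^ (a - 1) * s `^ (a - 1) * q `^ (a - 1).
  move=> q0 qs; have s0 : 0 < s by apply: lt_trans qs.
  have xs : 0 < x + s by lra.
  apply: (@le_trans _ _ ((x + s) `^ (- 4%:R) * (x + s) `^ (1 + 2 * e))).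
    apply: ler_pM; rewrite ?sqr_ge0 ?powR_ge0//.
      rewrite powR_invn ?(ltW xs)//; apply: eqW_le.
      by field; rewrite gt_eqF.
    rewrite ge0_ler_powR ?nnegrE//; lra.
  rewrite -powRD; last by rewrite (gt_eqF xs) implybT.
  rewrite (_ : - 4%:R + (1 + 2 * e) = (a - 1) + (a - 1) + (a - 1)); last first.
    by rewrite /a; field.
  rewrite powRD; last by rewrite (gt_eqF xs) implybT.
  rewrite powRD; last by rewrite (gt_eqF xs) implybT.
  apply: ler_pM; rewrite ?mulr_ge0 ?powR_ge0//; last by apply: powR_nincr => //; lra.
  by apply: ler_pM; rewrite ?powR_ge0//; apply: powR_nincr => //; lra.
have wx : x `^ (a - 1) <= wt a y.
  rewrite /x /dmin /wt; case: (leP y (1 - y)) => _; first by rewrite lerDl powR_ge0.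
  by rewrite lerDr powR_ge0.
have fin s s' q q' : 0 <= s `^ (a - 1) -> s `^ (a - 1) <= s' -> q `^ (a - 1) <= q' ->
    x `^ (a - 1) * s `^ (a - 1) * q `^ (a - 1) <= wt a y * s' * q'.
  move=> sp ss qq; apply: ler_pM; rewrite ?mulr_ge0 ?powR_ge0//.
  by apply: ler_pM; rewrite ?powR_ge0.
have w1 s : s `^ (a - 1) <= wt a s by rewrite lerDl powR_ge0.
have w2 s : (1 - s) `^ (a - 1) <= wt a s by rewrite lerDr powR_ge0.
move: t01 r01 => /andP[t0 t1] /andP[r0 r1].
rewrite /kap; have [rt|tr|->] := ltgtP r t.
- rewrite mul1r mul0r addr0 gtr0_norm ?subr_gt0//.
  by apply: (le_trans (core _ _ r0 rt)); apply: fin; rewrite ?powR_ge0.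
- rewrite mul1r mul0r add0r ltr0_norm ?subr_lt0//.
  have -> : - (t - r) = (1 - t) - (1 - r) by ring.
  apply: (le_trans (core _ _ _ _)); [lra|lra|].
  by apply: fin; rewrite ?powR_ge0.
- by rewrite !mul0r addr0 expr0n/= mul0r !mulr_ge0 ?wt_ge0.
Qed.

Local Open Scope ereal_scope.

Lemma hardy_half_onem (f : R -> R) x : (0 < x)%R -> measurable_fun I01 f ->
  \int[mu]_(t in I01) (`|f t| * (x / (x + (1 - t)) ^+ 2))%:E <=
  \int[mu]_(t in I01) (`|f t|)%:E +
  \int[mu]_(t in I01) \int[mu]_(r in I01)
     (`|f t - f r| * ((t < r)%R%:R / (x + (1 - t)) ^+ 2))%:E.
Proof.
move=> x0 mf; have := hardy_half x0 (measurable_I01_onem mf).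
have mf1 := measurable_II_fst mf; have mf2 := measurable_II_snd mf.
have mG : measurable_fun (@I01 R `*` @I01 R) (fun p =>
    (`|f p.1 - f p.2| * ((p.1 < p.2)%R%:R / (x + (1 - p.1)) ^+ 2))%:E) by measE.
have G0 t r : 0 <= (`|f t - f r| * ((t < r)%R%:R / (x + (1 - t)) ^+ 2))%:E.
  by rewrite lee_fin mulr_ge0// mulr_ge0// invr_ge0 sqr_ge0.
have onemK t : (1 - (1 - t) = t :> R)%R by rewrite opprB addrCA subrr addr0.
have -> : \int[mu]_(t in I01) (`|f (1 - t)| * (x / (x + t) ^+ 2))%:E =
    \int[mu]_(t in I01) (`|f t| * (x / (x + (1 - t)) ^+ 2))%:E.
  rewrite -[RHS]integral_I01_onem; first by apply: eq_integral => t _; rewrite onemK.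
  - by measE.
  - by move=> t _; rewrite lee_fin mulr_ge0// mulr_ge0 ?invr_ge0 ?sqr_ge0// ltW.
have -> : \int[mu]_(t in I01) (`|f (1 - t)|)%:E = \int[mu]_(t in I01) (`|f t|)%:E.
  by rewrite -[RHS]integral_I01_onem//; measE.
have -> // : \int[mu]_(t in I01) \int[mu]_(r in I01)
      (`|f (1 - t) - f (1 - r)| * ((r < t)%R%:R / (x + t) ^+ 2))%:E =
    \int[mu]_(t in I01) \int[mu]_(r in I01)
      (`|f t - f r| * ((t < r)%R%:R / (x + (1 - t)) ^+ 2))%:E.
  rewrite -[RHS]integral_I01_onem; first last.
  - by move=> t _; apply: integral_ge0.
  - by apply: measurable_inner_I01.
  apply: eq_integral => t /set_mem It; rewrite -[RHS]integral_I01_onem//.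
    by apply: eq_integral => r _; rewrite onemK ltrD2l ltrN2.
  by measE.
Qed.

Let lin_arith (n g1 g2 k1 k2 : \bar R) : 0 <= n -> 0 <= k1 -> 0 <= k2 ->
  g1 <= n + k1 -> g2 <= n + k2 ->
  4%:E * (g1 + g2) <= 8%:E * n + 4%:E * (k1 + k2).
Proof.
move=> n0 k10 k20 g1n g2n.
have -> : 8%:E * n = 4%:E * (n + n).
  rewrite ge0_muleDr// -ge0_muleDl ?lee_fin// -EFinD; congr (_%:E * _); ring.
by rewrite -ge0_muleDr ?adde_ge0// lee_pmul2l// addeACA; exact: leeD.
Qed.

(** The constants combine the factor 4 of [hardy_weight_le] with one L^1 norm from each end. They do
    not depend on y, so the inequality can be integrated over all lines. *)
Lemma hardy_full (f : R -> R) y : I01 y -> measurable_fun I01 f ->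
  \int[mu]_(t in I01) (`|f t| * (quad y / (quad y + quad t) ^+ 2))%:E <=
  8%:E * \int[mu]_(t in I01) (`|f t|)%:E +
  4%:E * \int[mu]_(t in I01) \int[mu]_(r in I01)
     (`|f t - f r| * kap (dmin y) t r)%:E.
Proof.
move=> /I01E y01 mf; have mI := @measurable_I01 R.
have x0 := dmin_gt0 y01; set x := dmin y in x0 *.
have mf1 := measurable_II_fst mf; have mf2 := measurable_II_snd mf.
have H1 := hardy_half x0 mf; have H2 := hardy_half_onem x0 mf.
pose g1 t : R := (`|f t| * (x / (x + t) ^+ 2))%R.
pose g2 t : R := (`|f t| * (x / (x + (1 - t)) ^+ 2))%R.
pose k1 t r : R := (`|f t - f r| * ((r < t)%R%:R / (x + t) ^+ 2))%R.
pose k2 t r : R := (`|f t - f r| * ((t < r)%R%:R / (x + (1 - t)) ^+ 2))%R.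
have g10 t : I01 t -> 0 <= (g1 t)%:E.
  by move=> _; rewrite lee_fin mulr_ge0// mulr_ge0 ?invr_ge0 ?sqr_ge0// ltW.
have g20 t : I01 t -> 0 <= (g2 t)%:E.
  by move=> _; rewrite lee_fin mulr_ge0// mulr_ge0 ?invr_ge0 ?sqr_ge0// ltW.
have k10 t r : 0 <= (k1 t r)%:E.
  by rewrite lee_fin mulr_ge0// mulr_ge0// invr_ge0 sqr_ge0.
have k20 t r : 0 <= (k2 t r)%:E.
  by rewrite lee_fin mulr_ge0// mulr_ge0// invr_ge0 sqr_ge0.
have mg1 : measurable_fun I01 (fun t => (g1 t)%:E) by rewrite /g1; measE.
have mg2 : measurable_fun I01 (fun t => (g2 t)%:E) by rewrite /g2; measE.
have mk1 : measurable_fun (@I01 R `*` @I01 R) (fun p => (k1 p.1 p.2)%:E).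
  by rewrite /k1; measE.
have mk2 : measurable_fun (@I01 R `*` @I01 R) (fun p => (k2 p.1 p.2)%:E).
  by rewrite /k2; measE.
have mK1 := measurable_inner_I01 mk1 (fun t r _ _ => k10 t r).
have mK2 := measurable_inner_I01 mk2 (fun t r _ _ => k20 t r).
have K10 t : I01 t -> 0 <= \int[mu]_(r in I01) (k1 t r)%:E.
  by move=> _; exact: integral_ge0.
have K20 t : I01 t -> 0 <= \int[mu]_(r in I01) (k2 t r)%:E.
  by move=> _; exact: integral_ge0.
apply: (@le_trans _ _ (4%:E * (\int[mu]_(t in I01) (g1 t)%:E + \int[mu]_(t in I01) (g2 t)%:E))).
  rewrite -(ge0_integralD mu mI g10 mg1 g20 mg2).
  rewrite -ge0_integralZl_EFin//; first last.
  - exact: emeasurable_funD.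
  - by move=> t It; rewrite adde_ge0// ?g10// g20.
  apply: le_integral_ge0 => t /I01E t01.
    rewrite lee_fin mulr_ge0// mulr_ge0 ?invr_ge0 ?sqr_ge0// ltW//.
    exact: quad_gt0.
  rewrite -EFinD -EFinM lee_fin /g1 /g2 -mulrDr [leRHS]mulrCA ler_wpM2l//.
  exact: hardy_weight_le.
have -> : \int[mu]_(t in I01) \int[mu]_(r in I01) (`|f t - f r| * kap x t r)%:E =
    \int[mu]_(t in I01) \int[mu]_(r in I01) (k1 t r)%:E +
    \int[mu]_(t in I01) \int[mu]_(r in I01) (k2 t r)%:E.
  rewrite -(ge0_integralD mu mI K10 mK1 K20 mK2).
  apply: eq_integral => t /set_mem It.
  have mkt1 : measurable_fun I01 (fun r => (k1 t r)%:E) by rewrite /k1; measE.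
  have mkt2 : measurable_fun I01 (fun r => (k2 t r)%:E) by rewrite /k2; measE.
  rewrite -(ge0_integralD mu mI (fun r _ => k10 t r) mkt1 (fun r _ => k20 t r) mkt2).
  by apply: eq_integral => r _; rewrite -EFinD /k1 /k2 -mulrDr.
have N0 : 0 <= \int[mu]_(t in I01) (`|f t|)%:E by apply: integral_ge0.
have K1_ge0 : 0 <= \int[mu]_(t in I01) \int[mu]_(r in I01) (k1 t r)%:E.
  exact: integral_ge0.
have K2_ge0 : 0 <= \int[mu]_(t in I01) \int[mu]_(r in I01) (k2 t r)%:E.
  exact: integral_ge0.
have := lin_arith N0 K1_ge0 K2_ge0.
move=> /(_ (\int[mu]_(t in I01) (g1 t)%:E) (\int[mu]_(t in I01) (g2 t)%:E)).
move=> /(_ H1 H2) H; exact H.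
Qed.

End HardyFull.

(** * Hardy inequalities on the square *)

Section Pairing.
Context {R : realType}.
Notation mu := (@lebesgue_measure R).
Implicit Types (t r x y a e : R) (j : 'I_2) (z : R * R) (u : R * R -> R).

Definition semi_sq j e u : \bar R :=
  T3 (fun z r => ((u z - u (setc j z r)) ^+ 2 / `|xcoord j z - r| `^ (1 + 2 * e))%:E).

Lemma measurable_semi_sq j e u : measurable_fun Qhat u ->
  measurable_fun QI (fun p : R * R * R =>
    ((u p.1 - u (setc j p.1 p.2)) ^+ 2 / `|xcoord j p.1 - p.2| `^ (1 + 2 * e))%:E).
Proof.
move=> mu; have m1 := measurable_QI_fst mu; have m2 := measurable_QI_setc j mu.
by measE.
Qed.

Lemma semi_sq_ge0 j e u : (0 <= semi_sq j e u)%E.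
Proof.
by apply: T3_ge0 => z r _ _; rewrite lee_fin mulr_ge0 ?sqr_ge0// invr_ge0 powR_ge0.
Qed.

Lemma AHs_seminormE j e u : measurable_fun Qhat u ->
  AHs_seminorm j e u = sqrte (semi_sq j e u).
Proof.
move=> mu_; rewrite /AHs_seminorm /semi_sq; congr sqrte.
rewrite (T3_fiber j (measurable_semi_sq j e mu_)); last first.
  by move=> z r _ _; rewrite lee_fin mulr_ge0 ?sqr_ge0// invr_ge0 powR_ge0.
apply: eq_integral => y _; apply: eq_integral => t _; apply: eq_integral => r _.
by rewrite setc_mkpt xcoord_mkpt.
Qed.

(** Pointwise Young inequality d k <= l d^2 / H + k^2 H / l with H = |t - r|^(1 + 2 e) and d the
    increment of [u]. The parameter l stays free, to be optimised by [lin_of_quad]. *)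
Lemma T3_pairing j e u (k : R * R -> R -> R) (l : R) : 0 < l ->
  measurable_fun Qhat u -> measurable_fun QI (fun p => k p.1 p.2) ->
  (forall z r, 0 <= k z r) ->
  (T3 (fun z r => (`|u z - u (setc j z r)| * k z r)%:E) <=
   l%:E * semi_sq j e u +
   (l^-1)%:E * T3 (fun z r => (k z r ^+ 2 * `|xcoord j z - r| `^ (1 + 2 * e))%:E))%E.
Proof.
move=> l0 mu_ mk k0; have ms := measurable_semi_sq j e mu_.
have m1 := measurable_QI_fst mu_; have m2 := measurable_QI_setc j mu_.
have mkk : measurable_fun QI (fun p =>
   (k p.1 p.2 ^+ 2 * `|xcoord j p.1 - p.2| `^ (1 + 2 * e))%:E) by measE.
have p1 z r : Qhat z -> I01 r ->
    (0 <= ((u z - u (setc j z r)) ^+ 2 / `|xcoord j z - r| `^ (1 + 2 * e))%:E)%E.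
  by move=> _ _; rewrite lee_fin mulr_ge0 ?sqr_ge0// invr_ge0 powR_ge0.
have p2 z r : Qhat z -> I01 r ->
    (0 <= (k z r ^+ 2 * `|xcoord j z - r| `^ (1 + 2 * e))%:E)%E.
  by move=> _ _; rewrite lee_fin mulr_ge0 ?sqr_ge0// powR_ge0.
rewrite /semi_sq -(T3Z (ltW l0) ms p1).
have li0 : 0 <= l^-1 by rewrite invr_ge0 ltW.
rewrite -(T3Z li0 mkk p2) -T3D; first last.
- by move=> z r Qz Ir; rewrite mule_ge0// p2.
- by move=> z r Qz Ir; rewrite mule_ge0 ?p1// lee_fin ltW.
- exact: measurable_funeM.
- exact: measurable_funeM.
apply: T3_le => z r Qz Ir; first by rewrite lee_fin mulr_ge0.
rewrite -!EFinM -EFinD lee_fin.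
set H := _ `^ _; set D := u z - _.
(* On the diagonal, where one cannot divide by H, the increment of [u] is 0. *)
have [h0|h0] := eqVneq (xcoord j z) r.
  rewrite /D -h0 setcK subrr normr0 mul0r addr_ge0//.
    by rewrite mulr_ge0 ?(ltW l0)// expr0n/= mul0r.
  by rewrite mulr_ge0// mulr_ge0 ?sqr_ge0// powR_ge0.
have Hp : 0 < H by rewrite powR_gt0// normr_gt0 subr_eq0.
rewrite -(real_normK (num_real D)).
have : 0 <= `|D| by []; have := k0 z r; move: (`|D|) (k z r) => d q q0 d0.
rewrite -subr_ge0.
have -> : l * (d ^+ 2 / H) + l^-1 * (q ^+ 2 * H) - d * q =
    ((l * d) ^+ 2 + (q * H) ^+ 2 - (l * d) * (q * H)) / (l * H).
  by field; rewrite !gt_eqF.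
rewrite divr_ge0//; last by rewrite mulr_ge0 ?ltW.
by have := sqr_ge0 (l * d - q * H); have := sqr_ge0 (l * d + q * H); nra.
Qed.

(* dominates the j-th partial derivative of the liftings (lift_grad_le) *)
Definition hardyw j z : R :=
  quad (xcoord (rev_ord j) z) /
    (quad (xcoord (rev_ord j) z) + quad (xcoord j z)) ^+ 2.

Definition kapQ j z r : R := kap (dmin (xcoord (rev_ord j) z)) (xcoord j z) r.

Lemma measurable_dmin : measurable_fun setT (@dmin R).
Proof. by apply: measurable_minr; meas. Qed.

Lemma measurable_kapQ j : measurable_fun QI (fun p => kapQ j p.1 p.2).
Proof.
have md : measurable_fun QI (fun p : R * R * R => dmin (xcoord (rev_ord j) p.1)).
  by apply: (measurableT_comp measurable_dmin); meas.
by rewrite /kapQ /kap; meas.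
Qed.

Lemma kapQ_ge0 j z r : 0 <= kapQ j z r. Proof. exact: kap_ge0. Qed.

Lemma measurable_hardyw j D : measurable_fun D (hardyw j).
Proof. by rewrite /hardyw /quad; meas. Qed.

Lemma hardyw_ge0 j z : Qhat z -> 0 <= hardyw j z.
Proof.
move=> Qz; rewrite mulr_ge0// ?invr_ge0 ?sqr_ge0//.
by apply/ltW/quad_gt0/I01E; exact: Qhat_xcoord.
Qed.

Lemma hardyw_mkpt j t y :
  hardyw j (mkpt j t y) = quad y / (quad y + quad t) ^+ 2.
Proof. by rewrite /hardyw xcoord_mkpt xcoord_mkpt_rev. Qed.

Lemma kapQ_mkpt j t y r : kapQ j (mkpt j t y) r = kap (dmin y) t r.
Proof. by rewrite /kapQ xcoord_mkpt xcoord_mkpt_rev. Qed.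

Local Open Scope ereal_scope.

Lemma integral_wt_scale a c : (0 < a)%R -> (0 <= c)%R ->
  \int[mu]_(t in I01) (c * wt a t)%:E <= (c * (2 / a))%:E.
Proof.
move=> a0 c0; under eq_integral do rewrite EFinM.
rewrite ge0_integralZl_EFin//.
- by rewrite EFinM lee_wpmul2l ?lee_fin//; exact: integral_wt.
- exact: measurable_I01.
- by move=> t _; rewrite lee_fin wt_ge0.
- by apply/measurable_EFinP; exact: measurable_wt.
Qed.

Lemma T3_wt j a : (0 < a)%R ->
  T3 (fun z r => (wt a (xcoord (rev_ord j) z) * wt a (xcoord j z) * wt a r)%:E)
  <= ((2 / a) ^+ 3)%:E.
Proof.
move=> a0; rewrite (T3_fiber j); first last.
- by move=> z r _ _; rewrite lee_fin !mulr_ge0 ?wt_ge0.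
- by measE.
have a2 : (0 <= 2 / a)%R by rewrite divr_ge0// ltW.
apply: (@le_trans _ _ (\int[mu]_(y in I01) ((2 / a) * (2 / a) * wt a y)%:E)).
  apply: le_integral_ge0 => y _.
    by do 2 (apply: integral_ge0 => ? _); rewrite lee_fin !mulr_ge0 ?wt_ge0.
  apply: (@le_trans _ _ (\int[mu]_(t in I01) ((2 / a) * wt a y * wt a t)%:E)).
    apply: le_integral_ge0 => t _.
      by apply: integral_ge0 => ? _; rewrite lee_fin !mulr_ge0 ?wt_ge0.
    rewrite xcoord_mkpt xcoord_mkpt_rev.
    apply: (le_trans (integral_wt_scale a0 _)); first by rewrite mulr_ge0 ?wt_ge0.
    by rewrite lee_fin; apply: eqW_le; ring.
  apply: (le_trans (integral_wt_scale a0 _)); first by rewrite mulr_ge0 ?wt_ge0.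
  by rewrite lee_fin; apply: eqW_le; ring.
apply: (le_trans (integral_wt_scale a0 _)); first by rewrite mulr_ge0.
by rewrite lee_fin; apply: eqW_le; ring.
Qed.

Lemma T3_kapQ_sq j e : (0 < e <= 1)%R ->
  T3 (fun z r => (kapQ j z r ^+ 2 * `|xcoord j z - r| `^ (1 + 2 * e))%:E)
  <= ((3 / e) ^+ 3)%:E.
Proof.
move=> /andP[e0 e1]; have a0 : (0 < 2 * e / 3)%R by lra.
(* Each of the three integrals of [wt a] with a = 2 e / 3 is at most 2 / a = 3 / e. *)
have -> : (3 / e = 2 / (2 * e / 3) :> R)%R by field; rewrite gt_eqF.
apply: le_trans (T3_wt j a0); apply: T3_le => z r Qz Ir.
  by rewrite lee_fin mulr_ge0 ?sqr_ge0// powR_ge0.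
rewrite lee_fin; apply: kap_sq_le; first by rewrite e0 e1.
- by apply/I01E; exact: Qhat_xcoord.
- exact/I01E.
- by apply/I01E; exact: Qhat_xcoord.
Qed.

Lemma T3_kapQ j e u : (0 < e <= 1)%R -> measurable_fun Qhat u ->
  T3 (fun z r => (`|u z - u (setc j z r)| * kapQ j z r)%:E) <=
  (1 + (3 / e) ^+ 3)%:E * AHs_seminorm j e u.
Proof.
move=> e01 mu_; rewrite AHs_seminormE//; move: (e01) => /andP[e0 _].
apply: lin_of_quad; first exact: semi_sq_ge0.
  by rewrite exprn_ge0// divr_ge0// ltW.
move=> l l0; apply: (le_trans (T3_pairing j e l0 mu_ (measurable_kapQ j) (@kapQ_ge0 j))).
apply: leeD => //.
rewrite [leRHS](_ : _ = (l^-1)%:E * ((3 / e) ^+ 3)%:E); last by rewrite -EFinM mulrC.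
rewrite lee_wpmul2l ?lee_fin ?invr_ge0 ?(ltW l0)//.
exact: T3_kapQ_sq.
Qed.

Lemma T3_diff j e u : (0 < e <= 1)%R -> measurable_fun Qhat u ->
  T3 (fun z r => (`|u z - u (setc j z r)|)%:E) <= 2%:E * AHs_seminorm j e u.
Proof.
move=> /andP[e0 e1] mu_; rewrite AHs_seminormE//.
have -> : (2 = 1 + 1 :> R)%R by [].
apply: lin_of_quad; [exact: semi_sq_ge0|by []|move=> l l0].
have m1 : measurable_fun QI (fun p : R * R * R => (fun _ _ => 1%R : R) p.1 p.2) by meas.
have H := T3_pairing j e l0 mu_ m1 (fun _ _ => ler01).
rewrite (_ : T3 _ = T3 (fun z r => (`|u z - u (setc j z r)| * 1)%:E)); last first.
  by apply: eq_integral => z _; apply: eq_integral => r _; rewrite mulr1.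
apply: (le_trans H); apply: leeD => //.
rewrite [leRHS](_ : _ = (l^-1)%:E * 1%:E); last by rewrite -EFinM mul1r mulr1.
rewrite lee_wpmul2l ?lee_fin ?invr_ge0 ?(ltW l0)//.
apply: (@le_trans _ _ (T3 (fun _ _ => 1))).
  apply: T3_le => z r Qz Ir; first by rewrite lee_fin mulr_ge0 ?sqr_ge0 ?powR_ge0.
  rewrite lee_fin expr1n mul1r -[leRHS](powRr0 (`|xcoord j z - r|)%R).
  have [h0|h0] := eqVneq (xcoord j z) r.
    by rewrite h0 subrr normr0 powR0 ?powRr0//; lra.
  apply: ger_powR; last lra.
  rewrite normr_gt0 subr_eq0 h0/= ler_norml.
  move: (Qhat_xcoord j Qz) Ir => /I01E /andP[? ?] /I01E /andP[? ?].
  by apply/andP; split; lra.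
rewrite (T3_fiber ord0)//.
have mI := @measurable_I01 R.
have I1 : \int[mu]_(r in I01) 1 = 1.
  by rewrite (integral_cst mu mI 1) mul1e; exact mu_I01.
by under eq_integral do (under eq_integral do rewrite I1; rewrite I1); rewrite I1.
Qed.

End Pairing.

Section Hardy2D.
Context {R : realType}.
Notation mu := (@lebesgue_measure R).
Implicit Types (t r x y a e : R) (j : 'I_2) (z : R * R) (u g : R * R -> R).
Local Open Scope ereal_scope.

Lemma measurable_fiber d (T : measurableType d) j y (u : R * R -> T) : I01 y ->
  measurable_fun Qhat u -> measurable_fun I01 (fun t => u (mkpt j t y)).
Proof.
move=> Iy; apply: (measurable_comp_sub measurable_I01 measurable_Qhat
  (g := fun t => mkpt j t y)).
- by apply: measurable_mkptT; [exact: measurable_id|exact: measurable_cst].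
- by move=> t It; exact/QhatE.
Qed.

Lemma measurable_fiber_integral j (F : R * R -> \bar R) :
  measurable_fun Qhat F -> (forall z, Qhat z -> 0 <= F z) ->
  measurable_fun I01 (fun y => \int[mu]_(t in I01) F (mkpt j t y)).
Proof.
move=> mF F0.
apply: (measurable_inner_I01 (f := fun y t => F (mkpt j t y))).
  move: mF; apply: (measurable_comp_sub measurable_II measurable_Qhat
    (g := fun p => mkpt j p.2 p.1)).
  - by apply: measurable_mkptT; [exact: measurable_snd|exact: measurable_fst].
  - by move=> p [? ?]; exact/QhatE.
by move=> y t Iy It; apply/F0/QhatE.
Qed.

Lemma measurable_norm d (T : measurableType d) (D : set T) (f : T -> R) :
  measurable_fun D f -> measurable_fun D (fun p => `|f p|%R).
Proof. by move=> mf; meas. Qed.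

Lemma measurable_inner_kapQ j u : measurable_fun Qhat u ->
  measurable_fun QI (fun p => (`|u p.1 - u (setc j p.1 p.2)| * kapQ j p.1 p.2)%:E).
Proof.
move=> mu_; have m1 := measurable_QI_fst mu_; have m2 := measurable_QI_setc j mu_.
by have m3 := @measurable_kapQ R j; measE.
Qed.

Lemma hardy2D j u : measurable_fun Qhat u ->
  \int[leb2]_(z in Qhat) (`|u z| * hardyw j z)%:E <=
  8%:E * \int[leb2]_(z in Qhat) (`|u z|)%:E +
  4%:E * T3 (fun z r => (`|u z - u (setc j z r)| * kapQ j z r)%:E).
Proof.
move=> mu_; have mw := @measurable_hardyw R j Qhat.
have mk := measurable_inner_kapQ j mu_.
have k0 z r : Qhat z -> I01 r ->
    0 <= (`|u z - u (setc j z r)| * kapQ j z r)%:E.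
  by move=> _ _; rewrite lee_fin mulr_ge0// kapQ_ge0.
have ma : measurable_fun Qhat (fun z => (`|u z|)%:E).
  exact/measurable_EFinP/measurable_norm.
have a0 z : Qhat z -> 0 <= (`|u z|)%:E by rewrite lee_fin.
have maw : measurable_fun Qhat (fun z => (`|u z| * hardyw j z)%:E).
  by measE.
have aw0 z : Qhat z -> 0 <= (`|u z| * hardyw j z)%:E.
  by move=> Qz; rewrite lee_fin mulr_ge0// hardyw_ge0.
have mI := @measurable_I01 R.
have mK := measurable_inner_QI mk k0.
have K0 z : Qhat z ->
    0 <= \int[mu]_(r in I01) (`|u z - u (setc j z r)| * kapQ j z r)%:E.
  by move=> Qz; apply: integral_ge0 => r; exact: k0.
rewrite (integral_Qhat j maw aw0) (integral_Qhat j ma a0) (T3_fiber j mk k0).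
have mA := measurable_fiber_integral j ma a0.
have mB := measurable_fiber_integral j mK K0.
have A0 y : I01 y -> 0 <= \int[mu]_(t in I01) (`|u (mkpt j t y)|)%:E.
  by move=> _; apply: integral_ge0 => t _; rewrite lee_fin.
have B0 y : I01 y -> 0 <= \int[mu]_(t in I01) \int[mu]_(r in I01)
    (`|u (mkpt j t y) - u (setc j (mkpt j t y) r)| * kapQ j (mkpt j t y) r)%:E.
  by move=> Iy; apply: integral_ge0 => t It; apply/K0/QhatE.
rewrite -(ge0_integralZl_EFin mu mI A0 mA (ler0n _ 8)).
rewrite -(ge0_integralZl_EFin mu mI B0 mB (ler0n _ 4)).
rewrite -ge0_integralD//; first last.
- exact: measurable_funeM.
- by move=> y Iy; rewrite mule_ge0// ?lee_fin// B0.
- exact: measurable_funeM.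
- by move=> y Iy; rewrite mule_ge0// ?lee_fin// A0.
apply: le_integral_ge0 => y Iy.
  by apply: integral_ge0 => t It; apply/aw0/QhatE.
have mfy := measurable_fiber j Iy mu_.
have H := hardy_full Iy mfy.
have mono : \int[mu]_(t in I01) \int[mu]_(r in I01)
      (`|u (mkpt j t y) - u (mkpt j r y)| * kap (dmin y) t r)%:E <=
    \int[mu]_(t in I01) \int[mu]_(r in I01)
      (`|u (mkpt j t y) - u (setc j (mkpt j t y) r)| * kapQ j (mkpt j t y) r)%:E.
  apply: le_integral_ge0 => t It.
    by apply: integral_ge0 => r _; rewrite lee_fin mulr_ge0// kap_ge0.
  apply: le_integral_ge0 => r _; first by rewrite lee_fin mulr_ge0// kap_ge0.
  by rewrite kapQ_mkpt setc_mkpt.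
have H4 := lee_wpmul2l (ler0n _ 4 : 0 <= 4%:E :> \bar R) mono.
under eq_integral do rewrite hardyw_mkpt.
exact (le_trans H (leeD2l _ H4)).
Qed.

(** Young's inequality |u| <= l u^2 + 1 / l on a square of measure 1. The constant 2 is the 1 + B of
    [lin_of_quad] with B = 1. *)
Lemma L1_le_L2 u : measurable_fun Qhat u ->
  \int[leb2]_(z in Qhat) (`|u z|)%:E <= 2%:E * L2norm u.
Proof.
move=> mu_; rewrite /L2norm; have -> : (2 = 1 + 1 :> R)%R by [].
have s0 : 0 <= L2sq u by apply: integral_ge0 => z _; rewrite lee_fin sqr_ge0.
apply: lin_of_quad => // l l0.
have mQ := @measurable_Qhat R.
have ms : measurable_fun Qhat (fun z => ((u z) ^+ 2)%:E).
  exact/measurable_EFinP/measurable_funX.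
have q0 z : Qhat z -> 0 <= ((u z) ^+ 2)%:E by rewrite lee_fin sqr_ge0.
have I1 : \int[leb2]_(z in Qhat) (l^-1)%:E = (1 / l)%:E.
  have p0 z : Qhat z -> 0 <= (cst (l^-1)%:E : R * R -> \bar R) z.
    by move=> _; rewrite lee_fin invr_ge0 ltW.
  rewrite (integral_Qhat ord0 (measurable_cst _) p0) /=.
  have mI := @measurable_I01 R.
  have J1 c : \int[mu]_(t in I01) c%:E = c%:E :> \bar R.
    by rewrite (integral_cst mu mI c%:E); rewrite -[RHS]mule1; congr (_ * _); exact mu_I01.
  by under eq_integral do rewrite J1; rewrite J1 mul1r.
rewrite /L2sq -I1 -(ge0_integralZl_EFin leb2 mQ q0 ms (ltW l0)).
rewrite -ge0_integralD//; first last.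
- by move=> z _; rewrite lee_fin invr_ge0 ltW.
- exact: measurable_funeM.
- by move=> z Qz; rewrite mule_ge0 ?q0// lee_fin ltW.
apply: le_integral_ge0 => z _; first by rewrite lee_fin.
rewrite -EFinM -EFinD lee_fin -(real_normK (num_real (u z))).
have : (0 <= `|u z|)%R by []; move: `|u z|%R => d d0.
rewrite -subr_ge0.
have -> : (l * d ^+ 2 + l^-1 - d = ((l * d) ^+ 2 + 1 - l * d) / l)%R.
  by field; rewrite gt_eqF.
rewrite divr_ge0//; last exact: ltW.
by have := sqr_ge0 (l * d - 1)%R; have := sqr_ge0 (l * d)%R; nra.
Qed.

Lemma hardy_pairing j e u : (0 < e <= 1)%R -> measurable_fun Qhat u ->
  \int[leb2]_(z in Qhat) (`|u z| * hardyw j z)%:E <=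
  (16 + 4 * (1 + (3 / e) ^+ 3))%:E * (L2norm u + AHs_seminorm j e u).
Proof.
move=> e01 mu_; apply: (le_trans (hardy2D j mu_)).
have C0 : (0 <= (3 / e) ^+ 3)%R.
  by rewrite exprn_ge0// divr_ge0//; case/andP: e01 => /ltW.
have n0 : 0 <= L2norm u by exact: sqrte_ge0.
have A0 : 0 <= AHs_seminorm j e u by exact: sqrte_ge0.
apply: (@le_trans _ _ (8%:E * (2%:E * L2norm u) +
   4%:E * ((1 + (3 / e) ^+ 3)%:E * AHs_seminorm j e u))).
  apply: leeD; rewrite lee_wpmul2l ?lee_fin//; [exact: L1_le_L2|exact: T3_kapQ].
rewrite !muleA -!EFinM ge0_muleDr//; apply: leeD; rewrite lee_wpmul2r// lee_fin; lra.
Qed.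

End Hardy2D.

(** * Pairings with functions of mean zero on lines *)

Section MeanFree.
Context {R : realType}.
Notation mu := (@lebesgue_measure R).
Implicit Types (t r x y a e M : R) (j : 'I_2) (z : R * R) (u G : R * R -> R).
Local Open Scope ereal_scope.

Lemma integral_I01_cst (c : \bar R) : \int[mu]_(t in I01) c = c.
Proof.
have mI := @measurable_I01 R.
by rewrite (integral_cst mu mI c) -[RHS]mule1; congr (_ * _); exact mu_I01.
Qed.

(** For fixed t the functions r -> f t - f r and -f differ by a constant, so the L^1 norm of the
    former is infinite too. This settles the case in which f has no mean. *)
Lemma integral_abs_sub_infty (f : R -> R) : measurable_fun I01 f ->
  \int[mu]_(t in I01) (`|f t|)%:E = +oo ->
  \int[mu]_(t in I01) \int[mu]_(r in I01) (`|f t - f r|)%:E = +oo.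
Proof.
move=> mf N; have mI := @measurable_I01 R.
have D t : \int[mu]_(r in I01) (`|f t - f r|)%:E = +oo.
  have m1 : measurable_fun I01 (fun r => (`|f t - f r|)%:E) by measE.
  have p1 r : I01 r -> 0 <= (`|f t - f r|)%:E by rewrite lee_fin.
  have p2 r : I01 r -> 0 <= (cst (`|f t|)%:E : R -> \bar R) r by rewrite lee_fin.
  have H : \int[mu]_(r in I01) (`|f r|)%:E <=
      \int[mu]_(r in I01) (`|f t - f r|)%:E + (`|f t|)%:E.
    rewrite -[X in _ <= _ + X]integral_I01_cst.
    rewrite -(ge0_integralD mu mI p1 m1 p2 (measurable_cst _)).
    apply: le_integral_ge0 => r _; first by rewrite lee_fin.
    rewrite /= -EFinD lee_fin -[X in (`|X| <= _)%R](subKr (f t)).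
    by rewrite [leRHS]addrC (le_trans (ler_normB _ _)).
  move: H; rewrite N leye_eq => /eqP.
  by case: (\int[mu]_(r in I01) _).
by rewrite (eq_integral (cst +oo)) ?integral_I01_cst.
Qed.

(** As the interval has measure 1, f t minus the mean is the average of f t - f r over r. *)
Lemma integral_sub_mean_le (f : R -> R) :
  mu.-integrable I01 (EFin \o f) ->
  \int[mu]_(t in I01) (`|f t - \int[mu]_(r in I01) f r|)%R%:E <=
  \int[mu]_(t in I01) \int[mu]_(r in I01) (`|f t - f r|)%:E.
Proof.
move=> fi; have mI := @measurable_I01 R.
have mf : measurable_fun I01 f by apply/measurable_EFinP; exact: measurable_int fi.
apply: le_integral_ge0 => t It; first by rewrite lee_fin.
have ci : mu.-integrable I01 (EFin \o cst (f t)).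
  apply/integrableP; split; first exact/measurable_EFinP/measurable_cst.
  by rewrite (_ : (fun _ => _) = cst (`|f t|)%:E)// integral_I01_cst ltry.
have -> : (f t - \int[mu]_(r in I01) f r = \int[mu]_(r in I01) (f t - f r))%R.
  rewrite (@RintegralB _ (measurableTypeR R) R mu _ _ _ mI ci fi); congr (_ - _)%R.
  by rewrite /Rintegral /= integral_I01_cst.
have di : mu.-integrable I01 (EFin \o (fun r => f t - f r)%R).
  by have H := @integrableB _ (measurableTypeR R) R mu _ mI _ _ ci fi; exact H.
rewrite EFin_normr_Rintegral//; apply: le_abse_integral => //.
exact: measurable_int di.
Qed.

(** Since g has mean zero, f may be replaced by f - c with c its mean. In the Hardy inequality for f
    - c the differences do not see c, and the L^1 norm is bounded by the mean oscillation. If f is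
    not integrable, the right-hand side is infinite. *)
Lemma fiber_mean_free (f g : R -> R) y M : I01 y -> (0 < M)%R ->
  measurable_fun I01 f -> measurable_fun I01 g ->
  (forall t, I01 t -> (`|g t| <= M * (quad y / (quad y + quad t) ^+ 2))%R) ->
  \int[mu]_(t in I01) (g t)%:E = 0 ->
  `| \int[mu]_(t in I01) (f t * g t)%:E | <=
  M%:E * (8%:E * \int[mu]_(t in I01) \int[mu]_(r in I01) (`|f t - f r|)%:E +
    4%:E * \int[mu]_(t in I01) \int[mu]_(r in I01)
      (`|f t - f r| * kap (dmin y) t r)%:E).
Proof.
move=> Iy M0 mf mg gw g0; have mI := @measurable_I01 R.
have D0 : 0 <= \int[mu]_(t in I01) \int[mu]_(r in I01) (`|f t - f r|)%:E.
  by do 2 (apply: integral_ge0 => ? _); rewrite lee_fin.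
have E0 : 0 <= \int[mu]_(t in I01) \int[mu]_(r in I01)
      (`|f t - f r| * kap (dmin y) t r)%:E.
  by do 2 (apply: integral_ge0 => ? _); rewrite lee_fin mulr_ge0 ?kap_ge0.
have maf : measurable_fun I01 (fun t => (`|f t|)%:E) by measE.
have [N|N] := eqVneq (\int[mu]_(t in I01) (`|f t|)%:E) +oo.
  rewrite (integral_abs_sub_infty mf N) gt0_muley ?lte_fin// addye; last first.
    by rewrite gt_eqF// (lt_le_trans _ (mule_ge0 _ E0)) ?lee_fin.
  by rewrite gt0_muley ?lte_fin// leey.
have fi : mu.-integrable I01 (EFin \o f).
  apply/integrableP; split; first exact/measurable_EFinP.
  by rewrite ltey.
have qy : (0 < quad y)%R by apply/quad_gt0/I01E.
(* On a single line the weight is bounded, by a constant that blows up as y approaches an end; it is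
   used only to split the integral of f g. *)
have wle t : I01 t -> (quad y / (quad y + quad t) ^+ 2 <= (quad y)^-1)%R.
  move=> /I01E/quad_gt0 qt; rewrite ler_pdivrMr; last by rewrite exprn_gt0// addr_gt0.
  rewrite mulrC ler_pdivlMr// -expr2 lerXn2r ?nnegrE ?addr_ge0 ?ltW//.
  by rewrite ltrDl.
have gb t : I01 t -> (`|g t| <= M / quad y)%R.
  move=> It; apply: (le_trans (gw t It)).
  by rewrite ler_wpM2l ?wle// ltW.
have gi : mu.-integrable I01 (EFin \o g).
  apply/integrableP; split; first exact/measurable_EFinP.
  apply: (@le_lt_trans _ _ (\int[mu]_(t in I01) (M / quad y)%:E)).
    by apply: le_integral_ge0 => t It; rewrite //= lee_fin gb.
  by rewrite integral_I01_cst ltry.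
have fgi : mu.-integrable I01 (EFin \o (fun t => f t * g t)%R).
  apply/integrableP; split; first by measE.
  apply: (@le_lt_trans _ _ ((M / quad y)%:E * \int[mu]_(t in I01) (`|f t|)%:E)).
    rewrite -ge0_integralZl_EFin//; last by rewrite divr_ge0 ?ltW.
    apply: le_integral_ge0 => t It //=.
    by rewrite -EFinM lee_fin normrM mulrC ler_wpM2r// gb.
  have := N; rewrite -ltey -ge0_fin_numE; last by apply: integral_ge0 => ? _; rewrite lee_fin.
  by move=> /fineK <-; rewrite -EFinM ltry.
set c := (\int[mu]_(r in I01) f r)%R.
have cgi : mu.-integrable I01 (EFin \o (fun t => c * g t)%R).
  rewrite (_ : EFin \o _ = (fun t => c%:E * (EFin \o g) t)).
    exact: integrableZl.
  by apply/funext => t; rewrite /= EFinM.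
have -> : \int[mu]_(t in I01) (f t * g t)%:E =
    \int[mu]_(t in I01) ((f t - c) * g t)%:E.
  transitivity (\int[mu]_(t in I01) ((EFin \o (fun t => f t * g t)%R) t -
      (EFin \o (fun t => c * g t)%R) t)).
    rewrite integralB// [X in _ - X](_ : _ = 0) ?sube0//.
    under eq_integral do rewrite /= EFinM.
    by rewrite integralZl// g0 mule0.
  by apply: eq_integral => t _; rewrite /= -EFinB mulrBl.
have mfc : measurable_fun I01 (fun t => (f t - c)%R) by meas.
apply: (le_trans (le_abse_integral mu mI _)); first by measE.
apply: (@le_trans _ _ (M%:E * \int[mu]_(t in I01)
    (`|f t - c| * (quad y / (quad y + quad t) ^+ 2))%:E)).
  rewrite -(ge0_integralZl_EFin mu mI _ _ (ltW M0)); last 2 first.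
  - by move=> t /I01E/quad_gt0 qt; rewrite lee_fin mulr_ge0// divr_ge0 ?sqr_ge0 ?ltW.
  - by rewrite /quad; measE.
  apply: le_integral_ge0 => t It; first by rewrite lee_fin.
  by rewrite -EFinM lee_fin normrM [leRHS]mulrCA ler_wpM2l// gw.
have M0' : 0 <= M%:E by rewrite lee_fin ltW.
apply: (lee_wpmul2l M0').
have H := hardy_full Iy mfc.
have shift : \int[mu]_(t in I01) \int[mu]_(r in I01)
     (`|f t - c - (f r - c)| * kap (dmin y) t r)%:E =
   \int[mu]_(t in I01) \int[mu]_(r in I01) (`|f t - f r| * kap (dmin y) t r)%:E.
  apply: eq_integral => t _; apply: eq_integral => r _.
  by rewrite opprB addrA subrK.
rewrite shift in H.
have mean := integral_sub_mean_le fi.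
have H8 := lee_wpmul2l (ler0n _ 8 : 0 <= 8%:E :> \bar R) mean.
exact (le_trans H (leeD2r _ H8)).
Qed.

(* G does not see the line means of u, and u minus these means has an L^1 norm
   bounded by the anisotropic seminorm. *)
Lemma mean_free_pairing j e u G M : (0 < e <= 1)%R -> (0 < M)%R ->
  measurable_fun Qhat u -> measurable_fun Qhat G ->
  (forall z, Qhat z -> (`|G z| <= M * hardyw j z)%R) ->
  (forall y, I01 y -> \int[mu]_(t in I01) (G (mkpt j t y))%:E = 0) ->
  leb2.-integrable Qhat (EFin \o (fun z => u z * G z)%R) ->
  `| \int[leb2]_(z in Qhat) (u z * G z)%:E | <=
  (M * (16 + 4 * (1 + (3 / e) ^+ 3)))%:E * AHs_seminorm j e u.
Proof.
move=> e01 M0 mu_ mG Gw G0 uGi.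
rewrite (integrable_Qhat j uGi).
have mI := @measurable_I01 R.
have md : measurable_fun QI (fun p => (`|u p.1 - u (setc j p.1 p.2)|)%:E).
  have m1 := measurable_QI_fst mu_; have m2 := measurable_QI_setc j mu_.
  by measE.
have mk := measurable_inner_kapQ j mu_.
have d0 z r : Qhat z -> I01 r -> 0 <= (`|u z - u (setc j z r)|)%:E by rewrite lee_fin.
have k0 z r : Qhat z -> I01 r ->
    0 <= (`|u z - u (setc j z r)| * kapQ j z r)%:E.
  by move=> _ _; rewrite lee_fin mulr_ge0// kapQ_ge0.
have mD := measurable_fiber_integral j (measurable_inner_QI md d0)
  (fun z Qz => integral_ge0 mu (fun r Ir => d0 z r Qz Ir)).
have mK := measurable_fiber_integral j (measurable_inner_QI mk k0)
  (fun z Qz => integral_ge0 mu (fun r Ir => k0 z r Qz Ir)).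
pose A y := \int[mu]_(t in I01) \int[mu]_(r in I01)
  (`|u (mkpt j t y) - u (setc j (mkpt j t y) r)|)%:E.
pose B y := \int[mu]_(t in I01) \int[mu]_(r in I01)
  (`|u (mkpt j t y) - u (setc j (mkpt j t y) r)| * kapQ j (mkpt j t y) r)%:E.
have A0 y : I01 y -> 0 <= A y.
  by move=> Iy; do 2 (apply: integral_ge0 => ? _); rewrite lee_fin.
have B0 y : I01 y -> 0 <= B y.
  by move=> Iy; do 2 (apply: integral_ge0 => ? _); rewrite lee_fin mulr_ge0 ?kapQ_ge0.
have fiber y : I01 y -> `| \int[mu]_(t in I01) (u (mkpt j t y) * G (mkpt j t y))%:E | <=
    M%:E * (8%:E * A y + 4%:E * B y).
  move=> Iy.
  have Gy t : I01 t -> (`|G (mkpt j t y)| <= M * (quad y / (quad y + quad t) ^+ 2))%R.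
    by move=> It; rewrite -(hardyw_mkpt j); apply/Gw/QhatE.
  have H := fiber_mean_free Iy M0 (measurable_fiber j Iy mu_)
    (measurable_fiber j Iy mG) Gy (G0 y Iy).
  have eA : \int[mu]_(t in I01) \int[mu]_(r in I01)
      (`|u (mkpt j t y) - u (mkpt j r y)|)%:E = A y.
    by apply: eq_integral => t _; apply: eq_integral => r _; rewrite setc_mkpt.
  have eB : \int[mu]_(t in I01) \int[mu]_(r in I01)
      (`|u (mkpt j t y) - u (mkpt j r y)| * kap (dmin y) t r)%:E = B y.
    apply: eq_integral => t _; apply: eq_integral => r _.
    by rewrite setc_mkpt kapQ_mkpt.
  by rewrite eA eB in H.
have muG : measurable_fun Qhat (fun z => (u z * G z)%:E) by measE.
apply: (@le_trans _ _ (\int[mu]_(y in I01) (M%:E * (8%:E * A y + 4%:E * B y)))).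
  apply: (@le_trans _ _ (\int[mu]_(y in I01)
      `| \int[mu]_(t in I01) (u (mkpt j t y) * G (mkpt j t y))%:E |)).
    apply: le_abse_integral => //.
    have := uGi; rewrite /leb2 => uGi'.
    have mp : measurable_fun I01 (fun y => \int[mu]_(t in I01)
        ((fun z => (u z * G z)%:E)^\+ (mkpt j t y))).
      apply: (measurable_fiber_integral j); first exact: measurable_funepos.
      by move=> z _.
    have mn : measurable_fun I01 (fun y => \int[mu]_(t in I01)
        ((fun z => (u z * G z)%:E)^\- (mkpt j t y))).
      apply: (measurable_fiber_integral j); first exact: measurable_funeneg.
      by move=> z _.
    rewrite (_ : (fun y => _) = (fun y => \int[mu]_(t in I01)
        ((fun z => (u z * G z)%:E)^\+ (mkpt j t y)) -
        \int[mu]_(t in I01) ((fun z => (u z * G z)%:E)^\- (mkpt j t y)))).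
      exact: emeasurable_funB.
    apply/funext => y.
    have H := integralE mu I01 (fun t => (u (mkpt j t y) * G (mkpt j t y))%:E).
    rewrite [LHS]H; congr (_ - _); apply: eq_integral => t _.
      by rewrite !funeposE.
    by rewrite !funenegE.
  by apply: le_integral_ge0 => y Iy; [exact: abse_ge0|exact: fiber].
have m8 : measurable_fun I01 (fun y => 8%:E * A y).
  by have H := measurable_funeM 8%:E mD; exact H.
have m4 : measurable_fun I01 (fun y => 4%:E * B y).
  by have H := measurable_funeM 4%:E mK; exact H.
have p8 y : I01 y -> 0 <= 8%:E * A y by move=> Iy; rewrite mule_ge0 ?lee_fin ?A0.
have p4 y : I01 y -> 0 <= 4%:E * B y by move=> Iy; rewrite mule_ge0 ?lee_fin ?B0.
have p84 y : I01 y -> 0 <= 8%:E * A y + 4%:E * B y.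
  by move=> Iy; exact (adde_ge0 (p8 y Iy) (p4 y Iy)).
rewrite (ge0_integralZl_EFin mu mI p84 (emeasurable_funD m8 m4) (ltW M0)).
rewrite EFinM -muleA; apply: lee_wpmul2l; first by rewrite lee_fin ltW.
rewrite (ge0_integralD mu mI p8 m8 p4 m4).
rewrite (ge0_integralZl_EFin mu mI A0 mD (ler0n _ 8)).
rewrite (ge0_integralZl_EFin mu mI B0 mK (ler0n _ 4)).
rewrite -(T3_fiber j md d0) -(T3_fiber j mk k0).
have C0 : (0 <= (3 / e) ^+ 3)%R.
  by rewrite exprn_ge0// divr_ge0//; case/andP: e01 => /ltW.
apply: (@le_trans _ _ (8%:E * (2%:E * AHs_seminorm j e u) +
   4%:E * ((1 + (3 / e) ^+ 3)%:E * AHs_seminorm j e u))).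
  apply: leeD; rewrite lee_wpmul2l ?lee_fin//; [exact: T3_diff|exact: T3_kapQ].
rewrite !muleA -!EFinM -ge0_muleDl ?lee_fin ?mulr_ge0 ?addr_ge0//.
rewrite -EFinD lee_wpmul2r ?sqrte_ge0// lee_fin; lra.
Qed.

End MeanFree.

(** * Slicing the Gagliardo seminorm *)

Section Leb2SigmaFinite.
Context {R: realType}.
Notation mu := (@lebesgue_measure R).
Notation RR := (measurableTypeR R).

(* [leb2], for which no sigma-finite instance is inferred *)
Definition sqmeas : set (RR * RR) -> \bar R := leb2.
HB.instance Definition _ := Measure.on sqmeas.

Let sqmeas_sigma_finite : sigma_finite setT sqmeas.
Proof.
have /sigma_finiteP [F [TF ndF Foo]] := sigma_finiteT mu.
exists (fun n => F n `*` F n).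
 rewrite -setXTT TF predeqE => -[x y]; split.
    move=> [/= [n _ Fnx] [k _ Gky]]; exists (maxn n k) => //; split.
    - by move: x Fnx; exact/subsetPset/ndF/leq_maxl.
    - by move: y Gky; exact/subsetPset/ndF/leq_maxr.
  by move=> [n _ []/= Fx Gy]; split; exists n.
move=> k; have [mF ?] := Foo k.
split; first exact: measurableX.
by rewrite /sqmeas /leb2 product_measure1E// lte_mul_pinfty// ge0_fin_numE.
Qed.

HB.instance Definition _ := Measure_isSigmaFinite.Build _ _ _ sqmeas
  sqmeas_sigma_finite.
End Leb2SigmaFinite.

Section Slicing.
Context {R : realType}.
Notation mu := (@lebesgue_measure R).
Notation RR := (measurableTypeR R).
Implicit Types (t r x y a e h : R) (j : 'I_2) (z w : R * R) (u : R * R -> R).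

Lemma edistE j z w : Defs.edist z w =
  Num.sqrt ((xcoord j z - xcoord j w) ^+ 2 +
            (xcoord (rev_ord j) z - xcoord (rev_ord j) w) ^+ 2).
Proof.
by rewrite /Defs.edist /xcoord; case: j => -[|[|//]] ?//=; rewrite addrC.
Qed.

Lemma edist_lt j z w h : `|xcoord j w - xcoord j z| < h ->
  `|xcoord (rev_ord j) w - xcoord (rev_ord j) z| < h -> Defs.edist z w < 2 * h.
Proof.
move=> h1 h2; have h0 : 0 < h by apply: le_lt_trans h1.
have sq s : `|s| < h -> (- s) ^+ 2 <= h ^+ 2.
  by move=> sh; rewrite sqrrN -(real_normK (num_real s)) lerXn2r ?nnegrE ?(ltW sh) ?(ltW h0).
rewrite (edistE j) -(ltr_pXn2r (_ : 0 < 2)%N) ?nnegrE ?sqrtr_ge0//; last by rewrite mulr_ge0 ?ltW.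
rewrite sqr_sqrtr ?addr_ge0 ?sqr_ge0//.
have := sq _ h1; have := sq _ h2; rewrite !opprB => p1 p2.
have hh : 0 < h ^+ 2 by rewrite exprn_gt0.
by rewrite exprMn; lra.
Qed.

Lemma edist_gt0 z w : z != w -> 0 < Defs.edist z w.
Proof.
move=> zw; rewrite sqrtr_gt0.
have [h|h] := eqVneq z.1 w.1.
  rewrite h subrr expr0n add0r exprn_even_gt0//= subr_eq0.
  by apply: contra zw => /eqP h2; case: z w h h2 => ? ? [? ?] /= -> ->.
by rewrite ltr_pwDl ?sqr_ge0// exprn_even_gt0//= subr_eq0.
Qed.

Lemma measurable_sqrt_fun d (T : measurableType d) (D : set T) (f : T -> R) :
  measurable_fun D f -> measurable_fun D (fun p => Num.sqrt (f p)).
Proof.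
apply: (measurableT_comp (f := @Num.sqrt R)).
by apply: continuous_measurable_fun; exact: sqrt_continuous.
Qed.

Definition QQ : set ((R * R) * (R * R)) := Qhat `*` Qhat.

Lemma measurable_QQ : measurable QQ.
Proof. by apply: measurableX; exact: measurable_Qhat. Qed.

Lemma measurable_QQ_fst d (T : measurableType d) (u : R * R -> T) :
  measurable_fun Qhat u -> measurable_fun QQ (fun p => u p.1).
Proof.
apply: (measurable_comp_sub measurable_QQ measurable_Qhat (g := fst)).
- exact: measurable_fst.
- by move=> p [].
Qed.

Lemma measurable_QQ_snd d (T : measurableType d) (u : R * R -> T) :
  measurable_fun Qhat u -> measurable_fun QQ (fun p => u p.2).
Proof.
apply: (measurable_comp_sub measurable_QQ measurable_Qhat (g := snd)).
- exact: measurable_snd.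
- by move=> p [].
Qed.

Lemma measurable_edist : measurable_fun QQ (fun p => Defs.edist p.1 p.2).
Proof.
have m1 j := measurable_QQ_fst (@measurable_xcoord R j Qhat).
have m2 j := measurable_QQ_snd (@measurable_xcoord R j Qhat).
under eq_fun do rewrite (edistE ord0).
apply: measurable_sqrt_fun; apply: measurable_funD; apply: measurable_funX;
  exact: measurable_funB.
Qed.

Definition gag_kernel e u z w : R := (u z - u w) ^+ 2 / Defs.edist z w `^ (2 + 2 * e).

Lemma gag_kernel_ge0 e u z w : 0 <= gag_kernel e u z w.
Proof. by rewrite mulr_ge0 ?sqr_ge0// invr_ge0 powR_ge0. Qed.

Lemma measurable_gag_kernel e u : measurable_fun Qhat u ->
  measurable_fun QQ (fun p => (gag_kernel e u p.1 p.2)%:E).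
Proof.
move=> mu_; have m1 := measurable_QQ_fst mu_; have m2 := measurable_QQ_snd mu_.
by have m3 := measurable_edist; rewrite /gag_kernel; measE.
Qed.

Local Open Scope ereal_scope.

Definition gag_inner e u z : \bar R := \int[leb2]_(w in Qhat) (gag_kernel e u z w)%:E.

Lemma gag_inner_ge0 e u z : 0 <= gag_inner e u z.
Proof. by apply: integral_ge0 => w _; rewrite lee_fin gag_kernel_ge0. Qed.

Lemma gagliardoE e u : gagliardo_sq e u = \int[leb2]_(z in Qhat) gag_inner e u z.
Proof. by []. Qed.

Lemma measurable_gag_inner e u : measurable_fun Qhat u ->
  measurable_fun Qhat (gag_inner e u).
Proof.
move=> mu_.
have k0 z w : Qhat z -> Qhat w -> 0 <= (gag_kernel e u z w)%:E.
  by rewrite lee_fin gag_kernel_ge0.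
have H := @measurable_rect_F _ _ (RR * RR)%type (RR * RR)%type R _ _ measurable_Qhat
  measurable_Qhat (fun p => (gag_kernel e u p.1 p.2)%:E)
  (measurable_gag_kernel e mu_) sqmeas k0.
exact H.
Qed.

Lemma integral_bool_ge (b : R -> bool) (al be : R) : (0 <= al <= be)%R -> (be <= 1)%R ->
  (forall t, (al < t < be)%R -> b t) ->
  (be - al)%:E <= \int[mu]_(t in I01) ((b t)%:R)%:E.
Proof.
move=> /andP[al0 ab] be1 bt.
have -> : (be - al)%:E = \int[mu]_(t in `]al, be[) 1.
  rewrite integral_cst//= lebesgue_measure_itv/= mul1e lte_fin.
  case: ltP => // ba; congr (_%:E); apply/eqP; rewrite subr_eq0 eq_le ba andTb.
  by move: ab ba; lra.
have -> : `]al, be[%classic = @I01 R `&` `]al, be[%classic.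
  apply/seteqP; split => t /=; rewrite /I01/= !in_itv/=; last by move=> [].
  by move=> /andP[? ?]; split; apply/andP; split; lra.
rewrite integral_mkcondr; apply: le_integral_ge0 => t It.
  by rewrite patchE; case: ifP.
rewrite patchE mem_setE in_itv/=; case: ifPn => [/bt -> //|_].
by rewrite lee_fin.
Qed.

(** With h = |z_j - r|, the coordinate j of w may run through the whole interval between z_j and r,
    of length h; the other coordinate stays within h of that of z. *)
Let Sreg j z r w : bool :=
  [&& `|xcoord j w - xcoord j z| < `|xcoord j z - r|,
      `|xcoord j w - r| < `|xcoord j z - r| &
      `|xcoord (rev_ord j) w - xcoord (rev_ord j) z| < `|xcoord j z - r|]%R.

Let measurable_Sreg j z r : measurable_fun Qhat (fun w => (Sreg j z r w)%:R : R).
Proof.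
apply: measurable_natb; do 2 (apply: measurable_and; [by meas|]); by meas.
Qed.

Let mass_Sreg j z r : Qhat z -> I01 r ->
  ((`|xcoord j z - r| ^+ 2)%R)%:E <=
  \int[leb2]_(w in Qhat) ((Sreg j z r w)%:R)%:E.
Proof.
move=> Qz Ir; set h := `|_|%R.
rewrite (integral_Qhat j); first last.
- by move=> w _; rewrite lee_fin.
- by apply/measurable_EFinP; exact (measurable_Sreg j z r).
set t := xcoord j z; set y := xcoord (rev_ord j) z.
have /I01E /andP[t0 t1] := Qhat_xcoord j Qz.
have /I01E /andP[y0 y1] := Qhat_xcoord (rev_ord j) Qz.
move: Ir => /I01E /andP[r0 r1]; rewrite -/t -/y in t0 t1 y0 y1.
have h0 : (0 <= h)%R by exact: normr_ge0.
have h1 : (h <= 1)%R by rewrite /h -/t ler_norml; apply/andP; split; lra.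
have hE : (h = Num.max t r - Num.min t r)%R.
  rewrite /h -/t; case: (leP t r) => tr.
    by rewrite ler0_norm ?opprB// subr_le0.
  by rewrite gtr0_norm ?subr_gt0.
have inner (t' : R) : (Num.min t r < t' < Num.max t r)%R ->
    (`|t' - t| < h)%R && (`|t' - r| < h)%R.
  rewrite hE !ltr_norml; case: (leP t r) => tr /andP[p1 p2];
    apply/andP; split; apply/andP; split; lra.
apply: (@le_trans _ _ (\int[mu]_(y' in I01) (h * (`|y' - y| < h)%R%:R)%:E)).
  under eq_integral do rewrite EFinM.
  have mI := @measurable_I01 R.
  have mb : measurable_fun I01 (fun y' => ((`|y' - y| < h)%R%:R : R)%:E) by measE.
  rewrite (ge0_integralZl_EFin mu mI _ mb h0)//.
  rewrite expr2 EFinM; apply: lee_wpmul2l; first by rewrite lee_fin.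
  (* Part of the window ]y - h, y + h[ may fall outside (0, 1), but a length of at least h remains
     because h <= 1. *)
  apply: (@le_trans _ _ ((Num.min 1 (y + h) - Num.max 0 (y - h))%R)%:E).
    by rewrite lee_fin; case: (leP 1 (y + h))%R => ?; case: (leP 0 (y - h))%R => ?; lra.
  apply: (@integral_bool_ge (fun y' => (`|y' - y| < h)%R)).
  - by apply/andP; split; case: (leP 0 (y - h))%R => ?;
      try (case: (leP 1 (y + h))%R => ?); lra.
  - by rewrite ge_min lexx.
  - move=> y'; rewrite gt_max lt_min => /andP[/andP[? ?] /andP[? ?]].
    by rewrite ltr_norml; apply/andP; split; lra.
apply: le_integral_ge0 => y' Iy'; first by rewrite lee_fin mulr_ge0.
have [yh|yh] := boolP (`|y' - y| < h)%R; last first.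
  by rewrite mulr0; apply: integral_ge0.
rewrite mulr1 {1}hE; apply: integral_bool_ge.
- by case: (leP t r) => ?; apply/andP; split; lra.
- by case: (leP t r) => ?; lra.
- move=> t' /inner /andP[p1 p2].
  by rewrite /Sreg !xcoord_mkpt !xcoord_mkpt_rev p1 p2.
Qed.

(** The exponent -(3 + 2 e') is that of the seminorm on the line, -(1 + 2 e'), lowered by 2 for the
    area h^2 of the averaging region. Since the distances to w are below 2 h, a factor h^-(2 + 2 e)
    is exchanged for the two-dimensional kernel. The power 2 (e - e') - 1 of h that is left is
    integrable in r because e' < e. *)
Let S_bound j e e' z r w : (0 < e' < e)%R -> Sreg j z r w ->
  let h := `|xcoord j z - r|%R in
  (z != w -> h `^ (- (3 + 2 * e')) <= 2 `^ (2 + 2 * e) * h `^ (2 * (e - e') - 1) *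
     (Defs.edist z w `^ (2 + 2 * e))^-1)%R /\
  (setc j z r != w -> h `^ (- (3 + 2 * e')) <= 2 `^ (2 + 2 * e) *
     h `^ (2 * (e - e') - 1) * (Defs.edist (setc j z r) w `^ (2 + 2 * e))^-1)%R.
Proof.
move=> /andP[e0 ee] /and3P[s1 s2 s3] h.
have h0 : (0 < h)%R by apply: le_lt_trans s1.
have core d : (0 < d)%R -> (d < 2 * h)%R -> (h `^ (- (3 + 2 * e')) <=
    2 `^ (2 + 2 * e) * h `^ (2 * (e - e') - 1) * (d `^ (2 + 2 * e))^-1)%R.
  move=> d0 dh.
  have -> : (- (3 + 2 * e') = (2 * (e - e') - 1) + (- (2 + 2 * e)))%R by ring.
  rewrite powRD; last by rewrite (gt_eqF h0) implybT.
  have dq : (d `^ (2 + 2 * e) <= 2 `^ (2 + 2 * e) * h `^ (2 + 2 * e))%R.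
    rewrite -powRM ?(ltW h0)// ge0_ler_powR ?nnegrE ?mulr_ge0 ?(ltW h0) ?(ltW d0) ?(ltW dh)//.
    by lra.
  have hq : (h `^ (- (2 + 2 * e)) <= 2 `^ (2 + 2 * e) * (d `^ (2 + 2 * e))^-1)%R.
    by rewrite powRN ler_pdivlMr ?powR_gt0// mulrC ler_pdivrMr ?powR_gt0.
  by rewrite mulrAC [leRHS]mulrC ler_wpM2l ?powR_ge0.
split => zw; apply: core; try exact: edist_gt0.
- exact: (edist_lt s1 s3).
- apply: (@edist_lt j); rewrite ?xcoord_setc//.
  by rewrite /setc xcoord_mkpt_rev.
Qed.

(* u z - u z' is compared with u z - u w and u z' - u w, averaged over the points w
   of Sreg, a region of area at least h^2 within distance 2 h of both z and z'. *)
Let pointwise j e e' u z r : (0 < e' < e)%R -> measurable_fun Qhat u ->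
  Qhat z -> I01 r ->
  ((u z - u (setc j z r)) ^+ 2 / `|xcoord j z - r| `^ (1 + 2 * e'))%:E <=
  (2 * 2 `^ (2 + 2 * e))%:E * ((`|xcoord j z - r| `^ (2 * (e - e') - 1))%:E *
    gag_inner e u z +
   (`|xcoord j z - r| `^ (2 * (e - e') - 1))%:E * gag_inner e u (setc j z r)).
Proof.
move=> ee mu_ Qz Ir; set z' := setc j z r; set h := `|_|%R; set D := (u z - u z')%R.
have Qz' : Qhat z' by exact: Qhat_setc.
(* The 2 comes from (p - q)^2 <= 2 p^2 + 2 q^2, the factor 2^(2 + 2 e) from the distance bound 2
   h. *)
set K : R := (2 * 2 `^ (2 + 2 * e))%R; have K0 : (0 <= K)%R by rewrite mulr_ge0 ?powR_ge0.
have mg v : Qhat v -> measurable_fun Qhat (fun w => (gag_kernel e u v w)%:E).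
  move=> Qv; apply: (measurable_comp_sub measurable_Qhat measurable_QQ
    (g := fun w => (v, w)) _ _ (measurable_gag_kernel e mu_)); last by [].
  by apply: measurable_fun_pair; [exact: measurable_cst|exact: measurable_id].
have g0 v w : 0 <= (gag_kernel e u v w)%:E by rewrite lee_fin gag_kernel_ge0.
have mQ := @measurable_Qhat R.
have [hz|hz] := eqVneq (xcoord j z) r.
  rewrite /D /z' -hz setcK subrr expr0n/= mul0r.
  by rewrite mule_ge0 ?lee_fin// adde_ge0// mule_ge0 ?gag_inner_ge0// lee_fin powR_ge0.
have h0 : (0 < h)%R by rewrite normr_gt0 subr_eq0.
have ha0 : (0 <= h `^ (2 * (e - e') - 1))%R by rewrite powR_ge0.
have c0 : (0 <= h `^ (- (3 + 2 * e')))%R by rewrite powR_ge0.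
have mS := measurable_Sreg j z r.
apply: (@le_trans _ _ (\int[leb2]_(w in Qhat)
   (h `^ (- (3 + 2 * e')) * D ^+ 2 * (Sreg j z r w)%:R)%:E)).
  under eq_integral do rewrite EFinM.
  rewrite (ge0_integralZl_EFin leb2 mQ); first last.
  - by rewrite mulr_ge0 ?sqr_ge0.
  - exact/measurable_EFinP.
  - by move=> w _; rewrite lee_fin.
  have := mass_Sreg j Qz Ir; rewrite -/h => H.
  apply: (@le_trans _ _ ((h `^ (- (3 + 2 * e')) * D ^+ 2)%:E * (h ^+ 2)%:E)); last first.
    by rewrite lee_wpmul2l// lee_fin mulr_ge0 ?sqr_ge0.
  have E : ((h `^ (1 + 2 * e'))^-1 = h `^ (- (3 + 2 * e')) * h ^+ 2)%R.
    rewrite -powRN -powR_mulrn ?(ltW h0)// -powRD; last by rewrite (gt_eqF h0) implybT.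
    by congr (_ `^ _)%R; ring.
  by rewrite -EFinM lee_fin E; apply: eqW_le; ring.
have EG v : Qhat v -> (h `^ (2 * (e - e') - 1))%:E * gag_inner e u v =
    \int[leb2]_(w in Qhat) ((h `^ (2 * (e - e') - 1))%:E * (gag_kernel e u v w)%:E).
  move=> Qv.
  by rewrite (ge0_integralZl_EFin leb2 mQ (fun w _ => g0 v w) (mg v Qv) ha0).
have m1 : measurable_fun Qhat (fun w =>
  (h `^ (2 * (e - e') - 1))%:E * (gag_kernel e u z w)%:E).
  exact (measurable_funeM _ (mg z Qz)).
have m2 : measurable_fun Qhat (fun w =>
  (h `^ (2 * (e - e') - 1))%:E * (gag_kernel e u z' w)%:E).
  exact (measurable_funeM _ (mg z' Qz')).
have p1 v w : Qhat w -> 0 <= (h `^ (2 * (e - e') - 1))%:E * (gag_kernel e u v w)%:E.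
  by move=> _; rewrite mule_ge0.
have ED := ge0_integralD leb2 mQ (p1 z) m1 (p1 z') m2.
have p2 w : Qhat w -> 0 <= (h `^ (2 * (e - e') - 1))%:E * (gag_kernel e u z w)%:E +
    (h `^ (2 * (e - e') - 1))%:E * (gag_kernel e u z' w)%:E.
  by move=> Qw; rewrite adde_ge0 ?p1.
have EZ := ge0_integralZl_EFin leb2 mQ p2 (emeasurable_funD m1 m2) K0.
have EE := etrans (congr1 (fun X => K%:E * X) (f_equal2 (@adde R) (EG z Qz) (EG z' Qz')))
  (etrans (congr1 (fun X => K%:E * X) (esym ED)) (esym EZ)).
apply: (@le_trans _ _ (\int[leb2]_(w in Qhat) (K%:E *
    ((h `^ (2 * (e - e') - 1))%:E * (gag_kernel e u z w)%:E +
     (h `^ (2 * (e - e') - 1))%:E * (gag_kernel e u z' w)%:E)))); last first.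
  exact (eqW_le (esym EE)).
apply: le_integral_ge0 => w Qw.
  by rewrite lee_fin mulr_ge0// mulr_ge0 ?sqr_ge0.
change ((h `^ (- (3 + 2 * e')) * D ^+ 2 * (Sreg j z r w)%:R)%:E <=
  (K * (h `^ (2 * (e - e') - 1) * gag_kernel e u z w +
        h `^ (2 * (e - e') - 1) * gag_kernel e u z' w))%:E).
rewrite lee_fin.
have [Sw|_] := boolP (Sreg j z r w); last first.
  by rewrite mulr0 mulr_ge0// -mulrDr mulr_ge0// addr_ge0// gag_kernel_ge0.
rewrite mulr1.
have [B1 B2] := S_bound ee Sw; rewrite -/h -/z' in B1 B2.
have key v : (v != w -> h `^ (- (3 + 2 * e')) <=
     2 `^ (2 + 2 * e) * h `^ (2 * (e - e') - 1) * (Defs.edist v w `^ (2 + 2 * e))^-1)%R ->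
    (h `^ (- (3 + 2 * e')) * (2 * (u v - u w) ^+ 2) <=
      K * (h `^ (2 * (e - e') - 1) * gag_kernel e u v w))%R.
  move=> B; have [->|vw] := eqVneq v w.
    rewrite subrr expr0n/= !mulr0 mulr_ge0// mulr_ge0// gag_kernel_ge0//.
  rewrite /gag_kernel /K; set X := (Defs.edist v w `^ (2 + 2 * e))%R.
  apply: (@le_trans _ _ (2 `^ (2 + 2 * e) * h `^ (2 * (e - e') - 1) * X^-1 *
    (2 * (u v - u w) ^+ 2))%R).
    by rewrite ler_wpM2r ?B// mulr_ge0 ?sqr_ge0.
  by apply: eqW_le; ring.
rewrite mulrDr; apply: le_trans (lerD (key z B1) (key z' B2)).
rewrite -mulrDr ler_wpM2l// /D.
have -> : (u z - u z' = (u z - u w) - (u z' - u w))%R by ring.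
have := sqr_ge0 ((u z - u w) + (u z' - u w))%R; nra.
Qed.

(** After integration of [pointwise], the term at z carries the integral over r of |z_j - r|^(2 (e -
    e') - 1), at most 1 / (e - e'). By [T3_swap] the term at the other point of the pair contributes
    the same amount. *)
Lemma semi_sq_le_gagliardo j e e' u : (0 < e' < e)%R -> measurable_fun Qhat u ->
  semi_sq j e' u <= (4 * 2 `^ (2 + 2 * e) / (e - e'))%:E * gagliardo_sq e u.
Proof.
move=> ee mu_; have /andP[e0 elt] := ee.
have a0 : (0 < 2 * (e - e'))%R by rewrite mulr_gt0// subr_gt0.
have mQ := @measurable_Qhat R.
have mG := measurable_gag_inner e mu_.
pose f z r : \bar R := (`|xcoord j z - r| `^ (2 * (e - e') - 1))%:E * gag_inner e u z.
have f0 z r : Qhat z -> I01 r -> 0 <= f z r.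
  by move=> _ _; rewrite mule_ge0 ?gag_inner_ge0// lee_fin powR_ge0.
have mh : measurable_fun QI (fun p : R * R * R =>
    (`|xcoord j p.1 - p.2| `^ (2 * (e - e') - 1))%:E) by measE.
have mf : measurable_fun QI (fun p => f p.1 p.2).
  by have H := emeasurable_funM mh (measurable_QI_fst mG); exact H.
have fswap z r : (`|xcoord j z - r| `^ (2 * (e - e') - 1))%:E *
    gag_inner e u (setc j z r) = f (setc j z r) (xcoord j z).
  by rewrite /f xcoord_setc distrC.
set K := (2 * 2 `^ (2 + 2 * e))%R.
have K0 : (0 <= K)%R by rewrite mulr_ge0 ?powR_ge0.
have msw := measurable_QI_swap j mf.
have sw0 z r : Qhat z -> I01 r -> 0 <= f (setc j z r) (xcoord j z).
  by move=> Qz Ir; apply: f0; [exact: Qhat_setc|exact: Qhat_xcoord].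
apply: (@le_trans _ _ (T3 (fun z r => K%:E * (f z r + f (setc j z r) (xcoord j z))))).
  apply: T3_le => z r Qz Ir.
    by rewrite lee_fin mulr_ge0 ?sqr_ge0// invr_ge0 powR_ge0.
  by rewrite -fswap; exact (pointwise j ee mu_ Qz Ir).
have mD : measurable_fun QI (fun p => f p.1 p.2 + f (setc j p.1 p.2) (xcoord j p.1)).
  by have H := emeasurable_funD mf msw; exact H.
rewrite (T3Z K0 mD); last by move=> z r Qz Ir; exact (adde_ge0 (f0 z r Qz Ir) (sw0 z r Qz Ir)).
have E12 := etrans (T3D mf msw f0 sw0) (congr1 (adde (T3 f)) (T3_swap j mf f0)).
apply: (@le_trans _ _ (K%:E * (T3 f + T3 f))).
  exact (eqW_le (congr1 (fun X => K%:E * X) E12)).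
have Tf : T3 f <= ((e - e')^-1)%:E * gagliardo_sq e u.
  rewrite gagliardoE.
  have ei0 : (0 <= (e - e')^-1)%R by rewrite invr_ge0 subr_ge0 ltW.
  rewrite -(ge0_integralZl_EFin leb2 mQ (fun z _ => gag_inner_ge0 e u z) mG ei0).
  apply: le_integral_ge0 => z Qz; first by apply: integral_ge0 => r; exact: f0.
  have mI := @measurable_I01 R.
  have mr : measurable_fun I01 (fun r => (`|xcoord j z - r| `^ (2 * (e - e') - 1))%:E).
    by measE.
  have r0 r : I01 r -> 0 <= (`|xcoord j z - r| `^ (2 * (e - e') - 1))%:E.
    by rewrite lee_fin powR_ge0.
  rewrite /f (ge0_integralZr mu mI mr r0 (gag_inner_ge0 e u z)).
  apply: lee_wpmul2r; first exact: gag_inner_ge0.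
  have -> : ((e - e')^-1 = 2 / (2 * (e - e')) :> R)%R by field; lra.
  apply: (le_trans _ (integral_absB_powR a0 (Qhat_xcoord j Qz))).
  by apply: le_integral_ge0 => r _; rewrite ?lee_fin ?powR_ge0// distrC.
have Tf0 := T3_ge0 f0.
apply: (@le_trans _ _ (K%:E * (((e - e')^-1)%:E * gagliardo_sq e u +
   ((e - e')^-1)%:E * gagliardo_sq e u))).
  by apply: lee_wpmul2l; [rewrite lee_fin|exact: leeD].
have G0 : 0 <= gagliardo_sq e u by apply: integral_ge0 => z _; exact: gag_inner_ge0.
have ei0 : 0 <= ((e - e')^-1)%:E by rewrite lee_fin invr_ge0 subr_ge0 ltW.
rewrite -ge0_muleDl// -EFinD muleA -EFinM.
apply: eqW_le; congr (_%:E * _).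
by rewrite /K; field; rewrite subr_eq0 gt_eqF.
Qed.

End Slicing.

Lemma near_eq_differentiable (R : numFieldType) (V W : normedModType R)
    (f g : V -> W) (x : V) :
  (\forall y \near x, f y = g y) -> differentiable g x -> differentiable f x.
Proof.
move=> fg dg; have fgx : f x = g x by exact: nbhs_singleton fg.
have /diff_locallyP [cdg gE] := dg.
have fE : f \o shift x = cst (f x) + 'd g x +o_ (0 : V) id.
  apply/eqaddoP => e e0; move/eqaddoP : gE => /(_ e e0) gE.
  have fg0 : \forall h \near (0 : V), f (h + x) = g (h + x).
    by move: fg; rewrite (near_shift 0 x) /= subr0.
  near=> h; rewrite [X in X <= _](_ : _ = `|(g \o shift x - (cst (g x) + 'd g x)) h|).
    by near: h.
  by rewrite !fctE /= fgx; congr (`| _ - _|); near: h.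
have dfE := diff_unique cdg fE.
by apply/diff_locallyP; rewrite dfE.
Unshelve. all: by end_near. Qed.

(** * Smooth functions of two variables *)

Section PlaneCalculus.
Context {R : realType}.
Notation mu := (@lebesgue_measure R).
Implicit Types (j : 'I_2) (x y t r : R) (z w : R * R) (u f g : R * R -> R)
  (O : set (R * R)).

(** The sigma-algebra of the plane is the product one, so an open set is written as a countable
    union of boxes with rational centres and radii 1 / (n + 1). *)
Lemma open_measurable_plane O : open O -> measurable O.
Proof.
move=> oO.
pose box (q q' : rat) n : set (R * R) :=
  ball (ratr q : R) n.+1%:R^-1 `*` ball (ratr q' : R) n.+1%:R^-1.
pose F q q' n := if `[< box q q' n `<=` O >] then box q q' n else set0.
have -> : O = \bigcup_q \bigcup_q' \bigcup_n F q q' n.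
  apply/seteqP; split => [[x y] Oxy|z]; last first.
    by move=> [q _ [q' _ [n _]]]; rewrite /F; case: ifPn => // /asboolP; apply.
  have /nbhs_ballP [e /= e0 eO] : nbhs (x, y) O by exact: open_nbhs_nbhs.
  have [n en] : exists n : nat, n.+1%:R^-1 < e / 2.
    exists (Num.truncn (e / 2)^-1); rewrite invf_plt ?posrE// ?divr_gt0//.
    exact: truncnS_gt.
  have n0 : 0 < n.+1%:R^-1 :> R by rewrite invr_gt0.
  have lt2 v : v - n.+1%:R^-1 < v + n.+1%:R^-1 :> R.
    by rewrite ltrD2l (lt_trans _ n0)// oppr_lt0.
  have [q /andP[q1 q2]] : exists q, x - n.+1%:R^-1 < ratr q < x + n.+1%:R^-1.
    by have /rat_in_itvoo[q qx] := lt2 x; exists q; move: qx; rewrite in_itv.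
  have [q' /andP[q1' q2']] : exists q', y - n.+1%:R^-1 < ratr q' < y + n.+1%:R^-1.
    by have /rat_in_itvoo[p px] := lt2 y; exists p; move: px; rewrite in_itv.
  exists q => //; exists q' => //; exists n => //.
  move: q1 q2 q1' q2' n0 en; rewrite /F /box; move: (n.+1%:R^-1) => d q1 q2 q1' q2' n0 en.
  have sub : ball (ratr q : R) d `*` ball (ratr q' : R) d `<=` O.
    move=> [a b] [/= ha hb]; apply: eO; split => /=;
      rewrite /ball/= in ha hb *; move: ha hb; rewrite !ltr_norml => /andP[? ?] /andP[? ?];
      apply/andP; split; lra.
  rewrite asboolT//; split => /=; rewrite /ball/= ltr_norml; apply/andP; split; lra.
apply: bigcupT_measurable_rat => q; apply: bigcupT_measurable_rat => q'.
apply: bigcupT_measurable => n; rewrite /F; case: ifPn => // _.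
by apply: measurableX; exact: measurable_ball.
Qed.

Lemma open_Qhat : open (@Qhat R).
Proof.
rewrite openE => -[x y] [/= Ix Iy]; exists (I01, I01) => //=; split.
- by apply: open_nbhs_nbhs; split => //; exact: interval_open.
- by apply: open_nbhs_nbhs; split => //; exact: interval_open.
Qed.

Lemma continuous_measurable_plane u O : open O ->
  (forall z, O z -> {for z, continuous u}) -> measurable_fun O u.
Proof.
move=> oO cu mO; apply: (measurability _ (RGenOpens.measurableE R)) => //.
move=> _ [_ [a [b ->] <-]]; apply: open_measurable_plane.
rewrite openE => z [Oz uz]; apply: filterI; first exact: open_nbhs_nbhs.
apply: (cu z Oz); apply: open_nbhs_nbhs; by split.
Qed.

Lemma mkpt_shift j t y h : h *: mkpt j 1 0 + mkpt j t y = mkpt j (h + t) y.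
Proof.
rewrite /mkpt; case: (j == ord0); congr pair; rewrite /= /GRing.scale/=.
- by rewrite mulr1.
- by rewrite mulr0 add0r.
- by rewrite mulr0 add0r.
- by rewrite mulr1.
Qed.

Lemma is_derive_fiber j u t y : differentiable u (mkpt j t y) ->
  is_derive t 1 (fun t => u (mkpt j t y)) (pd j u (mkpt j t y)).
Proof.
move=> du.
have du1 : derivable u (mkpt j t y) (mkpt j 1 0) by exact: diff_derivable.
have E : (fun h : R => h^-1 *: (((fun t => u (mkpt j t y)) \o shift t) (h *: 1)
      - u (mkpt j t y))) =
    (fun h : R => h^-1 *: ((u \o shift (mkpt j t y)) (h *: mkpt j 1 0)
      - u (mkpt j t y))).
  by apply/funext => h; rewrite /= mkpt_shift /GRing.scale/= mulr1.
by apply: DeriveDef; rewrite /derivable /pd /derive E.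
Qed.

Lemma near_eq_pd j f g z : (\forall y \near z, f y = g y) -> pd j f z = pd j g z.
Proof. by move=> fg; rewrite /pd; exact: near_eq_derive. Qed.

(** Smoothness involves all iterated derivatives, so it is proved at once for a class of
    differentiable functions that is stable under derivation. Stability up to equality on O is
    enough: O is open and a derivative depends only on the values nearby. *)
Lemma smooth_coind O (C : (R * R -> R) -> Prop) : open O ->
  (forall f, C f -> forall z, O z -> differentiable f z) ->
  (forall f j, C f -> exists2 g, C g & forall z, O z -> pd j f z = g z) ->
  forall f, C f -> smooth_on O f.
Proof.
move=> oO Cd Cpd f Cf ds.
suff [g Cg fg] : exists2 g, C g & forall z, O z -> foldr (@pd R) f ds z = g z.
  move=> z Oz; apply: (@near_eq_differentiable _ _ _ _ g); last exact: Cd.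
  by apply: filterS fg _; exact: open_nbhs_nbhs.
elim: ds => [|d ds [g Cg fg]] /=; first by exists f.
have [g' Cg' gg'] := Cpd g d Cg; exists g' => // z Oz; rewrite -gg'//.
by apply: near_eq_pd; apply: filterS fg _; exact: open_nbhs_nbhs.
Qed.

Lemma smooth_differentiable O f z : smooth_on O f -> O z -> differentiable f z.
Proof. by move=> /(_ [::]) sf /sf. Qed.

Lemma smooth_pd O f j : smooth_on O f -> smooth_on O (pd j f).
Proof. by move=> sf ds z Oz; have := sf (rcons ds j) z Oz; rewrite foldr_rcons. Qed.

Lemma smooth_continuous O f z : smooth_on O f -> O z -> {for z, continuous f}.
Proof. by move=> sf Oz; apply: differentiable_continuous; exact: smooth_differentiable sf Oz. Qed.

Inductive poly_closure (B : (R * R -> R) -> Prop) : (R * R -> R) -> Prop :=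
| pc_base f : B f -> poly_closure B f
| pc_cst c : poly_closure B (cst c)
| pc_add f g : poly_closure B f -> poly_closure B g -> poly_closure B (f + g)
| pc_mul f g : poly_closure B f -> poly_closure B g -> poly_closure B (f * g).

(** By the Leibniz rule, stability under derivation passes from the generators to the algebra they
    generate. It is applied below with the inverse of a denominator, and with cutoffs built from
    [flat], among the generators. *)
Lemma poly_closure_smooth O (B : (R * R -> R) -> Prop) : open O ->
  (forall f, B f -> forall z, O z -> differentiable f z) ->
  (forall f j, B f -> exists2 g, poly_closure B g & forall z, O z -> pd j f z = g z) ->
  forall f, poly_closure B f -> smooth_on O f.
Proof.
move=> oO Bd Bpd; have Cd f : poly_closure B f -> forall z, O z -> differentiable f z.
  elim=> {f} [f Bf|c|f g _ df _ dg|f g _ df _ dg] z Oz.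
  - exact: Bd.
  - exact: differentiable_cst.
  - by apply: differentiableD; [exact: df|exact: dg].
  - by apply: differentiableM; [exact: df|exact: dg].
apply: smooth_coind => // f j; elim=> {f} [f Bf|c|f g pf [df Cdf fdf] pg [dg Cdg gdg]
    |f g pf [df Cdf fdf] pg [dg Cdg gdg]].
- exact: Bpd.
- by exists (cst 0); [exact: pc_cst|move=> z _; rewrite /pd derive_cst].
- exists (df + dg); first exact: pc_add.
  move=> z Oz; rewrite /pd deriveD; first by rewrite -[RHS]/(df z + dg z) -fdf// -gdg.
  + by apply: diff_derivable; exact: Cd.
  + by apply: diff_derivable; exact: Cd.
- exists (f * dg + g * df); first by apply: pc_add; exact: pc_mul.
  move=> z Oz; rewrite /pd deriveM; first by rewrite -[RHS]/(f z * dg z + g z * df z) -fdf// -gdg.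
  + by apply: diff_derivable; exact: Cd.
  + by apply: diff_derivable; exact: Cd.
Qed.

End PlaneCalculus.

(** * The lifting of the edge data *)

Section Lifting.
Context {R : realType}.
Notation mu := (@lebesgue_measure R).
Implicit Types (j : 'I_2) (b : bool) (x y t r d : R) (z w : R * R).

(** The affine function with value 1 at the end [b] and 0 at the other end. Its slope [lsgn b] is
    also the sign of the outward normal there. *)
Definition lam b t : R := if b then t else 1 - t.
Definition lsgn b : R := if b then 1 else -1.

(* Inverse-distance (Shepard) interpolation of the edge data, with the distance
   to opposite sides combined into [quad]; [d > 0] regularises it at the corners. *)
Definition lift1 d b x y : R := lam b x * quad y / (quad x + quad y + d).
Definition lift1x b x y : R :=
  quad y * (lsgn b * (quad y + quad x) - lam b x * (1 - 2 * x)) /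
    (quad y + quad x) ^+ 2.
Definition lift1y b x y : R :=
  lam b x * quad x * (1 - 2 * y) / (quad x + quad y) ^+ 2.

Definition elift d (e : edge) z : R :=
  lift1 d e.2 (xcoord e.1 z) (xcoord (rev_ord e.1) z).

Definition lift_grad (e : edge) j z : R :=
  if j == e.1 then lift1x e.2 (xcoord j z) (xcoord (rev_ord j) z)
  else lift1y e.2 (xcoord (rev_ord j) z) (xcoord j z).

Lemma ord2_neq j k : j != k -> j = rev_ord k.
Proof. by case: j k => -[|[|//]] ? [] -[|[|//]] ? // _; apply/val_inj. Qed.

Lemma lam_bounds b t : 0 <= t <= 1 -> 0 <= lam b t <= 1.
Proof. by case: b => /andP[? ?] /=; apply/andP; split; rewrite /lam; lra. Qed.

Lemma quad_ge0 t : 0 <= t <= 1 -> 0 <= quad t.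
Proof. by move=> /andP[? ?]; rewrite mulr_ge0// subr_ge0. Qed.

Lemma quad_lip t r : 0 <= t <= 1 -> 0 <= r <= 1 -> `|quad t - quad r| <= `|t - r|.
Proof.
move=> /andP[? ?] /andP[? ?].
have -> : quad t - quad r = (t - r) * (1 - t - r) by rewrite /quad; ring.
by rewrite normrM ler_piMr// ler_norml; apply/andP; split; lra.
Qed.

Lemma lam_lip b t r : `|lam b t - lam b r| = `|t - r|.
Proof.
case: b => //=; rewrite /lam -(normrN (t - r)); congr (`|_|); ring.
Qed.

Lemma lift1_bounds d b x y : 0 <= d -> 0 < x < 1 -> 0 < y < 1 ->
  0 <= lift1 d b x y <= 1.
Proof.
move=> d0 x01 y01; have qx := quad_gt0 x01; have qy := quad_gt0 y01.
have /andP[l0 l1] : 0 <= lam b x <= 1.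
  by apply: lam_bounds; case/andP: x01 => ? ?; apply/andP; split; apply: ltW.
have D0 : 0 < quad x + quad y + d by rewrite ltr_pwDl// addr_gt0.
rewrite /lift1; apply/andP; split; first exact: (divr_ge0 (mulr_ge0 l0 (ltW qy)) (ltW D0)).
rewrite ler_pdivrMr// mul1r.
apply: (@le_trans _ _ (1 * quad y)); first by rewrite ler_wpM2r// ltW.
by rewrite mul1r; lra.
Qed.

(** For quotients N / D and N' / D' with second value phi', the increment is (N - N' + phi' (D' -
    D)) / D. Only the denominator at the first point occurs, phi' is between 0 and 1, and N and D
    are Lipschitz. Dropping d from D makes the bound uniform in the regularisation. *)
Lemma lift1_lip d b x y x' y' : 0 <= d -> 0 < x < 1 -> 0 < y < 1 ->
  0 < x' < 1 -> 0 < y' < 1 ->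
  `|lift1 d b x y - lift1 d b x' y'| <=
  3 * (`|x - x'| + `|y - y'|) / (quad x + quad y).
Proof.
move=> d0 x01 y01 x01' y01'.
have le01 t : 0 < t < 1 -> 0 <= t <= 1.
  by move=> /andP[? ?]; apply/andP; split; apply: ltW.
have qx := quad_gt0 x01; have qy := quad_gt0 y01.
have qx' := quad_gt0 x01'; have qy' := quad_gt0 y01'.
have /andP[l0 l1] := lam_bounds b (le01 _ x01).
have /andP[l0' l1'] := lam_bounds b (le01 _ x01').
set D := quad x + quad y + d; set D' := quad x' + quad y' + d.
have D0 : 0 < D by rewrite ltr_pwDl// addr_gt0.
have D0' : 0 < D' by rewrite ltr_pwDl// addr_gt0.
have -> : lift1 d b x y - lift1 d b x' y' =
    ((lam b x * quad y - lam b x' * quad y') + lift1 d b x' y' * (D' - D)) / D.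
  by rewrite /lift1 -/D -/D'; field; rewrite !gt_eqF.
rewrite normrM normfV (gtr0_norm D0).
have px := quad_lip (le01 _ x01) (le01 _ x01').
have py := quad_lip (le01 _ y01) (le01 _ y01').
have pl := lam_lip b x x'.
have quad1 t : 0 < t < 1 -> quad t <= 1.
  by move=> /andP[? ?]; rewrite /quad; nra.
have N1 : `|lam b x * quad y - lam b x' * quad y'| <= `|x - x'| + `|y - y'|.
  have -> : lam b x * quad y - lam b x' * quad y' =
    (lam b x - lam b x') * quad y + lam b x' * (quad y - quad y') by ring.
  apply: (le_trans (ler_normD _ _)); rewrite (normrM (lam b x - _)) (normrM (lam b x')).
  rewrite pl (gtr0_norm qy) (ger0_norm l0').
  apply: lerD; first by rewrite ler_piMr// quad1.
  by apply: le_trans py; rewrite ler_piMl.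
have /andP[L0 L1] := lift1_bounds b d0 x01' y01'.
have N2 : `|lift1 d b x' y' * (D' - D)| <= `|x - x'| + `|y - y'|.
  rewrite normrM (ger0_norm L0).
  apply: (@le_trans _ _ `|D' - D|); first by rewrite ler_piMl.
  have -> : D' - D = - ((quad x - quad x') + (quad y - quad y')) by rewrite /D /D'; ring.
  by rewrite normrN (le_trans (ler_normD _ _))// lerD.
apply: ler_pM => //.
- by rewrite invr_ge0 ltW.
- apply: (le_trans (ler_normD _ _)).
  have : 0 <= `|x - x'| + `|y - y'| by rewrite addr_ge0.
  by move: N1 N2; lra.
- by rewrite lef_pV2 ?posrE ?(addr_gt0 qx qy)// /D lerDl.
Qed.

Lemma lift1x_le b x y : 0 < x < 1 -> 0 < y < 1 ->
  `|lift1x b x y| <= 2 * (quad y / (quad y + quad x) ^+ 2).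
Proof.
move=> x01 y01; have qx := quad_gt0 x01; have qy := quad_gt0 y01.
rewrite /lift1x normrM normfV (ger0_norm (sqr_ge0 _)) normrM (gtr0_norm qy).
rewrite [leRHS]mulrA ler_wpM2r ?invr_ge0 ?sqr_ge0// mulrC ler_wpM2r ?(ltW qy)//.
move: x01 y01 => /andP[? ?] /andP[? ?].
by rewrite /lsgn /lam /quad ler_norml; case: b; apply/andP; split; nra.
Qed.

Lemma lift1y_le b x y : 0 < x < 1 -> 0 < y < 1 ->
  `|lift1y b x y| <= 2 * (quad x / (quad x + quad y) ^+ 2).
Proof.
move=> x01 y01; have qx := quad_gt0 x01; have qy := quad_gt0 y01.
rewrite /lift1y normrM normfV (ger0_norm (sqr_ge0 _)).
rewrite [leRHS]mulrA ler_wpM2r ?invr_ge0 ?sqr_ge0//.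
have -> : lam b x * quad x * (1 - 2 * y) = (lam b x * (1 - 2 * y)) * quad x by ring.
rewrite normrM (gtr0_norm qx) ler_wpM2r ?(ltW qx)//.
move: x01 y01 => /andP[? ?] /andP[? ?].
by rewrite /lam ler_norml; case: b; apply/andP; split; nra.
Qed.

Lemma is_derive_quad x : is_derive x 1 (@quad R) (1 - 2 * x).
Proof.
have H : is_derive x 1 (fun t : R => t * (1 - t)) (x *: (0 - 1) + (1 - x) *: 1).
  exact: is_deriveM.
rewrite (_ : 1 - 2 * x = x *: (0 - 1) + (1 - x) *: 1) //.
by rewrite /GRing.scale/=; ring.
Qed.

Lemma is_derive_lam b x : is_derive x 1 (lam b) (lsgn b).
Proof.
case: b; first exact: is_derive_id.
have H : is_derive x 1 (fun t : R => 1 - t) (0 - 1) by exact: is_deriveB.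
by rewrite sub0r in H.
Qed.

Lemma is_derive_lift1x b x y : quad x + quad y != 0 ->
  is_derive x 1 (fun x => lift1 0 b x y) (lift1x b x y).
Proof.
move=> D0; have dq := is_derive_quad x; have dl := is_derive_lam b x.
have dD : is_derive x 1 (fun x => quad x + quad y) (1 - 2 * x + 0) by exact: is_deriveD.
have dV := @is_deriveV _ (fun x => quad x + quad y) x _ 1 D0 dD.
have dn : is_derive x 1 (fun x => quad y *: lam b x) (quad y *: lsgn b) by exact: is_deriveZ.
have H := is_deriveM dn dV.
rewrite (_ : (fun x => lift1 0 b x y) =
  (fun x => quad y *: lam b x) * (fun x => (quad x + quad y)^-1)); last first.
  by apply/funext => t; rewrite /lift1 addr0 /GRing.scale/= [lam b t * _]mulrC.
apply: (is_derive_eq H).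
by rewrite /lift1x /GRing.scale/= [quad y + _]addrC; field.
Qed.

Lemma is_derive_lift1y b x y : quad x + quad y != 0 ->
  is_derive y 1 (fun y => lift1 0 b x y) (lift1y b x y).
Proof.
move=> D0; have dq := is_derive_quad y.
have dD : is_derive y 1 (fun y => quad x + quad y) (0 + (1 - 2 * y)) by exact: is_deriveD.
have dV := @is_deriveV _ (fun y => quad x + quad y) y _ 1 D0 dD.
have dn : is_derive y 1 (fun y => lam b x *: quad y) (lam b x *: (1 - 2 * y)) by exact: is_deriveZ.
have H := is_deriveM dn dV.
rewrite (_ : (fun y => lift1 0 b x y) =
  (fun y => lam b x *: quad y) * (fun y => (quad x + quad y)^-1)); last first.
  by apply/funext => t; rewrite /lift1 addr0.
apply: (is_derive_eq H).
by rewrite /lift1y /GRing.scale/=; field.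
Qed.

Lemma is_derive_elift e j t y : quad t + quad y != 0 ->
  is_derive t 1 (fun t => elift 0 e (mkpt j t y)) (lift_grad e j (mkpt j t y)).
Proof.
move=> D0; rewrite /elift /lift_grad; have [->|je] := eqVneq j e.1.
  under eq_fun do rewrite xcoord_mkpt xcoord_mkpt_rev.
  by rewrite xcoord_mkpt xcoord_mkpt_rev; exact: is_derive_lift1x.
have je' := ord2_neq je; have ej : e.1 = rev_ord j by rewrite je' rev_ordK.
rewrite ej rev_ordK.
under eq_fun do rewrite xcoord_mkpt xcoord_mkpt_rev.
by rewrite xcoord_mkpt xcoord_mkpt_rev; apply: is_derive_lift1y; rewrite addrC.
Qed.

Lemma lift_grad_le e j z : Qhat z -> `|lift_grad e j z| <= 2 * hardyw j z.
Proof.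
move=> Qz; have /I01E h1 := Qhat_xcoord j Qz.
have /I01E h2 := Qhat_xcoord (rev_ord j) Qz.
rewrite /lift_grad /hardyw; case: ifPn => _; first exact: lift1x_le.
exact: lift1y_le.
Qed.

Lemma lift_bounds d e z : 0 <= d -> Qhat z -> 0 <= elift d e z <= 1.
Proof.
move=> d0 Qz; have /I01E h1 := Qhat_xcoord e.1 Qz.
have /I01E h2 := Qhat_xcoord (rev_ord e.1) Qz.
exact: lift1_bounds.
Qed.

Lemma sum_coord e (F : R -> R -> R) z : (forall x y, F x y = F y x) ->
  F (xcoord e z) (xcoord (rev_ord e) z) = F z.1 z.2.
Proof. by move=> sF; rewrite /xcoord; case: e => -[|[|//]] ?//=; rewrite sF. Qed.

Lemma lift_lip d e z w : 0 <= d -> Qhat z -> Qhat w ->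
  `|elift d e z - elift d e w| <=
  3 * (`|z.1 - w.1| + `|z.2 - w.2|) / (quad z.1 + quad z.2).
Proof.
move=> d0 Qz Qw; have /I01E h1 := Qhat_xcoord e.1 Qz.
have /I01E h2 := Qhat_xcoord (rev_ord e.1) Qz.
have /I01E h3 := Qhat_xcoord e.1 Qw.
have /I01E h4 := Qhat_xcoord (rev_ord e.1) Qw.
apply: (le_trans (lift1_lip e.2 d0 h1 h2 h3 h4)).
by rewrite /xcoord; case: (e.1) => -[|[|//]] ?//=;
  rewrite addrC [quad _ + _]addrC.
Qed.

Lemma measurable_lam dT (T : measurableType dT) (D : set T) b (f : T -> R) :
  measurable_fun D f -> measurable_fun D (fun p => lam b (f p)).
Proof. by move=> mf; rewrite /lam; case: b => //; meas. Qed.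

Lemma measurable_elift d e D : measurable_fun D (elift d e).
Proof.
have m1 := @measurable_lam _ _ D e.2 _ (@measurable_xcoord R e.1 D).
by rewrite /elift /lift1 /quad; meas.
Qed.

Lemma measurable_lift_grad e j D : measurable_fun D (lift_grad e j).
Proof.
have m1 := @measurable_lam _ _ D e.2 _ (@measurable_xcoord R j D).
have m2 := @measurable_lam _ _ D e.2 _ (@measurable_xcoord R (rev_ord j) D).
by rewrite /lift_grad; case: (j == e.1); rewrite /lift1x /lift1y /quad; meas.
Qed.

(** On the opposite edge [lam] vanishes and on the two adjacent ones [quad] does. On [e] itself the
    regularisation leaves a defect near the corners, which tends to 0 at each interior point of the
    edge. *)
Lemma lift_edge d (e e' : edge) t : elift d e (edge_pt e' t) =
  if e' == e then quad t / (quad t + d) else 0.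
Proof.
case: e e' => [k b] [k' b'] /=; rewrite /elift /edge_pt /lift1 /=.
have quadb (c : bool) : quad (c%:R : R) = 0.
  by case: c; rewrite /quad ?subrr ?mulr0// mul0r.
have [->|kk] := eqVneq k' k.
  rewrite xcoord_mkpt xcoord_mkpt_rev quadb add0r.
  have [[->]|] := eqVneq (k, b') (k, b).
    by case: (b); rewrite /lam ?subr0 ?mul1r// subr0 mul1r.
  case: b b' => [] [] //=; rewrite ?eqxx// => _; rewrite /lam ?subrr ?mul0r//.
rewrite xpair_eqE (negbTE kk)/=.
have -> : k = rev_ord k' by apply: ord2_neq; rewrite eq_sym.
by rewrite rev_ordK xcoord_mkpt quadb mulr0 mul0r.
Qed.

(** The denominator D is positive on an open set that contains the closed square, since d > 0. There
    the lifting is a polynomial in the coordinates and 1 / D, and such polynomials are stable under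
    derivation. *)
Lemma smooth_closure_lift d e : 0 < d -> smooth_closure (elift d e).
Proof.
move=> d0; pose D (z : R * R) : R := quad z.1 + quad z.2 + d.
pose p1 : R * R -> R := fst; pose p2 : R * R -> R := snd.
have DE : D = p1 * (cst 1 + cst (-1) * p1) + p2 * (cst 1 + cst (-1) * p2) + cst d.
  by apply/funext => z; rewrite /D /quad /= !fctE /=; ring.
have c1 : continuous p1 by move=> z; exact: cvg_fst.
have c2 : continuous p2 by move=> z; exact: cvg_snd.
have dp1 z : differentiable p1 z.
  exact: (@linear_differentiable _ (R * R)%type R (fst : {linear (R * R)%type -> R^o})).
have dp2 z : differentiable p2 z.
  exact: (@linear_differentiable _ (R * R)%type R (snd : {linear (R * R)%type -> R^o})).
have dq (f : R * R -> R) : (forall z, differentiable f z) ->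
    forall z, differentiable (f * (cst 1 + cst (-1) * f) : R * R -> R) z.
  move=> df z; apply: (differentiableM (df z)).
  apply: (differentiableD (differentiable_cst _ _)).
  exact: (differentiableM (differentiable_cst _ _) (df z)).
have dD z : differentiable D z.
  rewrite DE.
  exact: (differentiableD (differentiableD (dq _ dp1 z) (dq _ dp2 z)) (differentiable_cst _ _)).
pose O : set (R * R) := [set z | 0 < D z].
have oO : open O.
  have cD : continuous D by move=> z; exact: differentiable_continuous.
  rewrite (_ : O = D @^-1` `]0, +oo[%classic).
    by apply: open_comp; [move=> z _; exact: cD|exact: rray_open].
  by apply/seteqP; split => z /=; rewrite in_itv/= andbT.
exists O; split => //.
  move=> [x y] [] /=; rewrite !in_itv/= => hx hy; rewrite /O/= /D/=.
  by rewrite ltr_wpDl// addr_ge0 ?quad_ge0.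
pose V : R * R -> R := fun z => (D z)^-1.
pose B (f : R * R -> R) := [\/ f = p1, f = p2 | f = V].
have b1 : poly_closure B p1 by apply: pc_base; apply: Or31.
have b2 : poly_closure B p2 by apply: pc_base; apply: Or32.
have b3 : poly_closure B V by apply: pc_base; apply: Or33.
have pdp1 j z : pd j p1 z = (mkpt j 1 0).1.
  rewrite /pd deriveE//.
  by rewrite (@diff_lin _ (R * R)%type R (fst : {linear (R * R)%type -> R^o})).
have pdp2 j z : pd j p2 z = (mkpt j 1 0).2.
  rewrite /pd deriveE//.
  by rewrite (@diff_lin _ (R * R)%type R (snd : {linear (R * R)%type -> R^o})).
have bx k : poly_closure B (fun z => xcoord k z).
  by rewrite /xcoord; case: (k == ord0).
have blam k b : poly_closure B (fun z => lam b (xcoord k z)).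
  case: b => /=; first exact: bx.
  rewrite (_ : (fun z => _) = cst 1 + cst (-1) * (fun z => xcoord k z)).
    by apply: pc_add; [exact: pc_cst|apply: pc_mul => //; exact: pc_cst].
  by apply/funext => z; rewrite /= !fctE /= mulN1r.
have bquad k : poly_closure B (fun z => quad (xcoord k z)).
  exact: (pc_mul (bx k) (blam k false)).
have -> : elift d e = (fun z => lam e.2 (xcoord e.1 z)) *
    (fun z => quad (xcoord (rev_ord e.1) z)) * V.
  apply/funext => z; rewrite /elift /lift1 /V /D !fctE.
  by rewrite -(@sum_coord e.1 (fun x y => quad x + quad y) z)// => ? ?; rewrite addrC.
apply: (@poly_closure_smooth _ O B) => //; last by apply: pc_mul => //; exact: pc_mul.
- move=> f [->|->|->] z Oz //; apply: differentiableV => //.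
  by rewrite gt_eqF.
- move=> f j [->|->|->].
  + exists (cst (mkpt j 1 0).1); [exact: pc_cst|by move=> z _; rewrite pdp1].
  + exists (cst (mkpt j 1 0).2); [exact: pc_cst|by move=> z _; rewrite pdp2].
  + exists ((cst (-1) * (V * V)) * (cst 1 + cst (-2) * (fun z => xcoord j z))).
      do ?[exact: b3|exact: bx|exact: pc_cst|apply: pc_mul|apply: pc_add].
    move=> z Oz; have Dz : D z != 0 by rewrite gt_eqF.
    have dDz : derivable D z (mkpt j 1 0) by exact: diff_derivable.
    rewrite /pd deriveV// /GRing.scale/= !fctE /=.
    suff -> : 'D_(mkpt j 1 0) D z = 1 - 2 * xcoord j z by rewrite /V; field.
    rewrite -[z in LHS](mkpt_xcoord j).
    have H1 := is_derive_fiber (dD (mkpt j (xcoord j z) (xcoord (rev_ord j) z))).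
    have := is_derive_quad (xcoord j z).
    move: (xcoord j z) (xcoord (rev_ord j) z) H1 => t y H1 dqt.
    have H2 : is_derive t 1 (fun t => quad t + (quad y + d)) (1 - 2 * t + 0).
      exact: is_deriveD.
    have E3 : (fun t => D (mkpt j t y)) = (fun t => quad t + (quad y + d)).
      by apply/funext => r; rewrite /D /mkpt; case: (j == ord0) => /=; ring.
    rewrite -E3 in H2.
    have E1 := @derive_val _ _ _ _ _ _ _ H1.
    have E2 := @derive_val _ _ _ _ _ _ _ H2.
    exact: (etrans (esym E1) (etrans E2 (addr0 _))).
Qed.

End Lifting.

(** * Sobolev regularity and traces of the lifting *)

Section DominatedZero.
Local Open Scope ereal_scope.

Lemma dominated_cvg0 d (T : measurableType d) (R : realType)
    (mu : {measure set T -> \bar R}) (D : set T) (F : nat -> T -> \bar R)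
    (g : T -> \bar R) : measurable D ->
  (forall n, measurable_fun D (F n)) -> measurable_fun D g ->
  (forall n x, D x -> 0 <= F n x) -> (forall x, D x -> 0 <= g x) ->
  (forall x, D x -> F ^~ x @ \oo --> 0) ->
  {ae mu, forall x, D x -> forall n, F n x <= g x} ->
  \int[mu]_(x in D) g x < +oo ->
  (fun n => \int[mu]_(x in D) F n x) @ \oo --> 0.
Proof.
move=> mD mF mg F0 g0 Fc Fg ig.
have mc : measurable_fun D (cst 0 : T -> \bar R) by exact: measurable_cst.
have aeF : {ae mu, forall x, D x -> F ^~ x @ \oo --> cst 0 x}.
  by apply: aeW => x Dx; exact: Fc.
have ig' : mu.-integrable D g.
  apply/integrableP; split => //.
  rewrite (eq_integral g)// => x; rewrite inE => Dx; exact: (gee0_abs (g0 x Dx)).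
have Fg' : {ae mu, forall x n, D x -> `|F n x| <= g x}.
  by apply: filterS Fg => x H n Dx; rewrite gee0_abs ?F0// H.
have [_ _] := dominated_convergence mD mF mc aeF ig' Fg'.
by rewrite integral0.
Qed.
End DominatedZero.

Section LiftingRegularity.
Context {R : realType}.
Notation mu := (@lebesgue_measure R).
Notation RR := (measurableTypeR R).
Implicit Types (a M x y t : R) (z w : R * R) (psi : R * R -> R).

(* [quad z.1 + quad z.2] is comparable to the distance from z to the corners *)
Definition corner_lip M psi : Prop := forall z w, Qhat z -> Qhat w ->
  `|psi z - psi w| <= M /\
  `|psi z - psi w| <=
    M * ((`|z.1 - w.1| + `|z.2 - w.2|) / (quad z.1 + quad z.2)).

(** Dominates the Gagliardo kernel of order 1 - 2 a. The singularities at the diagonal and at the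
    corners are distributed over the single coordinates, each with the integrable exponent a - 1. As
    it depends on psi only through M, it serves a whole sequence of functions. *)
Definition gdom a M z w : R :=
  16 * M ^+ 2 * (wt a z.1 * wt a z.2) *
  (`|w.1 - z.1| `^ (a - 1) * `|w.2 - z.2| `^ (a - 1)).

(** One of t and 1 - t is at least 1/2, and its power of exponent a - 1 costs a factor of at most
    2. *)
Lemma quad_powR_le a t : 0 < a < 1 -> 0 < t < 1 -> quad t `^ (a - 1) <= 2 * wt a t.
Proof.
move=> /andP[a0 a1] /andP[t0 t1].
have s0 : 0 < 1 - t by rewrite subr_gt0.
have half r : 2^-1 <= r -> r `^ (a - 1) <= 2.
  move=> hr; apply: (@le_trans _ _ (2^-1 `^ (a - 1))).
    by apply: powR_nincr => //; lra.
  rewrite -(@powR_inv1 _ 2)// -powRrM; apply: (@le_trans _ _ (2 `^ 1)); last by rewrite powRr1.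
  by apply: ler_powR; lra.
rewrite /quad powRM ?(ltW t0) ?(ltW s0)// /wt.
have p1 := powR_ge0 t (a - 1); have p2 := powR_ge0 (1 - t) (a - 1).
case: (leP 2^-1 t) => ht.
  by have := half _ ht; nra.
have /half : 2^-1 <= 1 - t by lra.
nra.
Qed.

(** Let d be the distance of the points and D the sum of the two [quad]. The square of the increment
    is at most M^2 (2 d / D)^b with b = 2 - 2 a. The kernel divides by d^(2 b), which leaves d^-b
    D^-b, and b = 2 (1 - a) lets each of the two powers be split between the two coordinates. *)
Lemma gag_le_gdom a M psi z w : 0 < a < 1 -> 0 <= M -> corner_lip M psi ->
  Qhat z -> Qhat w -> z.1 != w.1 -> z.2 != w.2 ->
  gag_kernel (1 - 2 * a) psi z w <= gdom a M z w.
Proof.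
move=> a01 M0 Lp Qz Qw zw1 zw2; have /andP[a0 a1] := a01.
have [[/I01E x01 /I01E y01] _] := (Qz, Qw).
have [B1 B2] := Lp z w Qz Qw.
have qx := quad_gt0 x01; have qy := quad_gt0 y01.
set N := `|z.1 - w.1| + `|z.2 - w.2| in B2; set D := quad z.1 + quad z.2 in B2.
set X := `|psi z - psi w| in B1 B2.
have D0 : 0 < D by exact: (addr_gt0 qx qy).
set d := Defs.edist z w.
have dx : `|w.1 - z.1| <= d.
  by rewrite -sqrtr_sqr /d /Defs.edist -sqrrN opprB ler_wsqrtr// lerDl sqr_ge0.
have dy : `|w.2 - z.2| <= d.
  by rewrite -sqrtr_sqr /d /Defs.edist -[(w.2 - _) ^+ 2]sqrrN opprB ler_wsqrtr// lerDr sqr_ge0.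
have x0 : 0 < `|w.1 - z.1| by rewrite normr_gt0 subr_eq0 eq_sym.
have y0 : 0 < `|w.2 - z.2| by rewrite normr_gt0 subr_eq0 eq_sym.
have d0 : 0 < d by apply: lt_le_trans dx.
set b : R := 2 - 2 * a; have b0 : 0 < b by rewrite /b; lra.
have key : X ^+ 2 <= M ^+ 2 * (2 * d / D) `^ b.
  set Y := 2 * d / D; have Y0 : 0 < Y by rewrite divr_gt0// mulr_gt0.
  have XY : X <= M * Y.
    apply: (le_trans B2); rewrite ler_wpM2l// ler_wpM2r ?invr_ge0 ?(ltW D0)//.
    by rewrite /N (distrC z.1) (distrC z.2); lra.
  have X0 : 0 <= X by exact: normr_ge0.
  (* For Y >= 1 the bound by M is used; for Y < 1 the Lipschitz bound, with Y^2 <= Y^b as b <= 2. *)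
  have [Y1|Y1] := leP 1 Y.
    apply: (@le_trans _ _ (M ^+ 2)); first by rewrite lerXn2r ?nnegrE.
    rewrite ler_peMr ?sqr_ge0// -(powRr0 Y); apply: ler_powR => //; exact: ltW.
  apply: (@le_trans _ _ ((M * Y) ^+ 2)).
    by rewrite lerXn2r ?nnegrE// mulr_ge0// ltW.
  rewrite exprMn ler_wpM2l ?sqr_ge0// -powR_mulrn ?(ltW Y0)//.
  rewrite -[2%:R]/(2 : R); apply: ger_powR; last by rewrite /b; lra.
  by rewrite Y0 ltW.
rewrite /gag_kernel -/d.
have -> : (psi z - psi w) ^+ 2 = X ^+ 2 by rewrite /X real_normK ?num_real.
have -> : 2 + 2 * (1 - 2 * a) = b + b by rewrite /b; ring.
rewrite powRD; last by rewrite (gt_eqF d0) implybT.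
have db := powR_gt0 b d0; have Db := powR_gt0 b D0.
apply: (@le_trans _ _ (M ^+ 2 * (2 `^ b * (d `^ b)^-1 * (D `^ b)^-1))).
  rewrite ler_pdivrMr ?mulr_gt0//; apply: (le_trans key).
  rewrite -[leRHS]mulrA ler_wpM2l ?sqr_ge0//.
  rewrite !powRM ?mulr_ge0 ?(ltW d0) ?invr_ge0 ?(ltW D0)// (_ : D^-1 `^ b = (D `^ b)^-1); last first.
    by rewrite -(powR_inv1 (ltW D0)) -powRrM mulN1r powRN.
  apply: eqW_le; field.
  by rewrite !gt_eqF.
have bE : b = (1 - a) + (1 - a) by rewrite /b; ring.
have split2 p q r : 0 < p -> 0 < q -> p <= r -> q <= r ->
    (r `^ b)^-1 <= p `^ (a - 1) * q `^ (a - 1).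
  move=> p0 q0 pr qr; have r0 : 0 < r by apply: lt_le_trans pr.
  rewrite bE (@powRD _ r (1 - a) (1 - a)); last by rewrite (gt_eqF r0) implybT.
  rewrite invfM -(opprB 1 a) !powRN; apply: ler_pM; rewrite ?invr_ge0 ?powR_ge0//.
    by rewrite lef_pV2 ?posrE ?powR_gt0// ge0_ler_powR ?nnegrE ?subr_ge0 ?(ltW a1) ?(ltW p0) ?(ltW r0).
  by rewrite lef_pV2 ?posrE ?powR_gt0// ge0_ler_powR ?nnegrE ?subr_ge0 ?(ltW a1) ?(ltW q0) ?(ltW r0).
have H1 := split2 _ _ _ x0 y0 dx dy.
have H2 : (D `^ b)^-1 <= (2 * wt a z.1) * (2 * wt a z.2).
  apply: (le_trans (split2 (quad z.1) (quad z.2) D qx qy _ _)); rewrite ?lerDl ?lerDr ?(ltW qx) ?(ltW qy)//.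
  by apply: ler_pM; rewrite ?powR_ge0// quad_powR_le.
have H3 : 2 `^ b <= 4.
  apply: (@le_trans _ _ (2 `^ 2%:R)); first by apply: ler_powR; rewrite /b; lra.
  by rewrite powR_mulrn//; lra.
have -> : gdom a M z w = M ^+ 2 * ((4 * (`|w.1 - z.1| `^ (a - 1) *
    `|w.2 - z.2| `^ (a - 1))) * ((2 * wt a z.1) * (2 * wt a z.2))).
  by rewrite /gdom; ring.
apply: (ler_wpM2l (sqr_ge0 M)).
apply: ler_pM.
- by rewrite mulr_ge0 ?invr_ge0 ?powR_ge0.
- by rewrite invr_ge0 powR_ge0.
- by apply: ler_pM => //; rewrite ?invr_ge0 ?powR_ge0.
- exact: H2.
Qed.

Local Open Scope ereal_scope.

Lemma integral_prod_le (p q : R -> R) (A B : R) :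
  (forall t, (0 <= p t)%R) -> (forall t, (0 <= q t)%R) ->
  measurable_fun I01 p -> measurable_fun I01 q -> (0 <= A)%R ->
  \int[mu]_(t in I01) (p t)%:E <= A%:E -> \int[mu]_(t in I01) (q t)%:E <= B%:E ->
  \int[leb2]_(z in Qhat) (p z.1 * q z.2)%:E <= (A * B)%:E.
Proof.
move=> p0 q0 mp mq A0 pA qB; have mI := @measurable_I01 R.
have mpq : measurable_fun Qhat (fun z : R * R => (p z.1 * q z.2)%:E).
  apply/measurable_EFinP; apply: measurable_funM.
    apply: (measurable_comp_sub measurable_Qhat mI (g := fst) _ _ mp); last by move=> z [].
    exact: measurable_fst.
  apply: (measurable_comp_sub measurable_Qhat mI (g := snd) _ _ mq); last by move=> z [].
  exact: measurable_snd.
rewrite (integral_Qhat ord0 mpq); last by move=> z _; rewrite lee_fin mulr_ge0.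
rewrite /mkpt eqxx /=.
apply: (@le_trans _ _ (\int[mu]_(y in I01) (A%:E * (q y)%:E))).
  apply: le_integral_ge0 => y Iy; first by apply: integral_ge0 => t _; rewrite lee_fin mulr_ge0.
  under eq_integral do rewrite EFinM.
  have mp' : measurable_fun I01 (fun t => (p t)%:E) by exact/measurable_EFinP.
  have p0' t : I01 t -> 0 <= (p t)%:E by rewrite lee_fin.
  have qy : 0 <= (q y)%:E by rewrite lee_fin.
  by rewrite (ge0_integralZr mu mI mp' p0' qy) lee_wpmul2r.
have mq' : measurable_fun I01 (fun t => (q t)%:E) by exact/measurable_EFinP.
have q0' t : I01 t -> 0 <= (q t)%:E by rewrite lee_fin.
by rewrite (ge0_integralZl_EFin mu mI q0' mq' A0) EFinM lee_wpmul2l// lee_fin.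
Qed.

End LiftingRegularity.

Section LiftingGagliardo.
Context {R : realType}.
Notation mu := (@lebesgue_measure R).
Notation RR := (measurableTypeR R).
Implicit Types (a M x y t : R) (z w : R * R) (psi : R * R -> R).

Lemma gdom_ge0 a M z w : 0 <= gdom a M z w.
Proof.
by rewrite /gdom ?(sqr_ge0, powR_ge0, wt_ge0, mulr_ge0).
Qed.

Lemma measurable_gdom a M z : measurable_fun Qhat (gdom a M z).
Proof.
have m1 : measurable_fun (@Qhat R) (fst : R * R -> R) by exact: (@measurable_xcoord R ord0).
have m2 : measurable_fun (@Qhat R) (snd : R * R -> R) by exact: (@measurable_xcoord R ord_max).
rewrite /gdom; do ?[apply: measurable_funM]; try exact: measurable_cst;
  by apply: measurable_powRc; meas.
Qed.

Local Open Scope ereal_scope.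

Lemma ae_coord_neq z : {ae leb2, forall w, z.1 != w.1 /\ z.2 != w.2}.
Proof.
pose N : set (RR * RR) := [set z.1] `*` setT `|` setT `*` [set z.2].
have m0 (A B : set R) : measurable A -> measurable B ->
    mu A = 0 \/ mu B = 0 -> leb2 (A `*` B) = 0.
  move=> mA mB H; have E := @product_measure1E _ _ RR RR R mu mu A B mA mB.
  apply: (etrans E); case: H => H.
    exact (etrans (congr1 (fun X => X * mu B) H) (mul0e _)).
  exact (etrans (congr1 (fun X => mu A * X) H) (mule0 _)).
have mN : measurable N.
  by apply: measurableU; apply: measurableX => //; exact: measurable_set1.
exists N; split => //.
  have mT := @measurableT _ (measurableTypeR R).
  have m1 := @measurable_set1 R z.1; have m2 := @measurable_set1 R z.2.
  have e1 : leb2 ([set z.1] `*` setT) = 0.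
    by apply: (m0 _ _ m1 mT); left; exact: lebesgue_measure_set1.
  have e2 : leb2 (setT `*` [set z.2]) = 0.
    by apply: (m0 _ _ mT m2); right; exact: lebesgue_measure_set1.
  have mA1 : measurable ([set z.1] `*` setT : set (RR * RR)) by exact: measurableX.
  have mA2 : measurable (setT `*` [set z.2] : set (RR * RR)) by exact: measurableX.
  have H := @measureU2 _ _ _ leb2 _ _ mA1 mA2.
  apply/eqP; rewrite eq_le measure_ge0 andbT.
  have E := etrans (f_equal2 (@adde R) e1 e2) (adde0 0).
  by apply: (le_trans H); exact (eqW_le E).
move=> w /= H; rewrite /N.
have [e|n1] := eqVneq z.1 w.1; first by left.
have [e|n2] := eqVneq z.2 w.2; first by right.
by exfalso; apply: H.
Qed.

Let c4 a M : R := (16 * M ^+ 2 * ((2 / a) * (2 / a)))%R.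

Lemma integral_gdom a M z : (0 < a)%R -> Qhat z ->
  \int[leb2]_(w in Qhat) (gdom a M z w)%:E <= (c4 a M * (wt a z.1 * wt a z.2))%:E.
Proof.
move=> a0 [/= Ix Iy].
pose c : R := (16 * M ^+ 2 * (wt a z.1 * wt a z.2))%R.
pose p (t : R) : R := (`|t - z.1| `^ (a - 1))%R.
pose q (t : R) : R := (`|t - z.2| `^ (a - 1))%R.
have c0 : (0 <= c)%R by rewrite /c ?(sqr_ge0, wt_ge0, mulr_ge0).
have p0 t : (0 <= p t)%R by exact: powR_ge0.
have q0 t : (0 <= q t)%R by exact: powR_ge0.
have mp : measurable_fun I01 p by rewrite /p; apply: measurable_powRc; meas.
have mq : measurable_fun I01 q by rewrite /q; apply: measurable_powRc; meas.
have a2 : (0 <= 2 / a)%R by rewrite divr_ge0 ?ltW.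
have H := integral_prod_le p0 q0 mp mq a2 (integral_absB_powR a0 Ix) (integral_absB_powR a0 Iy).
have mpq : measurable_fun Qhat (fun w : R * R => (p w.1 * q w.2)%:E).
  have m1 : measurable_fun (@Qhat R) (fst : R * R -> R) by exact: (@measurable_xcoord R ord0).
  have m2 : measurable_fun (@Qhat R) (snd : R * R -> R) by exact: (@measurable_xcoord R ord_max).
  apply/measurable_EFinP; rewrite /p /q; apply: measurable_funM; apply: measurable_powRc; meas.
have pq0 w : Qhat w -> 0 <= (p w.1 * q w.2)%:E by rewrite lee_fin mulr_ge0.
have E := ge0_integralZl_EFin leb2 (@measurable_Qhat R) pq0 mpq c0.
apply: (@le_trans _ _ (c%:E * \int[leb2]_(w in Qhat) (p w.1 * q w.2)%:E)).
  exact (eqW_le E).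
apply: (le_trans (lee_wpmul2l _ H)); first by rewrite lee_fin.
by rewrite -EFinM lee_fin; apply: eqW_le; rewrite /c /c4; ring.
Qed.

Lemma measurable_wt2 a (c : R) :
  measurable_fun Qhat (fun z : R * R => (c * (wt a z.1 * wt a z.2))%:E).
Proof.
have m1 : measurable_fun (@Qhat R) (fst : R * R -> R) by exact: (@measurable_xcoord R ord0).
have m2 : measurable_fun (@Qhat R) (snd : R * R -> R) by exact: (@measurable_xcoord R ord_max).
apply/measurable_EFinP; rewrite /wt.
do ?[apply: measurable_funM|apply: measurable_funD]; try exact: measurable_cst;
  by apply: measurable_powRc; meas.
Qed.

Lemma integral_wt2 a (c : R) : (0 < a)%R -> (0 <= c)%R ->
  \int[leb2]_(z in Qhat) (c * (wt a z.1 * wt a z.2))%:E < +oo.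
Proof.
move=> a0 c0.
have a2 : (0 <= 2 / a)%R by rewrite divr_ge0 ?ltW.
have mw := @measurable_wt R a I01.
have H := integral_prod_le (wt_ge0 a) (wt_ge0 a) mw mw a2 (integral_wt a0) (integral_wt a0).
have m1 := @measurable_wt2 a 1.
have m1' : measurable_fun Qhat (fun z : R * R => (wt a z.1 * wt a z.2)%:E).
  by under eq_fun do rewrite -[(_ * _)%R]mul1r; exact m1.
have p0 (w : R * R) : Qhat w -> 0 <= (wt a w.1 * wt a w.2)%:E by rewrite lee_fin mulr_ge0 ?wt_ge0.
have E := ge0_integralZl_EFin leb2 (@measurable_Qhat R) p0 m1' c0.
apply: (@le_lt_trans _ _ (c%:E * \int[leb2]_(w in Qhat) (wt a w.1 * wt a w.2)%:E)).
  exact (eqW_le E).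
apply: (@le_lt_trans _ _ (c%:E * (2 / a * (2 / a))%:E)); last by rewrite -EFinM ltry.
by apply: lee_wpmul2l => //; rewrite lee_fin.
Qed.

Lemma gag_ae_le a M psi z : (0 < a < 1)%R -> (0 <= M)%R -> corner_lip M psi -> Qhat z ->
  {ae leb2, forall w, Qhat w -> (gag_kernel (1 - 2 * a) psi z w)%:E <= (gdom a M z w)%:E}.
Proof.
move=> a01 M0 Lp Qz; have [N [mN N0 sub]] := ae_coord_neq z.
exists N; split => // w Hw; apply: sub => -[n1 n2]; apply: Hw => Qw.
by rewrite lee_fin; exact: gag_le_gdom.
Qed.

Lemma measurable_gag_fiber e psi z : measurable_fun Qhat psi -> Qhat z ->
  measurable_fun Qhat (fun w => (gag_kernel e psi z w)%:E).
Proof.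
move=> mpsi Qz; apply: (measurable_comp_sub (@measurable_Qhat R) (@measurable_QQ R)
    (g := fun w => (z, w)) _ _ (measurable_gag_kernel e mpsi)); last by [].
by apply: measurable_fun_pair; [exact: measurable_cst|exact: measurable_id].
Qed.

Lemma gag_inner_le a M psi z : (0 < a < 1)%R -> (0 <= M)%R ->
  measurable_fun Qhat psi -> corner_lip M psi -> Qhat z ->
  gag_inner (1 - 2 * a) psi z <= (c4 a M * (wt a z.1 * wt a z.2))%:E.
Proof.
move=> a01 M0 mpsi Lp Qz; have /andP[a0 a1] := a01.
apply: (le_trans _ (integral_gdom M a0 Qz)).
have k0 w : Qhat w -> 0 <= (gag_kernel (1 - 2 * a) psi z w)%:E.
  by rewrite lee_fin gag_kernel_ge0.
have g0 w : Qhat w -> 0 <= (gdom a M z w)%:E by rewrite lee_fin gdom_ge0.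
have mg : measurable_fun Qhat (fun w => (gdom a M z w)%:E).
  by apply/measurable_EFinP; exact: measurable_gdom.
have H := @ae_ge0_le_integral _ (RR * RR)%type R leb2 _ (@measurable_Qhat R) _ _ k0
  (measurable_gag_fiber _ mpsi Qz) g0 mg.
apply: H; have [N [mN N0 sub]] := gag_ae_le a01 M0 Lp Qz.
by exists N; split.
Qed.

Lemma gagliardo_lt_pinfty a M psi : (0 < a < 1)%R -> (0 <= M)%R ->
  measurable_fun Qhat psi -> corner_lip M psi ->
  gagliardo_sq (1 - 2 * a) psi < +oo.
Proof.
move=> a01 M0 mpsi Lp; have /andP[a0 a1] := a01.
have c0 : (0 <= c4 a M)%R by rewrite /c4 ?(sqr_ge0, mulr_ge0)// invr_ge0 ltW.
apply: le_lt_trans (integral_wt2 a0 c0).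
rewrite gagliardoE; apply: le_integral_ge0 => z Qz; first exact: gag_inner_ge0.
exact: gag_inner_le.
Qed.

(** Dominated convergence twice: in w for fixed z, with [gdom], and then in z, with the bound
    obtained by integrating [gdom]. Both are available because all functions share the same M. *)
Lemma gagliardo_cvg0 a M (psi : nat -> R * R -> R) : (0 < a < 1)%R -> (0 <= M)%R ->
  (forall n, measurable_fun Qhat (psi n)) -> (forall n, corner_lip M (psi n)) ->
  (forall z, Qhat z -> ((psi ^~ z) @ \oo --> (0 : R))%R) ->
  (fun n => gagliardo_sq (1 - 2 * a) (psi n)) @ \oo --> 0.
Proof.
move=> a01 M0 mpsi Lp pc; have /andP[a0 a1] := a01.
have c0 : (0 <= c4 a M)%R by rewrite /c4 ?(sqr_ge0, mulr_ge0)// invr_ge0 ltW.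
have mQ := @measurable_Qhat R.
have H := @dominated_cvg0 _ (RR * RR)%type R leb2 Qhat
  (fun n => gag_inner (1 - 2 * a) (psi n)) _ mQ
  (fun n => measurable_gag_inner _ (mpsi n)) (measurable_wt2 a (c4 a M)).
apply: H.
- by move=> n z _; exact: gag_inner_ge0.
- move=> z _; rewrite lee_fin; apply: (mulr_ge0 c0).
  by apply: mulr_ge0; exact: wt_ge0.
- move=> z Qz.
  have mg : measurable_fun Qhat (fun w => (gdom a M z w)%:E).
    by apply/measurable_EFinP; exact: measurable_gdom.
  have H := @dominated_cvg0 _ (RR * RR)%type R leb2 Qhat
    (fun n w => (gag_kernel (1 - 2 * a) (psi n) z w)%:E) _ mQ
    (fun n => measurable_gag_fiber _ (mpsi n) Qz) mg.
  apply: H.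
  + by move=> n w _; rewrite lee_fin gag_kernel_ge0.
  + by move=> w _; rewrite lee_fin gdom_ge0.
  + move=> w Qw; apply/fine_cvgP; split; first by near=> n.
    set c := (Defs.edist z w `^ (2 + 2 * (1 - 2 * a)))%R.
    have H1 : ((fun n => (psi n z - psi n w) ^+ 2 / c) @ \oo --> ((0 - 0) ^+ 2 / c : R))%R.
      apply: cvgM; last exact: cvg_cst.
      by apply: cvgM; apply: cvgB; exact: pc.
    by rewrite subrr expr0n mul0r in H1; exact: H1.
  + have [N [mN N0 sub]] := ae_coord_neq z.
    exists N; split => // w Hw; apply: sub => -[n1 n2]; apply: Hw => Qw n.
    by rewrite lee_fin; exact: gag_le_gdom.
  + by apply: (le_lt_trans (integral_gdom M a0 Qz)); rewrite ltry.
- exists set0; split; [exact: measurable0|exact (measure0 leb2)|].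
  by move=> z Hz; apply: Hz => Qz n; exact: gag_inner_le.
- exact: integral_wt2.
Unshelve. all: by end_near.
Qed.

End LiftingGagliardo.

Section IsLifting.
Context {R : realType}.
Notation mu := (@lebesgue_measure R).
Notation RR := (measurableTypeR R).
Implicit Types (d s x y t eps : R) (z w : R * R) (u : R * R -> R) (e : edge).

Lemma truncn_lt1 s : 0 < s < 1 -> Num.truncn s = 0%N.
Proof.
by move=> /andP[s0 s1]; apply/eqP; rewrite -leqn0 truncn_le_nat.
Qed.

Lemma Hs_sqnorm_lt1 s u : 0 < s < 1 ->
  (Hs_sqnorm s u = L2sq u + gagliardo_sq s u)%E.
Proof.
move=> s01; rewrite /Hs_sqnorm (truncn_lt1 s01).
have /andP[s0 _] := s01.
rewrite gt_eqF// !big_ord1 !big_ord1_cond /= subr0.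
by rewrite /wderiv /=.
Qed.

Lemma in_Hs_lt1 s u : 0 < s < 1 -> in_L2 u -> (gagliardo_sq s u < +oo)%E -> in_Hs s u.
Proof.
move=> s01 [mu_ uL] ug; split => //.
  by move=> a b; rewrite truncn_lt1// leqn0; case: (a + b)%N.
by rewrite Hs_sqnorm_lt1// lte_add_pinfty.
Qed.

Lemma lift_corner_lip d e : 0 <= d -> corner_lip 3 (elift d e).
Proof.
move=> d0 z w Qz Qw; split; last first.
  by have := lift_lip e d0 Qz Qw; rewrite -mulrA.
have /andP[a1 a2] := lift_bounds e d0 Qz; have /andP[b1 b2] := lift_bounds e d0 Qw.
by rewrite ler_norml; apply/andP; split; lra.
Qed.

Lemma liftB_corner_lip d e : 0 <= d ->
  corner_lip 6 (fun z => elift d e z - elift 0 e z).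
Proof.
move=> d0 z w Qz Qw.
have [A1 A2] := lift_corner_lip e d0 Qz Qw.
have [B1 B2] := lift_corner_lip e (lexx 0) Qz Qw.
rewrite [X in `|X|](_ : _ = (elift d e z - elift d e w) - (elift 0 e z - elift 0 e w)); last by ring.
split; apply: (le_trans (ler_normB _ _)).
  by move: A1 B1; lra.
apply: (le_trans (lerD A2 B2)).
by apply: eqW_le; ring.
Qed.

Lemma L2sq_le c u : 0 <= c -> (forall z, Qhat z -> u z ^+ 2 <= c) -> (L2sq u <= c%:E)%E.
Proof.
move=> c0 uc; rewrite /L2sq.
apply: (@le_trans _ _ (\int[leb2]_(z in Qhat) (c * (1 * 1))%:E)%E).
  apply: le_integral_ge0 => z Qz; rewrite lee_fin ?sqr_ge0// !mulr1; exact: uc.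
have H := @integral_prod_le R (cst c) (cst 1) c 1 (fun=> c0) (fun=> ler01)
  (measurable_cst _) (measurable_cst _) c0.
have E1 : (\int[mu]_(t in I01) (cst c t)%:E <= c%:E)%E.
  by apply: eqW_le; exact (integral_I01_cst c%:E).
have E2 : (\int[mu]_(t in I01) (cst (1 : R) t)%:E <= 1%:E)%E.
  by apply: eqW_le; exact (integral_I01_cst 1%:E).
have {}H := H E1 E2; rewrite mulr1 in H; apply: le_trans H.
by apply: le_integral_ge0 => z Qz; rewrite lee_fin ?mulr1.
Qed.

Lemma in_L2_lift d e : 0 <= d -> in_L2 (elift d e).
Proof.
move=> d0; split; first exact: measurable_elift.
apply: (@le_lt_trans _ _ (1%:E)); last exact: ltry.
apply: L2sq_le => // z Qz; have /andP[? ?] := lift_bounds e d0 Qz.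
by rewrite expr_le1.
Qed.

Let del (k : nat) : R := k.+1%:R^-1.

Let del_gt0 k : 0 < del k. Proof. by rewrite invr_gt0. Qed.

Let del_cvg : del @ \oo --> (0 : R). Proof. exact: cvg_harmonic. Qed.

Let frac_cvg (a D : R) : 0 < D -> (fun k => a / (D + del k)) @ \oo --> a / D.
Proof.
move=> D0; apply: cvgM; first exact: cvg_cst.
apply: cvgV; first by rewrite gt_eqF.
rewrite -[X in _ --> X]addr0; apply: cvgD; [exact: cvg_cst|exact: del_cvg].
Qed.

Let lift_cvg e z : Qhat z ->
  (fun k => elift (del k) e z - elift 0 e z) @ \oo --> (0 : R).
Proof.
move=> Qz; have /I01E h1 := Qhat_xcoord e.1 Qz.
have /I01E h2 := Qhat_xcoord (rev_ord e.1) Qz.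
have D0 := addr_gt0 (quad_gt0 h1) (quad_gt0 h2).
have H1 : (fun k => elift (del k) e z) @ \oo --> elift 0 e z.
  by have H := @frac_cvg (lam e.2 (xcoord e.1 z) * quad (xcoord (rev_ord e.1) z)) _ D0;
    rewrite /elift /lift1 addr0; exact: H.
have H : (fun k => elift (del k) e z - elift 0 e z) @ \oo --> elift 0 e z - elift 0 e z.
  by apply: cvgB; [exact: H1|exact: cvg_cst].
by rewrite subrr in H.
Qed.

(** The smooth approximations are the liftings with 1 / (k + 1) added to the denominator. They
    converge in H^(1 - eps) by [gagliardo_cvg0] with a = eps / 2, and on the edges by
    [lift_edge]. *)
Lemma is_trace_lift eps (e e' : edge) : 0 < eps < 1 ->
  is_trace (1 - eps) e' (elift 0 e) (fun=> (e' == e)%:R).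
Proof.
move=> /andP[e0 e1].
have s01 : 0 < 1 - eps < 1 by apply/andP; split; lra.
have a01 : 0 < eps / 2 < 1 by apply/andP; split; lra.
have aE : 1 - eps = 1 - 2 * (eps / 2) :> R by field.
have bE : (forall b : bool, (b%:R : R) ^+ 2 <= 1) by case; rewrite ?expr1n// expr0n.
split; first split.
- exact: measurable_cst.
- apply: (@le_lt_trans _ _ (\int[mu]_(t in I01) 1%:E)%E); last first.
    by rewrite integral_I01_cst ltry.
  by apply: le_integral_ge0 => t _; rewrite lee_fin ?sqr_ge0.
exists (fun k => elift (del k) e); split.
- by move=> k; exact: smooth_closure_lift.
- have mL k : measurable_fun Qhat (fun z => elift (del k) e z - elift 0 e z).
    by apply: measurable_funB; exact: measurable_elift.
  have Lp k : corner_lip 6 (fun z => elift (del k) e z - elift 0 e z).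
    by apply: liftB_corner_lip; exact: ltW.
  under eq_fun do rewrite (Hs_sqnorm_lt1 _ s01).
  suff H : (fun k => L2sq (fun z => elift (del k) e z - elift 0 e z)%R +
      gagliardo_sq (1 - eps) (fun z => elift (del k) e z - elift 0 e z)%R)%E @ \oo
      --> (0 + 0 : \bar R)%E by rewrite adde0 in H.
  apply: cvgeD => //.
    have mQ := @measurable_Qhat R.
    have mF k : measurable_fun Qhat (fun z => ((elift (del k) e z - elift 0 e z) ^+ 2)%:E).
      by apply/measurable_EFinP; exact: measurable_funX.
    have H := @dominated_cvg0 _ (RR * RR)%type R leb2 Qhat
      (fun k z => ((elift (del k) e z - elift 0 e z) ^+ 2)%:E) (cst 1%:E) mQ mF.
    apply: H.
    + exact: measurable_cst.
    + by move=> k z _; rewrite lee_fin sqr_ge0.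
    + by move=> z _; rewrite lee_fin.
    + move=> z Qz; apply/fine_cvgP; split; first by near=> n.
      have Hc := lift_cvg e Qz; have H1 := cvgM Hc Hc.
      by rewrite mul0r in H1; exact: H1.
    + exists set0; split; [exact: measurable0|exact (measure0 leb2)|].
      move=> z Hz; apply: Hz => Qz k.
      rewrite lee_fin -real_normK ?num_real// expr_le1//.
      have /andP[a1 a2] := lift_bounds e (ltW (del_gt0 k)) Qz.
      have /andP[b1 b2] := lift_bounds e (lexx 0) Qz.
      by rewrite ler_norml; apply/andP; split; lra.
    + have L1 : (L2sq (cst (1 : R)%R) <= (1 : R)%:E)%E by apply: L2sq_le => // z _; rewrite expr1n.
      apply: (@le_lt_trans _ _ (L2sq (cst (1 : R)))).
        by apply: le_integral_ge0 => z _; rewrite lee_fin// expr1n.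
      by apply: (le_lt_trans L1); exact: ltry.
  rewrite aE; apply: (gagliardo_cvg0 a01 _ mL Lp) => // z Qz.
  exact: lift_cvg.
have mI := @measurable_I01 R.
have [ee|ne] := eqVneq e' e; last first.
  rewrite [X in X @ _](_ : _ = cst 0%E); first exact: cvg_cst.
  apply/funext => k; apply: integral0_eq => t It.
  by rewrite lift_edge (negbTE ne) subrr expr0n.
have mF k : measurable_fun I01 (fun t => ((elift (del k) e (edge_pt e' t) - 1) ^+ 2)%:E).
  under eq_fun do rewrite lift_edge ee eqxx.
  by apply/measurable_EFinP; rewrite /quad; meas.
have H := @dominated_cvg0 _ RR R mu I01
  (fun k t => ((elift (del k) e (edge_pt e' t) - 1) ^+ 2)%:E) (cst 1%:E) mI mF.
apply: H.
- exact: measurable_cst.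
- by move=> k z _; rewrite lee_fin sqr_ge0.
- by move=> z _; rewrite lee_fin.
- move=> t /I01E It; have q0 := quad_gt0 It.
  apply/fine_cvgP; split; first by near=> n.
  have Hc : (fun k => elift (del k) e (edge_pt e' t) - 1) @ \oo --> (0 : R).
    under eq_fun do rewrite lift_edge ee eqxx.
    have H2 := @frac_cvg (quad t) _ q0; rewrite divff ?gt_eqF// in H2.
    have H3 : (fun k => quad t / (quad t + del k) - 1) @ \oo --> (1 - 1 : R).
      by apply: cvgB; [exact: H2|exact: cvg_cst].
    by rewrite subrr in H3.
  have H1 := cvgM Hc Hc.
  by rewrite mul0r in H1; exact: H1.
- exists set0; split; [exact: measurable0|exact (measure0 mu)|].
  move=> t Ht; apply: Ht => /I01E It k; have q0 := quad_gt0 It.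
  rewrite lee_fin lift_edge ee eqxx -real_normK ?num_real// expr_le1//.
  have D0 : 0 < quad t + del k by exact: addr_gt0 q0 (del_gt0 k).
  have h1 : quad t / (quad t + del k) <= 1.
    by rewrite ler_pdivrMr// mul1r lerDl ltW.
  have h0 : 0 <= quad t / (quad t + del k) by exact: divr_ge0 (ltW q0) (ltW D0).
  by rewrite ler_norml; apply/andP; split; lra.
- apply: (@le_lt_trans _ _ (\int[mu]_(t in I01) 1%:E)%E); first exact: lexx.
  by rewrite integral_I01_cst ltry.
Unshelve. all: by end_near.
Qed.

Lemma is_lifting_lift eps e : 0 < eps < 1 -> is_lifting eps e (elift 0 e).
Proof.
move=> e01; have /andP[e0 e1] := e01; split; last by move=> e'; exact: is_trace_lift.
apply: in_Hs_lt1; first by apply/andP; split; lra.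
  exact: in_L2_lift.
have -> : 1 - eps = 1 - 2 * (eps / 2) :> R by field.
apply: (@gagliardo_lt_pinfty _ _ 3) => //; first by apply/andP; split; lra.
- exact: measurable_elift.
- exact: lift_corner_lip.
Qed.

End IsLifting.

(** * The gradient of the lifting as a functional *)

Section DistributionalGradient.
Context {R : realType}.
Notation mu := (@lebesgue_measure R).
Notation RR := (measurableTypeR R).
Implicit Types (s x y t r eps c : R) (z w : R * R) (u v psi : R * R -> R) (e : edge).
Implicit Types (j : 'I_2) (U V : 'I_2 -> R * R -> R).

Local Open Scope ereal_scope.

Lemma sqrteZ_le c (X : \bar R) : (0 <= c)%R -> 0 <= X ->
  sqrte (c%:E * X) <= (1 + c)%:E * sqrte X.
Proof.
move=> c0 X0; rewrite sqrteM ?lee_fin// lee_wpmul2r ?sqrte_ge0//= lee_fin.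
rewrite -[leRHS]ger0_norm ?addr_ge0// -sqrtr_sqr ler_wsqrtr//.
by rewrite sqrrD expr1n mul1r; have := sqr_ge0 c; lra.
Qed.

Lemma L2sq_ge0 u : 0 <= L2sq u.
Proof. by apply: integral_ge0 => z _; rewrite lee_fin sqr_ge0. Qed.

Lemma gagliardo_ge0 s u : 0 <= gagliardo_sq s u.
Proof. by apply: integral_ge0 => z _; exact: gag_inner_ge0. Qed.

Lemma L2norm_le_Hs s u : (0 < s < 1)%R -> L2norm u <= Hs_norm s u.
Proof.
move=> s01; rewrite /L2norm /Hs_norm (Hs_sqnorm_lt1 _ s01).
rewrite (lee_sqrt _ (adde_ge0 (L2sq_ge0 u) (gagliardo_ge0 s u))).
exact: (leeDl _ (gagliardo_ge0 s u)).
Qed.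

Definition slice_cst r s : R := 1 + 4 * 2 `^ (2 + 2 * s) / (s - r).

Lemma slice_cst_ge0 r s : (r < s)%R -> (0 <= slice_cst r s)%R.
Proof.
move=> rs; rewrite /slice_cst addr_ge0// divr_ge0 ?mulr_ge0 ?powR_ge0//.
by rewrite subr_ge0 ltW.
Qed.

Lemma AHs_le_Hs j r s u : (0 < r < s)%R -> (s < 1)%R -> measurable_fun Qhat u ->
  AHs_seminorm j r u <= (slice_cst r s)%:E * Hs_norm s u.
Proof.
move=> rs s1 mu_; have /andP[r0 rls] := rs.
have s01 : (0 < s < 1)%R by rewrite s1 (lt_trans r0 rls).
have H := semi_sq_le_gagliardo j rs mu_.
have C0 : (0 <= 4 * 2 `^ (2 + 2 * s) / (s - r))%R.
  by rewrite divr_ge0 ?mulr_ge0 ?powR_ge0// subr_ge0 ltW.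
rewrite AHs_seminormE//.
apply: (@le_trans _ _ (sqrte ((4 * 2 `^ (2 + 2 * s) / (s - r))%:E * gagliardo_sq s u))).
  have C0' : 0 <= (4 * 2 `^ (2 + 2 * s) / (s - r))%:E by rewrite lee_fin.
  by rewrite (lee_sqrt _ (mule_ge0 C0' (gagliardo_ge0 s u))).
apply: (le_trans (sqrteZ_le C0 (gagliardo_ge0 s u))).
apply: lee_wpmul2l; first by rewrite lee_fin slice_cst_ge0.
rewrite /Hs_norm (Hs_sqnorm_lt1 _ s01).
rewrite (lee_sqrt _ (adde_ge0 (L2sq_ge0 u) (gagliardo_ge0 s u))).
exact: (leeDr _ (L2sq_ge0 u)).
Qed.

(** Slicing loses order, so the Hardy inequality is applied on the lines at order s / 2. The second
    factor collects the L^2 norm and the slicing constant. *)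
Definition hardy_cst s : R :=
  (16 + 4 * (1 + (3 / (s / 2)) ^+ 3)) * (1 + slice_cst (s / 2) s).

Lemma hardy_cst0_ge0 s : (0 < s)%R -> (0 <= 16 + 4 * (1 + (3 / s) ^+ 3))%R.
Proof.
move=> s0; have : (0 <= (3 / s) ^+ 3)%R by rewrite exprn_ge0// divr_ge0// ltW.
by move: ((3 / s) ^+ 3)%R => k k0; lra.
Qed.

Lemma hardy_cst_ge0 s : (0 < s)%R -> (0 <= hardy_cst s)%R.
Proof.
move=> s0; rewrite /hardy_cst; apply: mulr_ge0.
  by apply: hardy_cst0_ge0; rewrite divr_gt0.
by rewrite addr_ge0 ?slice_cst_ge0//; lra.
Qed.

Lemma hardy_pairing_Hs j s u : (0 < s < 1)%R -> measurable_fun Qhat u ->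
  \int[leb2]_(z in Qhat) (`|u z| * hardyw j z)%:E <= (hardy_cst s)%:E * Hs_norm s u.
Proof.
move=> s01 mu_; have /andP[s0 s1] := s01.
have ss : (0 < s / 2 <= 1)%R by apply/andP; split; lra.
have K0 : (0 <= 16 + 4 * (1 + (3 / (s / 2)) ^+ 3))%R.
  by apply: hardy_cst0_ge0; rewrite divr_gt0.
apply: (le_trans (hardy_pairing j ss mu_)).
rewrite /hardy_cst EFinM -muleA lee_wpmul2l ?lee_fin//.
have sl : (s / 2 < s)%R by lra.
rewrite EFinD ge0_muleDl ?lee_fin ?slice_cst_ge0// mul1e.
apply: leeD; [exact: L2norm_le_Hs|apply: AHs_le_Hs => //].
by rewrite sl divr_gt0.
Qed.

Lemma integrable_hardy j u (G : R * R -> R) (M : R) : (0 <= M)%R ->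
  measurable_fun Qhat u -> measurable_fun Qhat G ->
  (forall z, Qhat z -> (`|G z| <= M * hardyw j z)%R) ->
  \int[leb2]_(z in Qhat) (`|u z| * hardyw j z)%:E < +oo ->
  leb2.-integrable Qhat (EFin \o (fun z => u z * G z)%R).
Proof.
move=> M0 mu_ mG GM fin.
have mQ := @measurable_Qhat R.
apply/integrableP; split.
  by apply/measurable_EFinP; exact: measurable_funM.
have m1 : measurable_fun Qhat (fun z => (`|u z| * hardyw j z)%:E).
  apply/measurable_EFinP; apply: measurable_funM; first exact: measurable_norm.
  exact: measurable_hardyw.
have p1 z : Qhat z -> 0 <= (`|u z| * hardyw j z)%:E.
  by move=> Qz; rewrite lee_fin mulr_ge0// hardyw_ge0.
have E := ge0_integralZl_EFin leb2 mQ p1 m1 M0.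
apply: (@le_lt_trans _ _ (M%:E * \int[leb2]_(z in Qhat) (`|u z| * hardyw j z)%:E)); last first.
  by rewrite lte_mul_pinfty.
apply: (@le_trans _ _ (\int[leb2]_(z in Qhat) (M%:E * (`|u z| * hardyw j z)%:E))); last first.
  exact (eqW_le E).
apply: le_integral_ge0 => z Qz; first exact: abse_ge0.
rewrite /= lee_fin normrM mulrCA; apply: ler_wpM2l => //; exact: GM.
Qed.

Lemma le_abs_pairing j u (G : R * R -> R) (M : R) : (0 <= M)%R ->
  measurable_fun Qhat u -> measurable_fun Qhat G ->
  (forall z, Qhat z -> (`|G z| <= M * hardyw j z)%R) ->
  \int[leb2]_(z in Qhat) (`|u z * G z|)%:E <=
    M%:E * \int[leb2]_(z in Qhat) (`|u z| * hardyw j z)%:E.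
Proof.
move=> M0 mu_ mG GM.
have mQ := @measurable_Qhat R.
have m1 : measurable_fun Qhat (fun z => (`|u z| * hardyw j z)%:E).
  apply/measurable_EFinP; apply: measurable_funM; first exact: measurable_norm.
  exact: measurable_hardyw.
have p1 z : Qhat z -> 0 <= (`|u z| * hardyw j z)%:E.
  by move=> Qz; rewrite lee_fin mulr_ge0// hardyw_ge0.
have E := ge0_integralZl_EFin leb2 mQ p1 m1 M0.
apply: (@le_trans _ _ (\int[leb2]_(z in Qhat) (M%:E * (`|u z| * hardyw j z)%:E))); last first.
  exact (eqW_le E).
apply: le_integral_ge0 => z Qz; first by rewrite lee_fin.
rewrite /= lee_fin normrM mulrCA; apply: ler_wpM2l => //; exact: GM.
Qed.

(** The classical partial derivatives of the lifting are not square integrable at two of the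
    corners; by the Hardy inequality their integrals against fields in H^eps still converge
    absolutely. *)
Definition dgrad e U : R := (\sum_j \int[leb2]_(z in Qhat) (U j z * lift_grad e j z))%R.

Lemma in_Hs_measurable s u : in_Hs s u -> measurable_fun Qhat u.
Proof. by move=> [[]]. Qed.

Lemma Hs_norm_lty s u : in_Hs s u -> Hs_norm s u < +oo.
Proof.
move=> [_ _ H]; rewrite /Hs_norm.
by case: (Hs_sqnorm s u) H => //= r _; rewrite ltry.
Qed.

Lemma hardy_lty j s u : (0 < s < 1)%R -> in_Hs s u ->
  \int[leb2]_(z in Qhat) (`|u z| * hardyw j z)%:E < +oo.
Proof.
move=> s01 Hu; have /andP[s0 _] := s01.
apply: (le_lt_trans (hardy_pairing_Hs j s01 (in_Hs_measurable Hu))).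
by rewrite lte_mul_pinfty// ?lee_fin ?hardy_cst_ge0// Hs_norm_lty.
Qed.

Lemma integrable_dgrad e j s u : (0 < s < 1)%R -> in_Hs s u ->
  leb2.-integrable Qhat (EFin \o (fun z => u z * lift_grad e j z)%R).
Proof.
move=> s01 Hu; apply: (@integrable_hardy j _ _ 2) => //.
- exact: in_Hs_measurable Hu.
- exact: measurable_lift_grad.
- exact: lift_grad_le.
- exact: hardy_lty Hu.
Qed.

Lemma le_abs_dgrad_comp e j s u : (0 < s < 1)%R -> in_Hs s u ->
  (`| \int[leb2]_(z in Qhat) (u z * lift_grad e j z) |%R)%:E <=
    2%:E * \int[leb2]_(z in Qhat) (`|u z| * hardyw j z)%:E.
Proof.
move=> s01 Hu; have mQ := @measurable_Qhat R.
have iu := integrable_dgrad e j s01 Hu.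
have mu_ := in_Hs_measurable Hu.
have mG := @measurable_lift_grad R e j Qhat.
have mf : measurable_fun Qhat (fun z => (u z * lift_grad e j z)%:E).
  by apply/measurable_EFinP; exact: measurable_funM.
have E := @EFin_normr_Rintegral _ (RR * RR)%type R leb2 _ _ mQ iu.
apply: (@le_trans _ _ `|\int[leb2]_(z in Qhat) (u z * lift_grad e j z)%:E|).
  exact (eqW_le E).
apply: (le_trans (le_abse_integral leb2 mQ mf)).
apply: le_trans (le_abs_pairing (ler0n _ 2) mu_ mG (@lift_grad_le _ e j)).
by apply: le_integral_ge0 => z _.
Qed.

End DistributionalGradient.

Section DualGradient.
Context {R : realType}.
Notation mu := (@lebesgue_measure R).
Notation RR := (measurableTypeR R).
Implicit Types (s x y t r eps c : R) (z w : R * R) (u v psi : R * R -> R) (e : edge).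
Implicit Types (j : 'I_2) (U V : 'I_2 -> R * R -> R).

Lemma Hs_sqnorm_ge0 s u : 0 < s < 1 -> (0 <= Hs_sqnorm s u)%E.
Proof.
by move=> s01; rewrite Hs_sqnorm_lt1//; apply: adde_ge0; [exact: L2sq_ge0|exact: gagliardo_ge0].
Qed.

Lemma in_Hs_dual_dgrad eps e : 0 < eps < 1 -> in_Hs_dual eps (dgrad e).
Proof.
move=> e01; have /andP[e0 _] := e01; have mQ := @measurable_Qhat R; split.
  move=> c U V hU hV; rewrite /dgrad mulr_sumr -big_split; apply: eq_bigr => j _ /=.
  have iU := integrable_dgrad e j e01 (hU j).
  have iV := integrable_dgrad e j e01 (hV j).
  have icU := @integrableZl _ (RR * RR)%type R leb2 _ mQ c _ iU.
  have E1 := @RintegralZl _ (RR * RR)%type R leb2 _ _ c mQ iU.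
  have E2 := @RintegralD _ (RR * RR)%type R leb2 _ _ _ mQ icU iV.
  have E3 : \int[leb2]_(z in Qhat) ((c * U j z + V j z) * lift_grad e j z) =
      \int[leb2]_(z in Qhat) (c * (U j z * lift_grad e j z) + V j z * lift_grad e j z).
    by congr (Rintegral _ _ _); apply/funext => z; rewrite mulrDl mulrA.
  by apply: (etrans E3); apply: (etrans E2); exact (congr1 (fun X => X + _) E1).
exists (4 * hardy_cst eps) => U hU.
have H0 := hardy_cst_ge0 e0.
set S := (\sum_j Hs_sqnorm eps (U j))%E.
have SE : S = (Hs_sqnorm eps (U ord0) + Hs_sqnorm eps (U ord_max))%E.
  rewrite /S big_ord_recl big_ord1; congr (_ + Hs_sqnorm eps (U _))%E.
  exact/val_inj.
have S0 : (0 <= S)%E by rewrite SE; apply: adde_ge0; exact: Hs_sqnorm_ge0.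
have US j : (Hs_norm eps (U j) <= sqrte S)%E.
  rewrite /Hs_norm (lee_sqrt _ S0) SE.
  have h1 := Hs_sqnorm_ge0 (U ord0) e01; have h2 := Hs_sqnorm_ge0 (U ord_max) e01.
  have [->|] := eqVneq j ord0; first exact: (leeDl _ h2).
  move=> /ord2_neq ->; rewrite (_ : rev_ord ord0 = ord_max); last exact/val_inj.
  exact: (leeDr _ h1).
have B j : ((`|\int[leb2]_(z in Qhat) (U j z * lift_grad e j z)|)%:E <=
    (2 * hardy_cst eps)%:E * sqrte S)%E.
  apply: (le_trans (le_abs_dgrad_comp e j e01 (hU j))).
  rewrite EFinM -muleA; apply: lee_wpmul2l => //.
  apply: (le_trans (hardy_pairing_Hs j e01 (in_Hs_measurable (hU j)))).
  by apply: lee_wpmul2l; rewrite ?lee_fin.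
have T : (`|dgrad e U| <= `|\int[leb2]_(z in Qhat) (U ord0 z * lift_grad e ord0 z)|
   + `|\int[leb2]_(z in Qhat) (U (lift ord0 ord0) z * lift_grad e (lift ord0 ord0) z)|)%R.
  by rewrite /dgrad big_ord_recl big_ord1; exact: ler_normD.
have LB := leeD (B ord0) (B (lift ord0 ord0)).
have h2 : (0 <= (2 * hardy_cst eps)%:E)%E by rewrite lee_fin mulr_ge0.
rewrite -ge0_muleDl// -EFinD -EFinD in LB.
apply: (@le_trans _ _ ((2 * hardy_cst eps + 2 * hardy_cst eps)%:E * sqrte S)%E).
  by apply: le_trans LB; rewrite lee_fin.
by apply: eqW_le; congr (_%:E * _)%E; ring.
Qed.

Lemma compact_Qhat_bar : compact (@Qhat_bar R).
Proof. by apply: compact_setX; exact: segment_compact. Qed.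

Lemma Qhat_sub_bar : @Qhat R `<=` Qhat_bar.
Proof.
move=> [x y] [/= /I01E /andP[x0 x1] /I01E /andP[y0 y1]]; split => /=;
  by rewrite in_itv/= !ltW.
Qed.

Lemma continuous_bounded_Qhat u : continuous u ->
  exists2 M : R, 0 < M & forall z, Qhat_bar z -> `|u z| <= M.
Proof.
move=> cu.
have cn : {within Qhat_bar, continuous (fun z => `|u z|)}.
  apply: continuous_subspaceT => z; apply: continuous_comp; first exact: cu.
  exact: norm_continuous.
have ne : (@Qhat_bar R) !=set0.
  by exists (0, 0); split => /=; rewrite in_itv/= lexx ler01.
have [c _ H] := compact_EVT_max ne compact_Qhat_bar cn.
exists (`|u c| + 1); first by rewrite ltr_wpDl.
by move=> z Qz; apply: (@le_trans _ _ `|u c|); rewrite ?lerDl// H// inE.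
Qed.

Lemma continuous_measurable_Qhat u : continuous u -> measurable_fun Qhat u.
Proof.
by move=> cu; apply: continuous_measurable_plane; [exact: open_Qhat|move=> z _; exact: cu].
Qed.

Lemma AHs_cst j s c : (0 < s <= 1) -> AHs_seminorm j s (cst c) = 0%E.
Proof.
move=> s01; rewrite AHs_seminormE; last exact: measurable_cst.
rewrite (_ : semi_sq _ _ _ = 0%E) ?sqrte0//.
rewrite /semi_sq /T3; apply: integral0_eq => z _; apply: integral0_eq => r _.
by rewrite /= subrr expr0n mul0r.
Qed.

(** Comparison with a constant function, whose anisotropic seminorm is 0: [hardy_pairing] then
    bounds the integral of the weight itself. *)
Lemma hardyw_bounded_lty j u (M : R) : measurable_fun Qhat u -> 
  (forall z, Qhat z -> `|u z| <= M) ->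
  (\int[leb2]_(z in Qhat) (`|u z| * hardyw j z)%:E < +oo)%E.
Proof.
move=> mu_ uM; have h1 : 0 < (1 : R) <= 1 by rewrite ltr01 lexx.
(* Any point of the square would serve here: it shows that M >= 0. *)
have Qh : Qhat (2^-1, 2^-1 : R) by split; apply/I01E => /=; apply/andP; split; lra.
have M0 : 0 <= M by apply: le_trans (uM _ Qh).
have mc : measurable_fun Qhat (cst M : R * R -> R) by exact: measurable_cst.
have H := hardy_pairing j h1 mc.
rewrite AHs_cst// adde0 in H.
apply: (@le_lt_trans _ _ (\int[leb2]_(z in Qhat) (`|cst M z| * hardyw j z)%:E)%E).
  apply: le_integral_ge0 => z Qz; first by rewrite lee_fin mulr_ge0 ?hardyw_ge0.
  rewrite lee_fin; apply: ler_wpM2r; first exact: hardyw_ge0.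
  by rewrite /= (ger0_norm M0); exact: uM.
have K0 : (0 <= (16 + 4 * (1 + (3 / 1) ^+ 3) : R)%:E)%E.
  by rewrite lee_fin; apply: hardy_cst0_ge0; rewrite ltr01.
apply: (le_lt_trans H); apply: (lte_mul_pinfty K0) => //.
have L : (L2sq (cst M) <= (M ^+ 2)%:E)%E by apply: L2sq_le => //; exact: sqr_ge0.
by rewrite /L2norm; case: (L2sq (cst M)) L => //= r _; rewrite ltry.
Qed.

Lemma measurable_bounded_integrable u (M : R) : measurable_fun Qhat u ->
  (forall z, Qhat z -> `|u z| <= M) -> leb2.-integrable Qhat (EFin \o u).
Proof.
move=> mu_ uM; apply/integrableP; split; first exact/measurable_EFinP.
have Qh : Qhat (2^-1, 2^-1 : R) by split; apply/I01E => /=; apply/andP; split; lra.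
have M0 : 0 <= M by apply: le_trans (uM _ Qh).
apply: (@le_lt_trans _ _ (L2sq (cst (Num.sqrt M)))).
  apply: le_integral_ge0 => z Qz; first exact: abse_ge0.
  by rewrite /= lee_fin sqr_sqrtr//; exact: uM.
apply: (@le_lt_trans _ _ M%:E); last exact: ltry.
by apply: L2sq_le => // z _; rewrite sqr_sqrtr.
Qed.

Lemma continuous_lift_grad e j t y : quad t + quad y != 0 ->
  {for t, continuous (fun t => lift_grad e j (mkpt j t y))}.
Proof.
move=> D0.
have cq : {for t, continuous (@quad R)} := @is_derive_continuous _ (fun x => 1 - 2 * x) _ _ (is_derive_quad t).
have cl b : {for t, continuous (@lam R b)} := @is_derive_continuous _ (cst (lsgn b)) _ _ (is_derive_lam b t).
change ((fun t => lift_grad e j (mkpt j t y)) @ t --> lift_grad e j (mkpt j t y)).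
rewrite /lift_grad; case: (j == e.1).
  rewrite xcoord_mkpt xcoord_mkpt_rev; under eq_fun do rewrite xcoord_mkpt xcoord_mkpt_rev.
  rewrite /lift1x; apply: cvgM; last first.
    apply: cvgV; first by rewrite expf_neq0// addrC.
    by apply: cvgM; apply: cvgD => //; exact: cvg_cst.
  apply: cvgM; first exact: cvg_cst.
  apply: cvgB.
    by apply: cvgM; [exact: cvg_cst|apply: cvgD => //; exact: cvg_cst].
  apply: cvgM; first exact: cl.
  by apply: cvgB; [exact: cvg_cst|apply: cvgM; [exact: cvg_cst|exact: cvg_id]].
rewrite xcoord_mkpt xcoord_mkpt_rev; under eq_fun do rewrite xcoord_mkpt xcoord_mkpt_rev.
rewrite /lift1y; apply: cvgM; last first.
  apply: cvgV; first by rewrite expf_neq0// addrC.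
  by apply: cvgM; apply: cvgD => //; exact: cvg_cst.
apply: cvgM; first exact: cvg_cst.
by apply: cvgB; [exact: cvg_cst|apply: cvgM; [exact: cvg_cst|exact: cvg_id]].
Qed.

Let Dne t y : 0 <= t <= 1 -> I01 y -> quad t + quad y != 0.
Proof.
move=> t01 /I01E y01; rewrite gt_eqF//; apply: ltr_wpDl; first exact: quad_ge0.
exact: quad_gt0.
Qed.

Lemma integral_lift_grad e j y : j != e.1 -> I01 y ->
  (\int[mu]_(t in I01) (lift_grad e j (mkpt j t y))%:E = 0)%E.
Proof.
move=> je Iy.
have H := @FTC2_open R (fun t => lift_grad e j (mkpt j t y))
  (fun t => elift 0 e (mkpt j t y)) 0 1 ltr01.
have E (b : bool) : elift 0 e (mkpt j (b : nat)%:R y) = 0.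
  have := lift_edge 0 e (j, b) y; rewrite /edge_pt /= => ->.
  have [E|//] := eqVneq (j, b) e.
  by move: je; rewrite -E eqxx.
apply: (etrans (H _ _)).
- by move=> t t01; apply: is_derive_elift; exact: Dne.
- by move=> t t01; apply: continuous_lift_grad; exact: Dne.
- by rewrite (E true) (E false) subrr.
Qed.

Lemma test_fun_continuous psi : test_fun psi -> continuous psi.
Proof. by move=> [sp _] z; apply: (@smooth_continuous _ setT). Qed.

Lemma test_fun_pd_continuous psi j : test_fun psi -> continuous (pd j psi).
Proof.
by move=> [sp _] z; apply: (@smooth_continuous _ setT) => //; exact: smooth_pd.
Qed.

Lemma test_fun_edge psi j t y : test_fun psi -> ~ I01 t -> psi (mkpt j t y) = 0.
Proof.
move=> [_ [K [_ KQ K0]]] nt; apply: K0 => /KQ /QhatE [] //.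
Qed.

Lemma integral_fiber_derive j (F f : R * R -> R) :
  leb2.-integrable Qhat (EFin \o f) ->
  (forall t y, 0 <= t <= 1 -> I01 y ->
    is_derive t 1 (fun t => F (mkpt j t y)) (f (mkpt j t y))) ->
  (forall t y, 0 <= t <= 1 -> I01 y -> {for t, continuous (fun t => f (mkpt j t y))}) ->
  (\int[leb2]_(z in Qhat) (f z)%:E =
   \int[mu]_(y in I01) (F (mkpt j 1 y) - F (mkpt j 0 y))%:E)%E.
Proof.
move=> fi dF cf; apply: (etrans (integrable_Qhat j fi)).
apply: eq_integral => y; rewrite inE => Iy.
have H := @FTC2_open R (fun t => f (mkpt j t y)) (fun t => F (mkpt j t y)) 0 1 ltr01.
by apply: (etrans (H _ _)) => // t t01; [exact: dF|exact: cf].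
Qed.

Lemma test_fun_by_parts j (F f : R * R -> R) psi : test_fun psi ->
  leb2.-integrable Qhat (EFin \o (fun z => psi z * f z)) ->
  leb2.-integrable Qhat (EFin \o (fun z => F z * pd j psi z)) ->
  (forall t y, 0 <= t <= 1 -> I01 y ->
    is_derive t 1 (fun t => F (mkpt j t y)) (f (mkpt j t y))) ->
  (forall t y, 0 <= t <= 1 -> I01 y -> {for t, continuous (fun t => f (mkpt j t y))}) ->
  \int[leb2]_(z in Qhat) (psi z * f z) = - \int[leb2]_(z in Qhat) (F z * pd j psi z).
Proof.
move=> tpsi i1 i2 dF cf; have mQ := @measurable_Qhat R.
have E2 := @RintegralD _ (RR * RR)%type R leb2 _ _ _ mQ i1 i2.
apply/eqP; rewrite -addr_eq0; apply/eqP; apply: (etrans (esym E2)).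
have i12 := @integrableD _ (RR * RR)%type R leb2 _ mQ _ _ i1 i2.
rewrite /Rintegral; apply: (congr1 fine (y := 0%E)).
have dpsi t y : is_derive t 1 (fun t => psi (mkpt j t y)) (pd j psi (mkpt j t y)).
  by apply: is_derive_fiber; case: tpsi => sp _; exact: (@smooth_differentiable _ setT).
have dpd t y : is_derive t 1 (fun t => pd j psi (mkpt j t y)) (pd j (pd j psi) (mkpt j t y)).
  apply: is_derive_fiber; case: tpsi => sp _; apply: (@smooth_differentiable _ setT) => //.
  exact: smooth_pd.
have H := @integral_fiber_derive j (fun z => psi z * F z)
  (fun z => psi z * f z + F z * pd j psi z) i12.
apply: (etrans (H _ _)).
- move=> t y t01 Iy; have dM := is_deriveM (dpsi t y) (dF t y t01 Iy).
  by apply: (is_derive_eq dM); rewrite /GRing.scale/=.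
- move=> t y t01 Iy; have dl := dF t y t01 Iy.
  have c1 : {for t, continuous (fun t => psi (mkpt j t y))} :=
    @is_derive_continuous _ (fun t => pd j psi (mkpt j t y)) _ _ (dpsi t y).
  have c2 : {for t, continuous (fun t => pd j psi (mkpt j t y))} :=
    @is_derive_continuous _ (fun t => pd j (pd j psi) (mkpt j t y)) _ _ (dpd t y).
  have c3 : {for t, continuous (fun t => F (mkpt j t y))} :=
    @is_derive_continuous _ (fun t => f (mkpt j t y)) _ _ dl.
  by apply: cvgD; apply: cvgM; [exact: c1|exact: cf|exact: c3|exact: c2].
- apply: integral0_eq => y Iy.
  by rewrite !(test_fun_edge _ _ tpsi) ?mul0r ?subrr//; move=> /I01E; rewrite ltxx ?andbF//.
Qed.

Lemma test_fun_lift_grad e j psi : test_fun psi ->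
  \int[leb2]_(z in Qhat) (psi z * lift_grad e j z) =
  - \int[leb2]_(z in Qhat) (elift 0 e z * pd j psi z).
Proof.
move=> tpsi.
have cp := test_fun_continuous tpsi; have cd := test_fun_pd_continuous (j := j) tpsi.
have [M M0 pM] := continuous_bounded_Qhat cp.
have [M' M0' dM] := continuous_bounded_Qhat cd.
have mp := continuous_measurable_Qhat cp; have md := continuous_measurable_Qhat cd.
apply: test_fun_by_parts => //.
- apply: (@integrable_hardy _ j _ _ 2) => //.
  + exact: measurable_lift_grad.
  + exact: lift_grad_le.
  + by apply: (@hardyw_bounded_lty j _ M) => // z Qz; apply: pM; exact: Qhat_sub_bar.
- apply: (@measurable_bounded_integrable _ M').
    by apply: measurable_funM => //; exact: measurable_elift.
  move=> z Qz; rewrite normrM; have /andP[l0 l1] := lift_bounds e (lexx 0) Qz.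
  rewrite (ger0_norm l0) -[M']mul1r; apply: ler_pM => //.
  by apply: dM; exact: Qhat_sub_bar.
- by move=> t y t01 Iy; apply: is_derive_elift; exact: Dne.
- by move=> t y t01 Iy; apply: continuous_lift_grad; exact: Dne.
Qed.

Lemma is_dual_grad_dgrad eps e : 0 < eps < 1 -> is_dual_grad eps (elift 0 e) (dgrad e).
Proof.
move=> e01; split; first exact: in_Hs_dual_dgrad.
move=> U tU; rewrite /dgrad.
under eq_bigr => j _ do rewrite (test_fun_lift_grad e j (tU j)).
rewrite sumrN; congr (- _).
have mQ := @measurable_Qhat R.
have i j : leb2.-integrable Qhat (EFin \o (fun z => elift 0 e z * pd j (U j) z)).
  have cd := test_fun_pd_continuous (j := j) (tU j).
  have [M' M0' dM] := continuous_bounded_Qhat cd.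
  apply: (@measurable_bounded_integrable _ M').
    by apply: measurable_funM; [exact: measurable_elift|exact: continuous_measurable_Qhat].
  move=> z Qz; rewrite normrM; have /andP[l0 l1] := lift_bounds e (lexx 0) Qz.
  rewrite (ger0_norm l0) -[M']mul1r; apply: ler_pM => //.
  by apply: dM; exact: Qhat_sub_bar.
have E2 := @RintegralD _ (RR * RR)%type R leb2 _ _ _ mQ (i ord0) (i (lift ord0 ord0)).
rewrite big_ord_recl big_ord1; apply: (etrans (esym E2)).
by congr (Rintegral _ _ _); apply/funext => z; rewrite big_ord_recl big_ord1 mulrDr.
Qed.

End DualGradient.

(** * Moments for s <= 1/2 *)

Section PartTwo.
Context {R : realType}.
Notation mu := (@lebesgue_measure R).
Notation RR := (measurableTypeR R).
Implicit Types (s x y t r eps c : R) (z w : R * R) (u v psi : R * R -> R) (e : edge).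
Implicit Types (j l : 'I_2) (U V : 'I_2 -> R * R -> R).

Lemma L2norm_le c u : 0 <= c -> (forall z, Qhat z -> `|u z| <= c) ->
  (L2norm u <= c%:E)%E.
Proof.
move=> c0 uc.
have H : (L2sq u <= (c ^+ 2)%:E)%E.
  apply: L2sq_le; first exact: sqr_ge0.
  by move=> z Qz; rewrite -[u z ^+ 2]real_normK ?num_real// lerXn2r ?nnegrE ?uc.
rewrite /L2norm; apply: (@le_trans _ _ (sqrte ((c ^+ 2)%:E))).
  by rewrite lee_sqrt// lee_fin sqr_ge0.
by rewrite /= sqrtr_sqr ger0_norm.
Qed.

Lemma RT_interp_le s U l (B : \bar R) : (0 <= B)%E ->
  (forall b : bool, (`|edge_moment s U (l, b)|%:E <= B)%E) ->
  (L2norm (RT_interp s U l) <= 2%:E * B)%E.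
Proof.
(* In the default branch of [xget] the field is zero and the bound is trivial; otherwise it is an
   element of RT_0 with the prescribed moments. *)
move=> B0 mB; rewrite /RT_interp; case: xgetP => [P _ [[a [c PE]] mP]|_]; last first.
  apply: (@le_trans _ _ 0%E); last by rewrite mule_ge0.
  by apply: L2norm_le => // z _; rewrite normr0.
have E (b : bool) : edge_moment s U (l, b) =
    (a l + c l * (b : nat)%:R) * (if b then 1 else -1).
  rewrite -mP (_ : (fun t => _) = fun=> (a l + c l * (b : nat)%:R) * (if b then 1 else -1)).
    by have H := @integral_I01_cst R ((a l + c l * (b : nat)%:R) * (if b then 1 else -1))%:E;
      rewrite /Rintegral H.
  apply/funext => t; rewrite /normal_comp (bigD1 l)//= big1.
    by rewrite addr0 /edge_normal eqxx/= PE /edge_pt xcoord_mkpt.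
  by move=> k kl; rewrite /edge_normal/= (negbTE kl) mulr0.
set m0 := `|edge_moment s U (l, false)|; set m1 := `|edge_moment s U (l, true)|.
have e0 : m0 = `|a l| by rewrite /m0 E/= mulr0 addr0 mulrN1 normrN.
have e1 : m1 = `|a l + c l| by rewrite /m1 E/= mulr1 mulr1.
apply: (@le_trans _ _ ((m0 + m1)%:E)); last first.
  rewrite EFinD (_ : 2%:E * B = B + B)%E; last by rewrite -mule2n mule_natl.
  by apply: leeD; exact: mB.
apply: L2norm_le; first exact: (addr_ge0 (normr_ge0 _) (normr_ge0 _)).
move=> z /(Qhat_xcoord l) /I01E /andP[z0 z1].
rewrite PE (_ : a l + c l * _ = a l * (1 - xcoord l z) + (a l + c l) * xcoord l z); last by ring.
apply: (le_trans (ler_normD _ _)); rewrite !normrM -e0 -e1.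
have p0 : 0 <= m0 by exact: normr_ge0.
have p1 : 0 <= m1 by exact: normr_ge0.
by rewrite (gtr0_norm z0) gtr0_norm ?subr_gt0//; nra.
Qed.

Lemma in_L2_abs_lty u : in_L2 u -> (\int[leb2]_(z in Qhat) (`|u z|)%:E < +oo)%E.
Proof.
move=> [mu_ uL]; apply: (le_lt_trans (L1_le_L2 mu_)); rewrite lte_mul_pinfty//.
by rewrite /L2norm; case: (L2sq u) uL => //= r _; rewrite ltry.
Qed.

Lemma le_abs_Rintegral_bounded u psi : in_L2 u -> measurable_fun Qhat psi ->
  (forall z, Qhat z -> `|psi z| <= 1) ->
  (`|\int[leb2]_(z in Qhat) (u z * psi z)|%:E <= 2%:E * L2norm u)%E.
Proof.
move=> uL mp p1; have [mu_ _] := uL; have mQ := @measurable_Qhat R.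
have mf : measurable_fun Qhat (fun z => (u z * psi z)%:E).
  by apply/measurable_EFinP; exact: measurable_funM.
have le : (\int[leb2]_(z in Qhat) `|(u z * psi z)%:E| <= \int[leb2]_(z in Qhat) (`|u z|)%:E)%E.
  apply: le_integral_ge0 => z Qz; first exact: abse_ge0.
  by rewrite /= lee_fin normrM ler_piMr// p1.
have iu : leb2.-integrable Qhat (EFin \o (fun z => u z * psi z)).
  by apply/integrableP; split => //; apply: (le_lt_trans le); exact: in_L2_abs_lty.
have E := @EFin_normr_Rintegral _ (RR * RR)%type R leb2 _ _ mQ iu.
apply: (@le_trans _ _ `|\int[leb2]_(z in Qhat) (u z * psi z)%:E|%E).
  exact (eqW_le E).
apply: (le_trans (le_abse_integral leb2 mQ mf)); apply: (le_trans le).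
exact: L1_le_L2.
Qed.

Lemma in_L2_divg U : in_Hdiv U -> in_L2 (divg U).
Proof. by move=> [_ ex]; have [] := xgetPex (fun=> 0) ex. Qed.

Definition green_cst s : R := 2 * hardy_cst s + 2 * (16 + 4 * (1 + (3 / s) ^+ 3)) + 2.

(** The specification of the moment holds for all admissible eps, liftings and representations of
    the gradient, so it may be read off at eps = s / 2 with the explicit [elift 0 e] and [dgrad e].
    The resulting integrals are then estimated at order s. *)
Lemma green_moment_le s U l b : 0 < s <= 2^-1 -> in_Hs_vec s U -> in_Hdiv U ->
  (`|green_moment s U (l, b)|%:E <= (green_cst s)%:E *
    (Hs_norm s (U l) + AHs_seminorm (rev_ord l) s (U (rev_ord l)) + L2norm (divg U)))%E.
Proof.
move=> /andP[s0 s1] hU hD; set m := rev_ord l.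
have s01 : 0 < s < 1 by apply/andP; split; lra.
have H0 : (0 <= Hs_norm s (U l))%E by exact: sqrte_ge0.
have A0 : (0 <= AHs_seminorm m s (U m))%E by exact: sqrte_ge0.
have D0 : (0 <= L2norm (divg U))%E by exact: sqrte_ge0.
have c1 := hardy_cst_ge0 s0; have c2 := hardy_cst0_ge0 s0.
have g0 : 0 <= green_cst s by rewrite /green_cst; lra.
(* The default value of the moment is 0. *)
rewrite /green_moment; case: xgetP => [r _ rE|_]; last first.
  by rewrite normr0 mule_ge0 ?lee_fin// !adde_ge0.
set e : edge := (l, b).
have e01 : 0 < s / 2 < 1 by apply/andP; split; lra.
have es : 0 < s / 2 < s by apply/andP; split; lra.
rewrite (rE _ _ _ es (is_lifting_lift e e01) (is_dual_grad_dgrad e e01)).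
have B1 : (`|\int[leb2]_(z in Qhat) (U l z * lift_grad e l z)|%:E <=
    (2 * hardy_cst s)%:E * Hs_norm s (U l))%E.
  apply: (le_trans (le_abs_dgrad_comp e l s01 (hU l))).
  rewrite EFinM -muleA; apply: lee_wpmul2l => //.
  exact: (hardy_pairing_Hs l s01 (in_Hs_measurable (hU l))).
have ml : m != l by rewrite /m; case: (l) => -[|[|//]].
have B2 : (`|\int[leb2]_(z in Qhat) (U m z * lift_grad e m z)|%:E <=
    (2 * (16 + 4 * (1 + (3 / s) ^+ 3)))%:E * AHs_seminorm m s (U m))%E.
  have iu := integrable_dgrad e m s01 (hU m).
  have E := @EFin_normr_Rintegral _ (RR * RR)%type R leb2 _ _ (@measurable_Qhat R) iu.
  apply: (@le_trans _ _ `|\int[leb2]_(z in Qhat) (U m z * lift_grad e m z)%:E|%E).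
    exact (eqW_le E).
  apply: (@mean_free_pairing R m s (U m) (lift_grad e m) 2) => //.
  - by rewrite s0; lra.
  - exact: in_Hs_measurable (hU m).
  - exact: measurable_lift_grad.
  - exact: lift_grad_le.
  - by move=> y Iy; exact: integral_lift_grad.
have B3 : (`|\int[leb2]_(z in Qhat) (divg U z * elift 0 e z)|%:E <=
    2%:E * L2norm (divg U))%E.
  apply: le_abs_Rintegral_bounded; first exact: in_L2_divg.
    exact: measurable_elift.
  move=> z Qz; have /andP[l0 l1] := lift_bounds e (lexx 0) Qz.
  by rewrite ger0_norm.
have E : dgrad e U = \int[leb2]_(z in Qhat) (U l z * lift_grad e l z) +
    \int[leb2]_(z in Qhat) (U m z * lift_grad e m z).
  rewrite /dgrad (bigD1 l)//=; congr (_ + _); rewrite (bigD1 m)//= big1 ?addr0//.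
  by move=> k /andP[kl km]; have := ord2_neq kl; move: km => /[swap] ->; rewrite eqxx.
rewrite E; apply: (@le_trans _ _ (`|\int[leb2]_(z in Qhat) (U l z * lift_grad e l z)|%:E +
  `|\int[leb2]_(z in Qhat) (U m z * lift_grad e m z)|%:E +
  `|\int[leb2]_(z in Qhat) (divg U z * elift 0 e z)|%:E)%E).
  rewrite -!EFinD lee_fin; apply: (le_trans (ler_normD _ _)).
  by rewrite lerD2r ler_normD.
apply: (le_trans (leeD (leeD B1 B2) B3)).
rewrite !ge0_muleDr ?adde_ge0//; apply: leeD; first apply: leeD.
- by apply: lee_wpmul2r => //; rewrite lee_fin /green_cst; lra.
- by apply: lee_wpmul2r => //; rewrite lee_fin /green_cst; lra.
- by apply: lee_wpmul2r => //; rewrite lee_fin /green_cst; lra.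
Qed.

Lemma part_two s : 0 < s <= 2^-1 ->
  exists C : R, 0 < C /\
    forall U, in_Hs_vec s U -> in_Hdiv U -> forall l m : 'I_2, m = rev_ord l ->
      (L2norm (RT_interp s U l) <=
        C%:E * (Hs_norm s (U l) + AHs_seminorm m s (U m) + L2norm (divg U)))%E.
Proof.
move=> s01; have /andP[s0 s1] := s01.
have c1 := hardy_cst_ge0 s0; have c2 := hardy_cst0_ge0 s0.
have g0 : 0 < green_cst s by rewrite /green_cst; lra.
exists (2 * green_cst s); split; first by rewrite mulr_gt0.
move=> U hU hD l m ->; rewrite EFinM -muleA; apply: RT_interp_le.
  by rewrite mule_ge0 ?lee_fin ?(ltW g0)// !adde_ge0// sqrte_ge0.
move=> b; rewrite /edge_moment ltNge s1/=; exact: green_moment_le.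
Qed.

End PartTwo.

(** * Moments for 1/2 < s < 1 *)

Section TraceLimit.
Context {R : realType}.
Notation mu := (@lebesgue_measure R).
Notation RR := (measurableTypeR R).
Implicit Types (s x y t r eps c : R) (z w : R * R) (u v psi phi : R * R -> R) (e : edge).
Implicit Types (j l : 'I_2) (U V : 'I_2 -> R * R -> R) (g h : R -> R).

Lemma smooth_closure_pd phi j : smooth_closure phi -> smooth_closure (pd j phi).
Proof. by move=> [B [oB sub sB]]; exists B; split => //; exact: smooth_pd. Qed.

Lemma smooth_closure_differentiable phi z :
  smooth_closure phi -> Qhat_bar z -> differentiable phi z.
Proof. by move=> [B [oB sub sB]] /sub; exact: smooth_differentiable. Qed.

Lemma smooth_closure_continuous phi z :
  smooth_closure phi -> Qhat_bar z -> {for z, continuous phi}.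
Proof. by move=> sp Qz; apply: differentiable_continuous; exact: smooth_closure_differentiable. Qed.

Lemma smooth_closure_bounded phi : smooth_closure phi ->
  exists2 M : R, 0 < M & forall z, Qhat_bar z -> `|phi z| <= M.
Proof.
move=> sp.
have cn : {within Qhat_bar, continuous (fun z => `|phi z|)}.
  apply: continuous_in_subspaceT => z /set_mem Qz; apply: continuous_comp.
    exact: smooth_closure_continuous.
  exact: norm_continuous.
have ne : (@Qhat_bar R) !=set0.
  by exists (0, 0); split => /=; rewrite in_itv/= lexx ler01.
have [c _ H] := compact_EVT_max ne (@compact_Qhat_bar R) cn.
exists (`|phi c| + 1); first by rewrite ltr_wpDl.
by move=> z Qz; apply: (@le_trans _ _ `|phi c|); rewrite ?lerDl// H// inE.
Qed.

Lemma smooth_closure_measurable phi : smooth_closure phi -> measurable_fun Qhat phi.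
Proof.
move=> sp; apply: continuous_measurable_plane; first exact: open_Qhat.
by move=> z /Qhat_sub_bar; exact: smooth_closure_continuous.
Qed.

Lemma smooth_closure_in_L2 phi : smooth_closure phi -> in_L2 phi.
Proof.
move=> sp; split; first exact: smooth_closure_measurable.
have [M M0 pM] := smooth_closure_bounded sp.
apply: (@le_lt_trans _ _ ((M ^+ 2)%:E)); last exact: ltry.
apply: L2sq_le; first exact: sqr_ge0.
move=> z /Qhat_sub_bar Qz; rewrite -[phi z ^+ 2]real_normK ?num_real//.
by rewrite lerXn2r ?nnegrE ?(ltW M0)// pM.
Qed.

Lemma Qhat_bar_mkpt j t y : 0 <= t <= 1 -> 0 <= y <= 1 -> Qhat_bar (mkpt j t y).
Proof.
by move=> ht hy; rewrite /mkpt; case: (j == ord0); split; rewrite /= in_itv.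
Qed.

Lemma is_derive_smooth_closure phi j t y : smooth_closure phi ->
  0 <= t <= 1 -> 0 <= y <= 1 ->
  is_derive t 1 (fun t => phi (mkpt j t y)) (pd j phi (mkpt j t y)).
Proof.
move=> sp ht hy; apply: is_derive_fiber.
by apply: smooth_closure_differentiable => //; exact: Qhat_bar_mkpt.
Qed.

Lemma continuous_smooth_closure phi j t y : smooth_closure phi ->
  0 <= t <= 1 -> 0 <= y <= 1 -> {for t, continuous (fun t => phi (mkpt j t y))}.
Proof.
move=> sp ht hy; have d := is_derive_smooth_closure j sp ht hy.
exact: (@is_derive_continuous _ (fun t => pd j phi (mkpt j t y)) _ _ d).
Qed.

Lemma mkpt_rev j t y : mkpt (rev_ord j) t y = mkpt j y t.
Proof. by rewrite /mkpt; case: j => -[|[|//]]. Qed.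

Lemma I01_le t : I01 t -> 0 <= t <= 1.
Proof. by move=> /I01E /andP[t0 t1]; rewrite !ltW. Qed.

Lemma bool_le01 (b : bool) : 0 <= ((b : nat)%:R : R) <= 1.
Proof. by case: b; rewrite ?lexx ?ler01. Qed.

Lemma measurable_smooth_closure_edge phi e : smooth_closure phi ->
  measurable_fun I01 (fun t => phi (edge_pt e t)).
Proof.
move=> sp; apply: open_continuous_measurable_fun; first exact: interval_open.
move=> t /set_mem It.
have H := @continuous_smooth_closure phi (rev_ord e.1) _ _ sp (I01_le It) (bool_le01 e.2).
have E : (fun t => phi (mkpt (rev_ord e.1) t (e.2 : nat)%:R)) = (fun t => phi (edge_pt e t)).
  by apply/funext => r; rewrite mkpt_rev.
exact: (eq_ind _ (fun f : R -> R => {for t, continuous f}) H _ E).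
Qed.

Lemma integrable_I01_bounded h c : measurable_fun I01 h ->
  (forall t, I01 t -> `|h t| <= c) -> mu.-integrable I01 (EFin \o h).
Proof.
move=> mh hc; apply/integrableP; split; first exact/measurable_EFinP.
apply: (@le_lt_trans _ _ (\int[mu]_(t in I01) c%:E)%E); last first.
  by rewrite integral_I01_cst ltry.
by apply: le_integral_ge0 => t It; rewrite /= lee_fin// hc.
Qed.

Lemma integral_abs_le_sq h c : 0 < c -> measurable_fun I01 h ->
  (\int[mu]_(t in I01) ((h t) ^+ 2)%:E <= (c ^+ 2)%:E)%E ->
  (\int[mu]_(t in I01) (`|h t|)%:E <= (2 * c)%:E)%E.
Proof.
move=> c0 mh hc; have mI := @measurable_I01 R.
have m2 : measurable_fun I01 (fun t => ((h t) ^+ 2)%:E).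
  by apply/measurable_EFinP; exact: measurable_funX.
have p2 t : I01 t -> (0 <= ((h t) ^+ 2)%:E)%E by rewrite lee_fin sqr_ge0.
have ci0 : 0 <= c^-1 by rewrite invr_ge0 ltW.
have E := ge0_integralZl_EFin mu mI p2 m2 ci0.
have mz : measurable_fun I01 (fun t => (c^-1)%:E * ((h t) ^+ 2)%:E)%E.
  exact: measurable_funeM.
have pz t : I01 t -> (0 <= (c^-1)%:E * ((h t) ^+ 2)%:E)%E.
  by move=> It; rewrite mule_ge0 ?lee_fin ?sqr_ge0.
have mc : measurable_fun I01 (fun t : R => c%:E) by exact: measurable_cst.
have pc (t : R) : I01 t -> (0 <= c%:E)%E by rewrite lee_fin ltW.
have ED := ge0_integralD mu mI pz mz pc mc.
apply: (@le_trans _ _ (\int[mu]_(t in I01) ((c^-1)%:E * ((h t) ^+ 2)%:E + c%:E))%E).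
  apply: le_integral_ge0 => t It; first by rewrite lee_fin.
  rewrite -EFinM -EFinD lee_fin -[h t ^+ 2]real_normK ?num_real//.
  have := normr_ge0 (h t); move: (`|h t|) => a a0.
  rewrite -(ler_pM2l c0) mulrDr mulrA divff ?gt_eqF// mul1r.
  have := sqr_ge0 (a - c); nra.
apply: (@le_trans _ _ ((c^-1)%:E * (c ^+ 2)%:E + c%:E)%E).
  apply: (@le_trans _ _ ((c^-1)%:E * \int[mu]_(t in I01) ((h t) ^+ 2)%:E + c%:E)%E); last first.
    by apply: leeD => //; apply: lee_wpmul2l => //; rewrite lee_fin.
  apply: eqW_le; apply: (etrans ED).
  by apply: f_equal2; [exact E|exact: integral_I01_cst].
rewrite -EFinM -EFinD lee_fin; apply: eqW_le.
by field; rewrite gt_eqF.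
Qed.

Lemma cvg0_sqrte_le (X : nat -> \bar R) (eta : R) : 0 < eta -> X @ \oo --> 0%E ->
  \forall k \near \oo, (X k <= (eta ^+ 2)%:E)%E.
Proof.
move=> e0 Xc; have e2 : 0 < eta ^+ 2 by rewrite exprn_gt0.
have H := Xc [set x | (x <= (eta ^+ 2)%:E)%E].
apply: H; exists (eta ^+ 2) => //=.
move=> x /=; rewrite sub0r normrN => xe.
by rewrite lee_fin; apply: (le_trans (ler_norm _)); exact: ltW.
Qed.

(** The bound assumed for the smooth functions already separates the error phi k - v from a fixed Y,
    which will be the norm of v. So it is enough to find one k for which both the error and the
    distance to g on the edge are small. *)
Lemma trace_moment_limit s e v g (phi : nat -> R * R -> R) (C : R) (Y : \bar R) :
  0 < C -> (0 <= Y)%E -> measurable_fun I01 g ->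
  (\int[mu]_(t in I01) ((g t) ^+ 2)%:E < +oo)%E ->
  (forall k, smooth_closure (phi k)) ->
  (fun k => Hs_sqnorm s (fun z => phi k z - v z)%R) @ \oo --> 0%E ->
  (fun k => \int[mu]_(t in I01) ((phi k (edge_pt e t) - g t) ^+ 2)%:E)%E @ \oo --> 0%E ->
  (forall k, (`|\int[mu]_(t in I01) phi k (edge_pt e t)|%:E <=
     C%:E * (Hs_norm s (fun z => phi k z - v z)%R + Y))%E) ->
  (`|\int[mu]_(t in I01) g t|%:E <= C%:E * Y)%E.
Proof.
move=> C0 Y0 mg g2 sp Xc Tc H; apply/lee_addgt0Pr => d d0.
have mI := @measurable_I01 R.
(* The error in H^s contributes C eta and the edge 2 eta, in all d. *)
pose eta := d / (C + 2).
have C2 : 0 < C + 2 by rewrite addr_gt0.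
have eta0 : 0 < eta by rewrite divr_gt0.
have [k [Xk Tk]] : exists k, (Hs_sqnorm s (fun z => phi k z - v z)%R <= (eta ^+ 2)%:E)%E /\
    (\int[mu]_(t in I01) ((phi k (edge_pt e t) - g t) ^+ 2)%:E <= (eta ^+ 2)%:E)%E.
  have [N _ HN] := filterI (cvg0_sqrte_le eta0 Xc) (cvg0_sqrte_le eta0 Tc).
  by exists N; have := HN N (leqnn N).
have Nk : (Hs_norm s (fun z => phi k z - v z)%R <= eta%:E)%E.
  rewrite /Hs_norm; apply: (@le_trans _ _ (sqrte ((eta ^+ 2)%:E))).
    by rewrite lee_sqrt// lee_fin sqr_ge0.
  by rewrite /= sqrtr_sqr gtr0_norm.
have [M M0 pM] := smooth_closure_bounded (sp k).
have mphi := measurable_smooth_closure_edge e (sp k).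
have iphi : mu.-integrable I01 (EFin \o (fun t => phi k (edge_pt e t))).
  apply: (@integrable_I01_bounded _ M) => // t It; apply: pM.
  by apply: Qhat_bar_mkpt; [exact: bool_le01|exact: I01_le].
have md : measurable_fun I01 (fun t => phi k (edge_pt e t) - g t) by exact: measurable_funB.
have dB := integral_abs_le_sq eta0 md Tk.
have id : mu.-integrable I01 (EFin \o (fun t => phi k (edge_pt e t) - g t)).
  apply/integrableP; split; first exact/measurable_EFinP.
  by apply: (le_lt_trans dB); exact: ltry.
have EB := @RintegralB _ RR R mu _ _ _ mI iphi id.
have Eg : \int[mu]_(t in I01) g t = \int[mu]_(t in I01) phi k (edge_pt e t) -
    \int[mu]_(t in I01) (phi k (edge_pt e t) - g t).
  rewrite -EB; congr (Rintegral _ _ _); apply/funext => t.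
  by rewrite opprB addrCA subrr addr0.
have dB' : (`|\int[mu]_(t in I01) (phi k (edge_pt e t) - g t)|%:E <= (2 * eta)%:E)%E.
  have E := @EFin_normr_Rintegral _ RR R mu _ _ mI id.
  apply: (@le_trans _ _ `|\int[mu]_(t in I01) (phi k (edge_pt e t) - g t)%:E|%E).
    exact (eqW_le E).
  have mdE : measurable_fun I01 (fun t => (phi k (edge_pt e t) - g t)%:E).
    exact/measurable_EFinP.
  by apply: (le_trans (le_abse_integral mu mI mdE)); exact: dB.
rewrite Eg; apply: (@le_trans _ _ (`|\int[mu]_(t in I01) phi k (edge_pt e t)|%:E +
   `|\int[mu]_(t in I01) (phi k (edge_pt e t) - g t)|%:E)%E).
  by rewrite -EFinD lee_fin ler_normB.
apply: (le_trans (leeD (H k) dB')).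
apply: (@le_trans _ _ (C%:E * (eta%:E + Y) + (2 * eta)%:E)%E).
  by apply: leeD => //; apply: lee_wpmul2l; [rewrite lee_fin ltW|exact: leeD].
rewrite ge0_muleDr ?lee_fin ?(ltW eta0)// addeAC addeC -EFinM -EFinD.
apply: leeD => //; rewrite lee_fin; apply: eqW_le.
by rewrite /eta; field; rewrite gt_eqF.
Qed.

End TraceLimit.

Section EndpointHardy.
Context {R : realType}.
Notation mu := (@lebesgue_measure R).
Notation RR := (measurableTypeR R).
Implicit Types (s a x y t r eps c d : R) (f g : R -> R) (b : bool).

Lemma integral_dilation x d : 0 < x -> 0 < d ->
  (\int[mu]_(t in `]0%R, d[) (x / (x + t) ^+ 2)%:E = (d / (x + d))%:E)%E.
Proof.
move=> x0 d0.
have D0 t : 0 <= t -> x + t != 0 by move=> t0; rewrite gt_eqF// ltr_pwDl.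
have dD t : is_derive t 1 (fun t => x + t) (0 + 1) by exact: is_deriveD.
have dV t : 0 <= t -> is_derive t 1 (fun t => t / (x + t)) (x / (x + t) ^+ 2).
  move=> t0; have dVt := @is_deriveV _ (fun t => x + t) t _ 1 (D0 t t0) (dD t).
  have H := is_deriveM (is_derive_id t (1 : R)) dVt.
  apply: (is_derive_eq H); rewrite /GRing.scale/=; field; exact: D0.
have H := @FTC2_open R (fun t => x / (x + t) ^+ 2) (fun t => t / (x + t)) 0 d d0.
apply: (etrans (H _ _)).
- by move=> t /andP[t0 _]; exact: dV.
- move=> t /andP[t0 _].
  have cD : {for t, continuous (fun t => x + t)} :=
    @is_derive_continuous _ (cst (0 + 1)) _ _ (dD t).
  apply: cvgM; first exact: cvg_cst.
  by apply: cvgV; [rewrite expf_neq0// D0|apply: cvgM; exact: cD].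
- by rewrite mul0r subr0.
Qed.

Local Open Scope ereal_scope.

(** The kernels x / (x + t)^2 are an approximate identity at 0: their mass on ]0, d[ is d / (x + d),
    which tends to 1 as x tends to 0. A bound that is uniform in x therefore passes to |g 0|. *)
Lemma endpoint_le_core g (A : \bar R) : measurable_fun I01 g -> {for 0%R, continuous g} ->
  (forall x, (0 < x)%R -> \int[mu]_(t in I01) (`|g t| * (x / (x + t) ^+ 2))%:E <= A) ->
  (`|g 0%R|%R)%:E <= A.
Proof.
move=> mg cg H.
have A0 : 0 <= A.
  apply: le_trans (H 1%R ltr01); apply: integral_ge0 => t _.
  by rewrite lee_fin mulr_ge0// divr_ge0// sqr_ge0.
apply/lee_addgt0Pr => eps eps0.
have [M0|M0] := leP (`|g 0|%R - eps / 2)%R 0%R.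
  apply: (@le_trans _ _ (0 + eps%:E)); last by apply: leeD.
  by rewrite add0e lee_fin; move: M0; lra.
have e2 : (0 < eps / 2)%R by rewrite divr_gt0.
set c := (`|g 0| - eps / 2)%R; have c0 : (0 < c)%R := M0.
have [d /andP[d0 d1] dg] : exists2 d : R, (0 < d <= 1)%R &
    forall t, (0 < t < d)%R -> (c <= `|g t|)%R.
  have /cvgrPdist_lt /(_ _ e2) [d /= d0 dP] := cg.
  exists (Num.min d 1)%R; first by rewrite lt_min d0 ltr01 ge_min lexx orbT.
  move=> t /andP[t0]; rewrite lt_min => /andP[td t1].
  have : (ball 0 d t)%R by rewrite /ball/= sub0r normrN gtr0_norm.
  move=> /dP /= gt; rewrite /c.
  have := ler_normD (g 0 - g t)%R (g t); rewrite subrK.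
  by move: gt; lra.
have M1 : (0 < `|g 0|)%R by move: M0; lra.
(* Chosen such that x / d = eps / (2 |g 0|): the mass lost outside ]0, d[ then costs at most eps /
   2. The other eps / 2 is the oscillation of g on ]0, d[. *)
pose x := (d * eps / (2 * `|g 0|))%R.
have x0 : (0 < x)%R by rewrite divr_gt0 ?mulr_gt0.
have I1 : \int[mu]_(t in `]0%R, d[) (c * (x / (x + t) ^+ 2))%:E <= A.
  apply: le_trans (H x x0).
  have sub : `]0%R, d[%classic `<=` @I01 R.
    move=> t /=; rewrite /I01/= !in_itv/= => /andP[t0 td]; rewrite t0/=.
    exact: lt_le_trans td d1.
  have mf : measurable_fun I01 (fun t => (`|g t| * (x / (x + t) ^+ 2))%:E) by measE.
  apply: (@le_trans _ _ (\int[mu]_(t in `]0%R, d[) (`|g t| * (x / (x + t) ^+ 2))%:E)).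
    apply: le_integral_ge0 => t /=; rewrite in_itv/= => t0d.
      by rewrite lee_fin (mulr_ge0 (ltW c0))// divr_ge0 ?sqr_ge0 ?(ltW x0).
    rewrite lee_fin; apply: ler_wpM2r; last exact: dg.
    by rewrite divr_ge0 ?sqr_ge0 ?(ltW x0).
  apply: (@ge0_subset_integral _ RR R mu _ _ _ _ _ mf) => //.
  - exact: measurable_I01.
  - by move=> t _; rewrite lee_fin mulr_ge0// divr_ge0 ?sqr_ge0 ?(ltW x0).
have mk : measurable_fun (`]0%R, d[%classic : set R) (fun t => (x / (x + t) ^+ 2)%:E) by measE.
have k0 t : `]0%R, d[%classic t -> 0 <= (x / (x + t) ^+ 2)%:E.
  by move=> _; rewrite lee_fin divr_ge0 ?sqr_ge0 ?(ltW x0).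
have mJ : measurable (`]0%R, d[%classic : set R) by exact: measurable_itv.
have E := ge0_integralZl_EFin mu mJ k0 mk (ltW M0).
have E2 : \int[mu]_(t in `]0%R, d[) (c * (x / (x + t) ^+ 2))%:E = (c * (d / (x + d)))%:E.
  apply: (etrans E).
  exact (congr1 (fun X => c%:E * X) (integral_dilation x0 d0)).
have I2 : (c * (d / (x + d)))%:E <= A by rewrite -E2.
apply: (@le_trans _ _ ((c * (d / (x + d)))%:E + eps%:E)); last exact: leeD.
rewrite -EFinD lee_fin.
have xd : (0 < x + d)%R by rewrite addr_gt0.
have q : (d / (x + d) >= 1 - x / d)%R.
  rewrite ler_pdivlMr//; have -> : ((1 - x / d) * (x + d) = d - x ^+ 2 / d)%R.
    by field; rewrite gt_eqF.
  by rewrite gerBl divr_ge0 ?sqr_ge0// ltW.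
have xdE : (x / d = eps / (2 * `|g 0|))%R.
  by rewrite /x; field; rewrite !gt_eqF.
rewrite xdE in q.
have h1 : (c * (1 - eps / (2 * `|g 0|)) <= c * (d / (x + d)))%R.
  by rewrite (ler_wpM2l (ltW c0)).
have h2 : (c * (eps / (2 * `|g 0|)) <= eps / 2)%R.
  apply: (@le_trans _ _ (`|g 0| * (eps / (2 * `|g 0|)))%R).
    apply: ler_wpM2r; first by rewrite divr_ge0 ?mulr_ge0// ltW.
    by rewrite /c; lra.
  by apply: eqW_le; field; rewrite gt_eqF.
have cE : (c = `|g 0| - eps / 2)%R by [].
rewrite (_ : c * (1 - _) = c - c * (eps / (2 * `|g 0|)))%R in h1; last by ring.
have arith (X1 X2 X3 G : R) : (X1 - X2 <= X3)%R -> (X2 <= eps / 2)%R ->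
    (X1 = G - eps / 2)%R -> (G <= X3 + eps)%R by lra.
exact: arith h1 h2 cE.
Qed.

(** The kernels on the right of the Hardy inequality increase as x decreases to 0, so with [kap 0]
    the bound is uniform in x, as [endpoint_le_core] requires. The end 1 follows by reflection. *)
Lemma endpoint_le f b : measurable_fun I01 f ->
  {for (b : nat)%:R%R, continuous f} ->
  (`|f (b : nat)%:R|%R)%:E <=
  \int[mu]_(t in I01) (`|f t|)%:E +
  \int[mu]_(t in I01) \int[mu]_(r in I01) (`|f t - f r| * kap 0 t r)%:E.
Proof.
move=> mf cf; set A := _ + _.
have k1 x t r : (0 < x)%R -> I01 t -> (`|f t - f r| * ((r < t)%R%:R / (x + t) ^+ 2) <=
    `|f t - f r| * kap 0 t r)%R.
  move=> x0 /I01E /andP[t0 t1]; rewrite ler_wpM2l// /kap add0r.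
  rewrite -[leLHS]addr0; apply: lerD; last by rewrite divr_ge0 ?sqr_ge0.
  rewrite ler_wpM2l// lef_pV2 ?posrE ?exprn_gt0 ?addr_gt0//.
  by rewrite lerXn2r ?nnegrE ?(ltW t0) ?(ltW (addr_gt0 x0 t0)) ?lerDr ?(ltW x0).
have k2 x t r : (0 < x)%R -> I01 t -> (`|f t - f r| * ((t < r)%R%:R / (x + (1 - t)) ^+ 2) <=
    `|f t - f r| * kap 0 t r)%R.
  move=> x0 /I01E /andP[t0 t1]; rewrite ler_wpM2l// /kap.
  rewrite -[leLHS]add0r; apply: lerD; first by rewrite divr_ge0 ?sqr_ge0.
  have t1' : (0 < 1 - t)%R by rewrite subr_gt0.
  rewrite ler_wpM2l// add0r lef_pV2 ?posrE ?(exprn_gt0 _ t1') ?(exprn_gt0 _ (addr_gt0 x0 t1'))//.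
  by rewrite lerXn2r ?nnegrE ?(ltW t1') ?(ltW (addr_gt0 x0 t1')) ?lerDr ?(ltW x0).
case: b cf => /= cf; last first.
  have H := @endpoint_le_core f A mf cf; apply: H => x x0.
  apply: (le_trans (hardy_half x0 mf)); apply: leeD => //.
  apply: le_integral_ge0 => t It; first by apply: integral_ge0 => r _; rewrite lee_fin mulr_ge0// divr_ge0 ?sqr_ge0.
  apply: le_integral_ge0 => r Ir; first by rewrite lee_fin mulr_ge0// divr_ge0 ?sqr_ge0.
  by rewrite lee_fin; exact: k1.
have H := @endpoint_le_core (fun t => f (1 - t))%R A (measurable_I01_onem mf).
rewrite subr0 in H; apply: H.
  have c1 : {for 0%R, continuous (fun t : R => 1 - t)%R}.
    by apply: cvgB; [exact: cvg_cst|exact: cvg_id].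
  by apply: continuous_comp; [exact: c1|rewrite subr0].
move=> x x0.
have mh : measurable_fun I01 (fun t => (`|f t| * (x / (x + (1 - t)) ^+ 2))%:E) by measE.
have h0 t : I01 t -> 0 <= (`|f t| * (x / (x + (1 - t)) ^+ 2))%:E.
  by move=> _; rewrite lee_fin mulr_ge0// divr_ge0 ?sqr_ge0// ltW.
have E := integral_I01_onem mh h0.
apply: (@le_trans _ _ (\int[mu]_(t in I01) (`|f t| * (x / (x + (1 - t)) ^+ 2))%:E)).
  rewrite -E; apply: eqW_le; apply: eq_integral => t _.
  by rewrite (_ : 1 - (1 - t) = t)%R//; ring.
apply: (le_trans (hardy_half_onem x0 mf)); apply: leeD => //.
apply: le_integral_ge0 => t It; first by apply: integral_ge0 => r _; rewrite lee_fin mulr_ge0// divr_ge0 ?sqr_ge0.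
apply: le_integral_ge0 => r Ir; first by rewrite lee_fin mulr_ge0// divr_ge0 ?sqr_ge0.
by rewrite lee_fin; exact: k2.
Qed.

End EndpointHardy.

Section FractionalTrace.
Context {R : realType}.
Notation mu := (@lebesgue_measure R).
Notation RR := (measurableTypeR R).
Implicit Types (s a x y t r c : R) (z w : R * R) (u v phi : R * R -> R) (e : edge).
Implicit Types (j l : 'I_2) (U : 'I_2 -> R * R -> R) (b : bool).

(** Here x = 0, and the power 2 s - 3 is shared by t and r alone: 2 (a - 1) = 2 s - 3 for a = s -
    1/2, which is positive exactly when s > 1/2. The factor [wt a y], which is at least 1, is
    inserted to reach the three-variable form integrated in [T3_wt]. *)
Lemma kap0_sq_le s t r y : 2^-1 < s <= 1 -> 0 < t < 1 -> 0 < r < 1 -> 0 < y < 1 ->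
  kap 0 t r ^+ 2 * `|t - r| `^ (1 + 2 * s) <=
  wt (s - 2^-1) y * wt (s - 2^-1) t * wt (s - 2^-1) r.
Proof.
move=> /andP[s0 s1] t01 r01 /andP[y0 y1]; set a := s - 2^-1.
have a1 : a - 1 <= 0 by rewrite /a; lra.
have core p q : 0 < q -> q < p ->
    ((0 + p) ^+ 2)^-1 ^+ 2 * (p - q) `^ (1 + 2 * s) <= p `^ (a - 1) * q `^ (a - 1).
  move=> q0 qs; have p0 : 0 < p by apply: lt_trans qs.
  apply: (@le_trans _ _ (p `^ (- 4%:R) * p `^ (1 + 2 * s))).
    apply: ler_pM; rewrite ?sqr_ge0 ?powR_ge0//.
      rewrite add0r powR_invn ?(ltW p0)//; apply: eqW_le.
      by field; rewrite gt_eqF.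
    by rewrite ge0_ler_powR ?nnegrE//; lra.
  rewrite -powRD; last by rewrite (gt_eqF p0) implybT.
  rewrite (_ : - 4%:R + (1 + 2 * s) = (a - 1) + (a - 1)); last by rewrite /a; field.
  rewrite powRD; last by rewrite (gt_eqF p0) implybT.
  by apply: ler_wpM2l; [exact: powR_ge0|apply: powR_nincr => //; lra].
have wy : 1 <= wt a y.
  apply: (@le_trans _ _ (y `^ (a - 1))); last by rewrite lerDl powR_ge0.
  have E : 1 `^ (a - 1) = 1 :> R by rewrite powR1.
  rewrite -[leLHS]E; apply: powR_nincr => //; exact: ltW.
have fin p p' q q' : 0 <= p `^ (a - 1) -> p `^ (a - 1) <= p' -> q `^ (a - 1) <= q' ->
    p `^ (a - 1) * q `^ (a - 1) <= wt a y * p' * q'.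
  move=> pp ss qq; apply: ler_pM; rewrite ?powR_ge0//.
  by rewrite -[leLHS]mul1r; apply: ler_pM.
have w1 p : p `^ (a - 1) <= wt a p by rewrite lerDl powR_ge0.
have w2 p : (1 - p) `^ (a - 1) <= wt a p by rewrite lerDr powR_ge0.
move: t01 r01 => /andP[t0 t1] /andP[r0 r1].
rewrite /kap; have [rt|tr|->] := ltgtP r t.
- rewrite mul1r mul0r addr0 gtr0_norm ?subr_gt0//.
  by apply: (le_trans (core _ _ r0 rt)); apply: fin; rewrite ?powR_ge0.
- rewrite mul1r mul0r add0r ltr0_norm ?subr_lt0//.
  have -> : - (t - r) = (1 - t) - (1 - r) by ring.
  apply: (le_trans (core _ _ _ _)); [lra|lra|].
  by apply: fin; rewrite ?powR_ge0.
- by rewrite !mul0r addr0 expr0n/= mul0r !mulr_ge0 ?wt_ge0.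
Qed.

Local Open Scope ereal_scope.

Let k0Q j z r : R := kap 0 (xcoord j z) r.

Let measurable_k0Q j : measurable_fun QI (fun p => k0Q j p.1 p.2).
Proof. by rewrite /k0Q /kap; meas. Qed.

Let k0Q_ge0 j z r : (0 <= k0Q j z r)%R. Proof. exact: kap_ge0. Qed.

Let measurable_k0Q_diff j u : measurable_fun Qhat u ->
  measurable_fun QI (fun p => (`|u p.1 - u (setc j p.1 p.2)| * k0Q j p.1 p.2)%:E).
Proof.
move=> mu_; have m1 := measurable_QI_fst mu_; have m2 := measurable_QI_setc j mu_.
by have m3 := measurable_k0Q j; measE.
Qed.

Let k0Q_diff_ge0 j u z r : 0 <= (`|u z - u (setc j z r)| * k0Q j z r)%:E.
Proof. by rewrite lee_fin mulr_ge0. Qed.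

Lemma T3_kap0 j s u : (2^-1 < s <= 1)%R -> measurable_fun Qhat u ->
  T3 (fun z r => (`|u z - u (setc j z r)| * k0Q j z r)%:E) <=
  (1 + (2 / (s - 2^-1)) ^+ 3)%:E * AHs_seminorm j s u.
Proof.
move=> s01 mu_; rewrite AHs_seminormE//; move: (s01) => /andP[s0 _].
have a0 : (0 < s - 2^-1)%R by rewrite subr_gt0.
apply: lin_of_quad; first exact: semi_sq_ge0.
  by rewrite exprn_ge0// divr_ge0// ltW.
move=> l l0; apply: (le_trans (T3_pairing j s l0 mu_ (measurable_k0Q j) (@k0Q_ge0 j))).
apply: leeD => //.
rewrite [leRHS](_ : _ = (l^-1)%:E * ((2 / (s - 2^-1)) ^+ 3)%:E); last by rewrite -EFinM mulrC.
rewrite lee_wpmul2l ?lee_fin ?invr_ge0 ?(ltW l0)//.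
apply: le_trans (T3_wt j a0); apply: T3_le => z r Qz Ir.
  by rewrite lee_fin mulr_ge0 ?sqr_ge0// powR_ge0.
by rewrite lee_fin; apply: kap0_sq_le => //; apply/I01E => //; exact: Qhat_xcoord.
Qed.

(** The right-hand side of [endpoint_le] integrated over the lines. Being of L^1 type it satisfies
    the triangle inequality pointwise, so an approximation is split into error and limit at this
    level, before the H^s norms enter. *)
Let edgeN j u : \bar R := \int[leb2]_(z in Qhat) (`|u z|)%:E +
  T3 (fun z r => (`|u z - u (setc j z r)| * k0Q j z r)%:E).

(** The order on the lines is the midpoint of 1/2 and s: above 1/2 for [T3_kap0], below s for
    [AHs_le_Hs]. *)
Definition trace_cst s : R :=
  2 + (1 + (2 / ((s + 2^-1) / 2 - 2^-1)) ^+ 3) * slice_cst ((s + 2^-1) / 2) s.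

Lemma trace_cst_gt0 s : (2^-1 < s)%R -> (0 < trace_cst s)%R.
Proof.
move=> s0; rewrite /trace_cst; apply: ltr_pwDl => //; apply: mulr_ge0.
  by rewrite addr_ge0// exprn_ge0// divr_ge0//; lra.
by apply: slice_cst_ge0; lra.
Qed.

Let edgeN_le_Hs j s u : (2^-1 < s < 1)%R -> measurable_fun Qhat u ->
  edgeN j u <= (trace_cst s)%:E * Hs_norm s u.
Proof.
move=> /andP[s0 s1] mu_; set r := ((s + 2^-1) / 2)%R.
have r01 : (2^-1 < r <= 1)%R by rewrite /r; apply/andP; split; lra.
have rs : (0 < r < s)%R by rewrite /r; apply/andP; split; lra.
have s01 : (0 < s < 1)%R by apply/andP; split; lra.
have k0 : (0 <= 1 + (2 / (r - 2^-1)) ^+ 3)%R.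
  by rewrite addr_ge0// exprn_ge0// divr_ge0// /r; lra.
have H0 : 0 <= Hs_norm s u by exact: sqrte_ge0.
have B1 := le_trans (L1_le_L2 mu_)
  (lee_wpmul2l (_ : 0 <= 2%:E) (L2norm_le_Hs u s01)).
have B2 := le_trans (T3_kap0 j r01 mu_)
  (lee_wpmul2l (_ : 0 <= (1 + (2 / (r - 2^-1)) ^+ 3)%:E) (AHs_le_Hs j rs s1 mu_)).
apply: (le_trans (leeD (B1 _) (B2 _))); rewrite ?lee_fin//.
rewrite muleA -EFinM -ge0_muleDl// lee_fin mulr_ge0//.
by apply: slice_cst_ge0; case/andP: rs.
Qed.

Let edgeN_triangle j u v : measurable_fun Qhat u -> measurable_fun Qhat v ->
  edgeN j u <= edgeN j (fun z => u z - v z)%R + edgeN j v.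
Proof.
move=> mu_ mv; have mQ := @measurable_Qhat R.
have md : measurable_fun Qhat (fun z => u z - v z)%R by exact: measurable_funB.
have ma (f : R * R -> R) : measurable_fun Qhat f -> measurable_fun Qhat (fun z => (`|f z|)%:E).
  by move=> mf; exact/measurable_EFinP/measurable_norm.
have a0 (f : R * R -> R) z : Qhat z -> 0 <= (`|f z|)%:E by rewrite lee_fin.
have E1 := ge0_integralD leb2 mQ (a0 _) (ma _ md) (a0 _) (ma _ mv).
have E2 := T3D (measurable_k0Q_diff j md) (measurable_k0Q_diff j mv)
  (fun z r _ _ => k0Q_diff_ge0 j _ z r) (fun z r _ _ => k0Q_diff_ge0 j _ z r).
have L1 : \int[leb2]_(z in Qhat) (`|u z|)%:E <=
    \int[leb2]_(z in Qhat) (`|u z - v z|)%:E + \int[leb2]_(z in Qhat) (`|v z|)%:E.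
  apply: (@le_trans _ _ (\int[leb2]_(z in Qhat) ((`|u z - v z|)%:E + (`|v z|)%:E))).
    apply: le_integral_ge0 => z _; first by rewrite lee_fin.
    by rewrite -EFinD lee_fin -{1}(subrK (v z) (u z)) ler_normD.
  exact (eqW_le E1).
have L2 : T3 (fun z r => (`|u z - u (setc j z r)| * k0Q j z r)%:E) <=
    T3 (fun z r => (`|u z - v z - (u (setc j z r) - v (setc j z r))| * k0Q j z r)%:E) +
    T3 (fun z r => (`|v z - v (setc j z r)| * k0Q j z r)%:E).
  apply: (@le_trans _ _ (T3 (fun z r =>
      (`|u z - v z - (u (setc j z r) - v (setc j z r))| * k0Q j z r)%:E +
      (`|v z - v (setc j z r)| * k0Q j z r)%:E))).
    apply: T3_le => z r _ _; first exact: k0Q_diff_ge0.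
    rewrite -EFinD lee_fin -mulrDl; apply: ler_wpM2r => //.
    have {1}-> : (u z - u (setc j z r) = (u z - v z - (u (setc j z r) - v (setc j z r))) +
      (v z - v (setc j z r)))%R by ring.
    exact: ler_normD.
  exact (eqW_le E2).
by apply: (le_trans (leeD L1 L2)); rewrite addeACA.
Qed.

Let edge_le_edgeN e phi : smooth_closure phi ->
  (`|\int[mu]_(t in I01) phi (edge_pt e t)|%R)%:E <= edgeN e.1 phi.
Proof.
move=> sp; have mI := @measurable_I01 R; have mphi := smooth_closure_measurable sp.
set j := e.1.
have [M M0 pM] := smooth_closure_bounded sp.
have me := measurable_smooth_closure_edge e sp.
have ie : mu.-integrable I01 (EFin \o (fun t => phi (edge_pt e t))).
  apply: (@integrable_I01_bounded _ _ M) => // t It; apply: pM.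
  by apply: Qhat_bar_mkpt; [exact: bool_le01|exact: I01_le].
have E := @EFin_normr_Rintegral _ RR R mu _ _ mI ie.
have meE : measurable_fun I01 (fun t => (phi (edge_pt e t))%:E) by exact/measurable_EFinP.
apply: (@le_trans _ _ `|\int[mu]_(t in I01) (phi (edge_pt e t))%:E|).
  exact (eqW_le E).
apply: (le_trans (le_abse_integral mu mI meE)).
have ma : measurable_fun Qhat (fun z => (`|phi z|)%:E).
  exact/measurable_EFinP/measurable_norm.
have a0 z : Qhat z -> 0 <= (`|phi z|)%:E by rewrite lee_fin.
have mk := measurable_k0Q_diff j mphi.
have k0 z r : Qhat z -> I01 r -> 0 <= (`|phi z - phi (setc j z r)| * k0Q j z r)%:E.
  by move=> _ _; exact: k0Q_diff_ge0.
have mK := measurable_inner_QI mk k0.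
have K0 z : Qhat z ->
    0 <= \int[mu]_(r in I01) (`|phi z - phi (setc j z r)| * k0Q j z r)%:E.
  by move=> Qz; apply: integral_ge0 => r; exact: k0.
have mA := measurable_fiber_integral j ma a0.
have mB := measurable_fiber_integral j mK K0.
have A0 y : I01 y -> 0 <= \int[mu]_(t in I01) (`|phi (mkpt j t y)|)%:E.
  by move=> _; apply: integral_ge0 => t _; rewrite lee_fin.
have B0 y : I01 y -> 0 <= \int[mu]_(t in I01) \int[mu]_(r in I01)
    (`|phi (mkpt j t y) - phi (setc j (mkpt j t y) r)| * k0Q j (mkpt j t y) r)%:E.
  by move=> Iy; apply: integral_ge0 => t It; apply/K0/QhatE.
have ED := ge0_integralD mu mI A0 mA B0 mB.
rewrite /edgeN (integral_Qhat j ma a0) (T3_fiber j mk k0).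
apply: (@le_trans _ _ (\int[mu]_(y in I01) (\int[mu]_(t in I01) (`|phi (mkpt j t y)|)%:E +
  \int[mu]_(t in I01) \int[mu]_(r in I01)
    (`|phi (mkpt j t y) - phi (setc j (mkpt j t y) r)| * k0Q j (mkpt j t y) r)%:E))); last first.
  exact (eqW_le ED).
apply: le_integral_ge0 => y Iy; first exact: abse_ge0.
have mfy := measurable_fiber j Iy mphi.
have cf := @continuous_smooth_closure _ phi j _ _ sp (bool_le01 e.2) (I01_le Iy).
apply: (le_trans (endpoint_le mfy cf)); apply: leeD; first exact: lexx.
apply: le_integral_ge0 => t It.
  by apply: integral_ge0 => r _; rewrite lee_fin mulr_ge0// kap_ge0.
apply: le_integral_ge0 => r _; first by rewrite lee_fin mulr_ge0// kap_ge0.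
by rewrite /k0Q xcoord_mkpt setc_mkpt.
Qed.

Lemma Hs_norm_sign s u b : (0 < s < 1)%R ->
  Hs_norm s (fun z => u z * (if b then 1 else -1))%R = Hs_norm s u.
Proof.
move=> s01; set v : R * R -> R := fun z => _.
have E1 : L2sq v = L2sq u.
  by apply: eq_integral => z _; rewrite /v exprMn (_ : (if b then 1 else -1) ^+ 2 = 1)%R ?mulr1//; clear v; case: b; rewrite ?sqrrN expr1n.
have E2 : gagliardo_sq s v = gagliardo_sq s u.
  apply: eq_integral => z _; apply: eq_integral => w _; rewrite /v -mulrBl exprMn.
  by rewrite (_ : (if b then 1 else -1) ^+ 2 = 1)%R ?mulr1//; clear v E1; case: b; rewrite ?sqrrN expr1n.
by rewrite /Hs_norm (Hs_sqnorm_lt1 v s01) (Hs_sqnorm_lt1 u s01) E1 E2.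
Qed.

Lemma normal_compE U e :
  normal_comp U e = (fun z => U e.1 z * (if e.2 then 1 else -1))%R.
Proof.
apply/funext => z; rewrite /normal_comp (bigD1 e.1)//= big1 ?addr0.
  by rewrite /edge_normal eqxx.
by move=> k kl; rewrite /edge_normal/= (negbTE kl) mulr0.
Qed.

Lemma trace_moment_le_frac s U l b : (2^-1 < s < 1)%R -> in_Hs_vec s U ->
  (`|trace_moment s U (l, b)|%R)%:E <= (trace_cst s)%:E * Hs_norm s (U l).
Proof.
move=> s01 hU; have /andP[s0 s1] := s01; set e : edge := (l, b).
have s01' : (0 < s < 1)%R by apply/andP; split; lra.
have C0 := trace_cst_gt0 s0.
(* In the default branch of [xget] the trace is the zero function; otherwise its specification
   supplies the smooth approximations. *)
rewrite /trace_moment /edge_trace; case: xgetP => [g _ [[mg g2] [phi [sp Xc Tc]]]|_]; last first.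
  rewrite /Rintegral integral0_eq//= normr0 mule_ge0 ?lee_fin ?(ltW C0)//.
  exact: sqrte_ge0.
have mUl := in_Hs_measurable (hU l).
have vE := normal_compE U e; set v := normal_comp U e in Xc vE *.
have mv : measurable_fun Qhat v.
  by rewrite vE; apply: measurable_funM => //; exact: measurable_cst.
have Nv : Hs_norm s v = Hs_norm s (U l) by rewrite vE Hs_norm_sign.
rewrite -Nv; apply: (trace_moment_limit C0 _ mg g2 sp Xc Tc) => [|k].
  exact: sqrte_ge0.
have mphi := smooth_closure_measurable (sp k).
have md : measurable_fun Qhat (fun z => phi k z - v z)%R by exact: measurable_funB.
apply: (le_trans (edge_le_edgeN e (sp k))).
apply: (le_trans (edgeN_triangle e.1 mphi mv)).
have L := leeD (edgeN_le_Hs e.1 s01 md) (edgeN_le_Hs e.1 s01 mv).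
have E := @ge0_muleDr R (trace_cst s)%:E (Hs_norm s (fun z => phi k z - v z)%R)
  (Hs_norm s v) (sqrte_ge0 _) (sqrte_ge0 _).
by apply: (le_trans L); exact (eqW_le (esym E)).
Qed.

End FractionalTrace.

(** * Moments for s >= 1 *)

Section Cutoff.
Context {R : realType}.
Implicit Types (x y t r h : R) (z w : R * R) (k n : nat) (i j l : 'I_2) (b : bool).

(* flat at 0; closed under derivation up to linear combinations (is_derive_flat) *)
Definition flat k t : R := if 0 < t then t^-1 ^+ k * expR (- t^-1) else 0.

Lemma flat_gt0 k t : 0 < t -> flat k t = t^-1 ^+ k * expR (- t^-1).
Proof. by rewrite /flat => ->. Qed.

Lemma flat_le0 k t : t <= 0 -> flat k t = 0.
Proof. by rewrite /flat ltNge => ->. Qed.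

Lemma flat_ge0 k t : 0 <= flat k t.
Proof.
by rewrite /flat; case: ltP => // t0; rewrite mulr_ge0 ?expR_ge0// exprn_ge0// invr_ge0 ltW.
Qed.

(** The term X^(k + 1) / (k + 1)! of the exponential series at X = 1 / t compensates the power t^-k
    and leaves one factor t. *)
Lemma flat_le k t : 0 < t -> flat k t <= (k.+1)`!%:R * t.
Proof.
move=> t0; rewrite flat_gt0//; have ti : 0 < t^-1 by rewrite invr_gt0.
have H := expR_ge1Dxn k (ltW ti).
have f0 : 0 < (k.+1)`!%:R :> R by rewrite ltr0n fact_gt0.
rewrite expRN ler_pdivrMr ?expR_gt0//.
apply: (@le_trans _ _ ((k.+1)`!%:R * t * (t^-1 ^+ k.+1 / (k.+1)`!%:R))).
  rewrite exprS; apply: eqW_le; field.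
  by rewrite !gt_eqF.
by apply: ler_wpM2l; [rewrite mulr_ge0 ?ltW|apply: le_trans H; rewrite lerDr].
Qed.

Lemma flat0_le1 t : flat 0 t <= 1.
Proof.
rewrite /flat; case: ltP => // t0; rewrite expr0 mul1r -expR0 ler_expR.
by rewrite oppr_le0 invr_ge0 ltW.
Qed.

(** At 0 the difference quotient of [flat k] is [flat k.+1], which tends to 0 by [flat_le]; hence
    the same formula holds on the whole line. *)
Lemma is_derive_flat k t : is_derive t 1 (flat k) (- k%:R * flat k.+1 t + flat k.+2 t).
Proof.
have [t0|t0|->] := ltgtP t 0.
- rewrite !flat_le0 ?ltW// mulr0 addr0.
  have H : is_derive t 1 (cst 0 : R -> R) 0 by exact: is_derive_cst.
  apply: near_eq_is_derive H; near=> r; rewrite flat_le0//; near: r.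
  exact: lt_le_nbhsl.
- have ti : t != 0 by rewrite gt_eqF.
  have di : is_derive t 1 (fun r => r^-1) (- t ^- 2 *: 1).
    exact: (@is_deriveV _ id t 1 1 ti (is_derive_id t 1)).
  have dN : is_derive t 1 (fun r => - r^-1) (- (- t ^- 2 *: 1)) by exact: is_deriveN.
  have dX : is_derive t 1 (fun r => r^-1 ^+ k) ((k%:R * t^-1 ^+ k.-1) *: (- t ^- 2 *: 1)).
    have HX := @is_deriveX _ _ (fun r : R => r^-1) k t 1 _ di.
    rewrite (_ : (fun r : R => r^-1 ^+ k) = (fun r : R => r^-1) ^+ k)//.
    by apply/funext => r; rewrite fctE.
  have dE : is_derive t 1 (fun r => expR (- r^-1)) (expR (- t^-1) * (- (- t ^- 2 *: 1))).
    exact: (@is_derive1_comp _ expR (fun r => - r^-1)).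
  have H := is_deriveM dX dE.
  have {}H : is_derive t 1 (fun r => r^-1 ^+ k * expR (- r^-1))
      (- k%:R * flat k.+1 t + flat k.+2 t).
    apply: (is_derive_eq H); rewrite !flat_gt0// /GRing.scale/= !mulr1.
    by case: (k) => [|m]; rewrite ?mul0r /= ?exprS ?expr0; field.
  apply: near_eq_is_derive H; near=> r; rewrite flat_gt0//; near: r.
  exact: lt_nbhsr.
- rewrite !flat_le0// mulr0 addr0.
  have H : (fun h : R => h^-1 *: ((flat k \o shift (0 : R)) (h *: (1 : R)) - flat k 0))
      @ (0 : R)^' --> (0 : R).
    apply/cvgrPdist_le => eps eps0.
    have C0 : 0 < (k.+2)`!%:R :> R by rewrite ltr0n fact_gt0.
    have e0 : 0 < eps / (k.+2)`!%:R by rewrite divr_gt0.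
    exists (eps / (k.+2)`!%:R) => //= r; rewrite /ball_/= sub0r normrN => rl r0.
    rewrite sub0r normrN addr0 (flat_le0 _ (lexx 0)) subr0 /GRing.scale/= mulr1.
    have [r1|r1] := leP r 0; first by rewrite flat_le0// mulr0 normr0 ltW.
    have -> : r^-1 * flat k r = flat k.+1 r by rewrite !flat_gt0// exprS mulrA.
    rewrite ger0_norm ?flat_ge0//; apply: (le_trans (flat_le _ r1)).
    by rewrite mulrC -ler_pdivlMr// (le_trans (ler_norm r))// ltW.
  apply: DeriveDef; first by apply/cvg_ex; exists 0.
  exact: cvg_lim.
Unshelve. all: by end_near.
Qed.

Lemma differentiable_xcoord i z : differentiable (@xcoord R i) z.
Proof.
rewrite /xcoord; case: (i == ord0).
  apply: (@linear_differentiable _ (R * R)%type R (fst : {linear (R * R)%type -> R^o})).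
  by move=> w; exact: cvg_fst.
apply: (@linear_differentiable _ (R * R)%type R (snd : {linear (R * R)%type -> R^o})).
by move=> w; exact: cvg_snd.
Qed.

Lemma differentiable_coord_comp (f f' : R -> R) i z :
  (forall t, is_derive t 1 f (f' t)) -> differentiable (fun z => f (xcoord i z)) z.
Proof.
move=> df; apply: differentiable_comp; first exact: differentiable_xcoord.
by apply/derivable1_diffP; exact: (@ex_derive _ _ _ _ _ _ _ (df (xcoord i z))).
Qed.

Lemma pd_coord_comp (f f' : R -> R) i j z : (forall t, is_derive t 1 f (f' t)) ->
  pd j (fun z => f (xcoord i z)) z = if i == j then f' (xcoord i z) else 0.
Proof.
move=> df; rewrite -[z in LHS](mkpt_xcoord j).
have H1 := is_derive_fiber (@differentiable_coord_comp f f' i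
  (mkpt j (xcoord j z) (xcoord (rev_ord j) z)) df).
have E1 := @derive_val _ _ _ _ _ _ _ H1; apply: (etrans (esym E1)).
have [->|ij] := eqVneq i j.
  have E : (fun t => f (xcoord j (mkpt j t (xcoord (rev_ord j) z)))) = f.
    by apply/funext => t; rewrite xcoord_mkpt.
  by rewrite E; exact: (@derive_val _ _ _ _ _ _ _ (df _)).
have E : (fun t => f (xcoord i (mkpt j t (xcoord (rev_ord j) z)))) =
    cst (f (xcoord (rev_ord j) z)).
  by apply/funext => t; rewrite (ord2_neq ij) xcoord_mkpt_rev.
by rewrite E derive_cst.
Qed.

(** The argument of [flat] is positive only where [quad] exceeds 1 / (n + 1), hence away from both
    ends. At every interior point it tends to infinity with n, so [flat 0] tends to 1. *)
Definition cutoff1 n k t : R := flat k (n.+1%:R * quad t - 1).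

Lemma is_derive_cutoff1 n k t : is_derive t 1 (cutoff1 n k)
  ((- k%:R * cutoff1 n k.+1 t + cutoff1 n k.+2 t) * (n.+1%:R * (1 - 2 * t))).
Proof.
have dq := is_derive_quad t.
have d1 : is_derive t 1 (fun t => n.+1%:R * quad t) (n.+1%:R *: (1 - 2 * t)).
  exact: is_deriveZ.
have d2 : is_derive t 1 (fun t => n.+1%:R * quad t - 1) (n.+1%:R *: (1 - 2 * t) - 0).
  exact: is_deriveB.
rewrite subr0 in d2.
exact: (@is_derive1_comp _ (flat k) (fun t => n.+1%:R * quad t - 1) t _ _ (is_derive_flat k _) d2).
Qed.

(** Test functions, bounded by 1 on the square, that converge to the weight [lam b], which does not
    vanish on the boundary. Through them a weak derivative is tested against this weight. *)
Definition cutoff n l b z : R :=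
  cutoff1 n 0 (xcoord ord0 z) * cutoff1 n 0 (xcoord ord_max z) * lam b (xcoord l z).

Lemma cutoff_smooth n l b : smooth_on setT (cutoff n l b).
Proof.
pose B (f : R * R -> R) := (exists k i, f = (fun z => cutoff1 n k (xcoord i z))) \/
  (exists i, f = (fun z => xcoord i z)).
have bc k i : poly_closure B (fun z => cutoff1 n k (xcoord i z)).
  by apply: pc_base; left; exists k, i.
have bx i : poly_closure B (fun z => xcoord i z) by apply: pc_base; right; exists i.
have blam i : poly_closure B (fun z => lam b (xcoord i z)).
  rewrite /lam; case: b; first exact: bx.
  rewrite (_ : (fun z => _) = cst 1 + cst (-1) * (fun z => xcoord i z)).
    by apply: pc_add; [exact: pc_cst|apply: pc_mul => //; exact: pc_cst].
  by apply/funext => z; rewrite /= !fctE /= mulN1r.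
have idd t : is_derive t 1 (@id R) ((cst 1 : R -> R) t) by exact: is_derive_id.
apply: (@poly_closure_smooth R setT B openT); last first.
- apply: pc_mul; last exact: blam.
  by apply: pc_mul; exact: bc.
- move=> f j [[k [i ->]]|[i ->]].
    have [E|ij] := eqVneq i j; last first.
      exists (cst 0); first exact: pc_cst.
      move=> z _; rewrite (pd_coord_comp i j z (is_derive_cutoff1 n k)).
      by rewrite (negbTE ij).
    exists ((cst (- k%:R) * (fun z => cutoff1 n k.+1 (xcoord i z)) +
        (fun z => cutoff1 n k.+2 (xcoord i z))) *
        (cst n.+1%:R * (cst 1 + cst (- 2) * (fun z => xcoord i z)))).
      do ?[exact: bc|exact: bx|exact: pc_cst|apply: pc_mul|apply: pc_add].
    move=> z _; rewrite (pd_coord_comp i j z (is_derive_cutoff1 n k)) E eqxx !fctE /=.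
    ring.
  exists (cst (i == j)%:R); first exact: pc_cst.
  move=> z _; rewrite (pd_coord_comp i j z idd) /=.
  by case: (i == j).
- move=> f [[k [i ->]]|[i ->]] z _.
    exact: (differentiable_coord_comp i z (is_derive_cutoff1 n k)).
  exact: differentiable_xcoord.
Qed.

Lemma cutoff_test_fun n l b : test_fun (cutoff n l b).
Proof.
split; first exact: cutoff_smooth.
have n0 : 0 < n.+1%:R :> R by [].
have ni : 0 < n.+1%:R^-1 :> R by rewrite invr_gt0.
(* If [quad] t > 1 / (n + 1), then t and 1 - t both exceed 1 / (n + 1); so the cutoff vanishes
   outside J x J. *)
pose J : set R := `[n.+1%:R^-1, 1 - n.+1%:R^-1]%classic.
exists (J `*` J); split.
- by apply: compact_setX; exact: segment_compact.
- have sub (d t : R) : 0 < d -> d <= t <= 1 - d -> 0 < t < 1.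
    by move=> d0 /andP[? ?]; apply/andP; split; lra.
  by move=> [x y] []; rewrite /J/= !in_itv/= => hx hy;
    split; apply/I01E => /=; [exact: sub hx|exact: sub hy].
- move=> z nz.
  have out t : ~ J t -> cutoff1 n 0 t = 0.
    move=> Jt; apply: flat_le0; rewrite subr_le0 leNgt; apply/negP => qt; apply: Jt.
    have qn : n.+1%:R^-1 < quad t by rewrite -[ltLHS]mulr1 ltr_pdivrMl.
    have qt0 : 0 < quad t by apply: lt_trans qn.
    have t0 : 0 < t by rewrite ltNge; apply/negP => t0; move: qt0; rewrite /quad; nra.
    have t1 : t < 1 by rewrite ltNge; apply/negP => t1; move: qt0; rewrite /quad; nra.
    have arith (d : R) : d < quad t -> d <= t <= 1 - d.
      by rewrite /quad => qn'; apply/andP; split; nra.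
    by rewrite /J/= in_itv/=; exact: arith.
  rewrite /cutoff; have [J1|nJ1] := pselect (J (xcoord ord0 z)); last first.
    by rewrite (out _ nJ1) !mul0r.
  have [J2|nJ2] := pselect (J (xcoord ord_max z)); last by rewrite (out _ nJ2) mulr0 mul0r.
  by exfalso; apply: nz; split.
Qed.

Lemma cutoff_le1 n l b z : Qhat z -> `|cutoff n l b z| <= 1.
Proof.
move=> Qz; have /I01E /andP[l0 l1] := Qhat_xcoord l Qz.
have /andP[b0 b1] := @lam_bounds R b (xcoord l z) (introT andP (conj (ltW l0) (ltW l1))).
have c0 t : 0 <= cutoff1 n 0 t by exact: flat_ge0.
have c1 t : cutoff1 n 0 t <= 1 by exact: flat0_le1.
rewrite ger0_norm; last by apply: mulr_ge0 => //; apply: mulr_ge0.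
rewrite /cutoff -[leRHS]mulr1; apply: ler_pM => //; first by apply: mulr_ge0.
by rewrite -[leRHS]mulr1; apply: ler_pM.
Qed.

Lemma cutoff1_cvg t : 0 < t < 1 -> (fun n => cutoff1 n 0 t) @ \oo --> (1 : R).
Proof.
move=> t01; have q0 := quad_gt0 t01.
apply/cvgrPdist_le => eps eps0; near=> n.
have nq : eps^-1 + 1 <= n%:R * quad t.
  rewrite -ler_pdivrMr//; near: n; exact: nbhs_infty_ger.
set a := n.+1%:R * quad t - 1.
have aq : eps^-1 <= a.
  rewrite /a -natr1 mulrDl mul1r; move: nq q0; lra.
have e0 : 0 < eps^-1 by rewrite invr_gt0.
have a0 : 0 < a by apply: lt_le_trans aq.
rewrite ger0_norm ?subr_ge0 ?flat0_le1// /cutoff1 -/a flat_gt0// expr0 mul1r.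
have H := expR_ge1Dx (- a^-1).
have H2 : a^-1 <= eps by rewrite -[eps]invrK lef_pV2.
by move: H H2; lra.
Unshelve. all: by end_near.
Qed.

Lemma cutoff_cvg l b z : Qhat z -> (fun n => cutoff n l b z) @ \oo --> lam b (xcoord l z).
Proof.
move=> Qz; have /I01E h1 := Qhat_xcoord ord0 Qz; have /I01E h2 := Qhat_xcoord ord_max Qz.
have H := cvgM (cvgM (cutoff1_cvg h1) (cutoff1_cvg h2)) (cvg_cst (lam b (xcoord l z))).
by rewrite mulr1 mul1r in H; exact: H.
Qed.

End Cutoff.

(** * Green's formula and weak derivatives *)

Section IntegerTrace.
Context {R : realType}.
Notation mu := (@lebesgue_measure R).
Notation RR := (measurableTypeR R).
Implicit Types (s x y t r c : R) (z w : R * R) (u v phi psi : R * R -> R) (e : edge).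
Implicit Types (j l : 'I_2) (U : 'I_2 -> R * R -> R) (b : bool).

Lemma Hs_sqnorm_ge_wderiv s u (p q : nat) : (p + q <= Num.truncn s)%N ->
  (L2sq (wderiv p q u) <= Hs_sqnorm s u)%E.
Proof.
move=> pq; rewrite /Hs_sqnorm; set m := Num.truncn s in pq *.
have pm : (p < m.+1)%N by rewrite ltnS (leq_trans (leq_addr _ _) pq).
have qm : (q < m.+1)%N by rewrite ltnS (leq_trans (leq_addl _ _) pq).
set S1 := (\sum_(a < m.+1) _)%E; set S2 := (if _ then _ else _).
have S20 : (0 <= S2)%E.
  rewrite /S2; case: ifP => // _; apply: sume_ge0 => i _; apply: sume_ge0 => k _.
  exact: gagliardo_ge0.
apply: (@le_trans _ _ S1); last exact: (leeDl _ S20).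
have in0 (i : 'I_m.+1) : (0 <= \sum_(k < m.+1 | (i + k <= m)%N) L2sq (wderiv i k u))%E.
  by apply: sume_ge0 => k _; exact: L2sq_ge0.
rewrite /S1 (bigD1 (Ordinal pm))//=.
apply: (@le_trans _ _ (\sum_(k < m.+1 | (p + k <= m)%N) L2sq (wderiv p k u))%E); last first.
  by apply: leeDl; apply: sume_ge0 => i _; exact: in0.
rewrite (bigD1 (Ordinal qm))//=.
by apply: leeDl; apply: sume_ge0 => k _; exact: L2sq_ge0.
Qed.

Lemma L2norm_wderiv_le s u (p q : nat) : (p + q <= Num.truncn s)%N ->
  (L2norm (wderiv p q u) <= Hs_norm s u)%E.
Proof.
move=> pq; have H := Hs_sqnorm_ge_wderiv u pq; rewrite /L2norm /Hs_norm lee_sqrt//.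
by apply: le_trans H; exact: L2sq_ge0.
Qed.

Lemma in_L2_sub u v c : in_L2 u -> in_L2 v -> in_L2 (fun z => u z - v z * c).
Proof.
move=> [mu_ uL] [mv vL]; have mQ := @measurable_Qhat R.
split; first by apply: measurable_funB => //; apply: measurable_funM => //; exact: measurable_cst.
have m2 (f : R * R -> R) : measurable_fun Qhat f -> measurable_fun Qhat (fun z => (f z ^+ 2)%:E).
  by move=> mf; apply/measurable_EFinP; exact: measurable_funX.
have p2 (f : R * R -> R) z : Qhat z -> (0 <= (f z ^+ 2)%:E)%E by rewrite lee_fin sqr_ge0.
have k1 : 0 <= (2 : R) by [].
have k2 : 0 <= 2 * c ^+ 2 by rewrite mulr_ge0 ?sqr_ge0.
have E1 := ge0_integralZl_EFin leb2 mQ (p2 u) (m2 u mu_) k1.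
have E2 := ge0_integralZl_EFin leb2 mQ (p2 v) (m2 v mv) k2.
have q1 z : Qhat z -> (0 <= 2%:E * (u z ^+ 2)%:E)%E by move=> Qz; rewrite mule_ge0// p2.
have q2 z : Qhat z -> (0 <= (2 * c ^+ 2)%:E * (v z ^+ 2)%:E)%E.
  by move=> Qz; rewrite mule_ge0 ?lee_fin// sqr_ge0.
have n1 : measurable_fun Qhat (fun z => (2%:E * (u z ^+ 2)%:E)%E).
  by exact (measurable_funeM _ (m2 u mu_)).
have n2 : measurable_fun Qhat (fun z => ((2 * c ^+ 2)%:E * (v z ^+ 2)%:E)%E).
  by exact (measurable_funeM _ (m2 v mv)).
have ED := ge0_integralD leb2 mQ q1 n1 q2 n2.
apply: (@le_lt_trans _ _ (2%:E * L2sq u + (2 * c ^+ 2)%:E * L2sq v)%E); last first.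
  by apply: lte_add_pinfty; apply: lte_mul_pinfty => //; rewrite lee_fin.
apply: (@le_trans _ _ (\int[leb2]_(z in Qhat) (2%:E * (u z ^+ 2)%:E + (2 * c ^+ 2)%:E * (v z ^+ 2)%:E))%E).
  apply: le_integral_ge0 => z _; first by rewrite lee_fin sqr_ge0.
  rewrite -!EFinM -EFinD lee_fin; have := sqr_ge0 (u z + v z * c).
  by rewrite sqrrD sqrrB exprMn; lra.
apply: eqW_le; apply: (etrans ED).
by apply: f_equal2; [exact E1|exact E2].
Qed.

Lemma integrable_L2_bounded u psi (M : R) : in_L2 u -> measurable_fun Qhat psi -> 0 < M ->
  (forall z, Qhat z -> `|psi z| <= M) ->
  leb2.-integrable Qhat (EFin \o (fun z => u z * psi z)).
Proof.
move=> uL mp M0 pM; have mQ := @measurable_Qhat R; have [mu_ _] := uL.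
apply/integrableP; split; first by apply/measurable_EFinP; exact: measurable_funM.
have mua : measurable_fun Qhat (fun z => (`|u z|)%:E).
  exact/measurable_EFinP/measurable_norm.
have a0 z : Qhat z -> (0 <= (`|u z|)%:E)%E by rewrite lee_fin.
have E := ge0_integralZl_EFin leb2 mQ a0 mua (ltW M0).
apply: (@le_lt_trans _ _ (M%:E * \int[leb2]_(z in Qhat) (`|u z|)%:E)%E); last first.
  by apply: lte_mul_pinfty; rewrite ?lee_fin ?(ltW M0)//; exact: in_L2_abs_lty.
apply: (@le_trans _ _ (\int[leb2]_(z in Qhat) (M%:E * (`|u z|)%:E))%E); last first.
  exact (eqW_le E).
apply: le_integral_ge0 => z Qz; first exact: abse_ge0.
by rewrite /= lee_fin normrM mulrC ler_wpM2r// pM.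
Qed.

(* the multi-index of the first derivative in the direction l *)
Definition dirx l : nat := (l == ord0).
Definition diry l : nat := (l != ord0).

Lemma pderiv_dir l u : pderiv (dirx l) (diry l) u = pd l u.
Proof.
rewrite /dirx /diry; have [->//|] := eqVneq l ord0.
by move=> /ord2_neq ->; congr (pd _ _); exact/val_inj.
Qed.

Lemma dir_sum l : (dirx l + diry l = 1)%N.
Proof. by rewrite /dirx /diry; case: (l == ord0). Qed.

Lemma test_fun_bounded psi : test_fun psi ->
  exists2 M : R, 0 < M & forall z, Qhat z -> `|psi z| <= M.
Proof.
move=> tp; have [M M0 pM] := continuous_bounded_Qhat (test_fun_continuous tp).
by exists M => // z /Qhat_sub_bar; exact: pM.
Qed.

Lemma test_fun_pd_bounded psi l : test_fun psi ->
  exists2 M : R, 0 < M & forall z, Qhat z -> `|pd l psi z| <= M.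
Proof.
move=> tp; have [M M0 pM] := continuous_bounded_Qhat (test_fun_pd_continuous (j := l) tp).
by exists M => // z /Qhat_sub_bar; exact: pM.
Qed.

Lemma smooth_closure_by_parts l phi psi : smooth_closure phi -> test_fun psi ->
  \int[leb2]_(z in Qhat) (phi z * pd l psi z) = - \int[leb2]_(z in Qhat) (pd l phi z * psi z).
Proof.
move=> sp tp; have mp := continuous_measurable_Qhat (test_fun_continuous tp).
have md := continuous_measurable_Qhat (test_fun_pd_continuous (j := l) tp).
have [M M0 pM] := test_fun_bounded tp; have [M' M0' dM] := test_fun_pd_bounded l tp.
have sd := smooth_closure_pd l sp.
have i1 := integrable_L2_bounded (smooth_closure_in_L2 sd) mp M0 pM.
have i2 := integrable_L2_bounded (smooth_closure_in_L2 sp) md M0' dM.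
have i1' : leb2.-integrable Qhat (EFin \o (fun z => psi z * pd l phi z)).
  by rewrite (_ : (fun z => _) = (fun z => pd l phi z * psi z))//; apply/funext => z; rewrite mulrC.
have H := @test_fun_by_parts R l phi (pd l phi) psi tp i1' i2.
have E : \int[leb2]_(z in Qhat) (psi z * pd l phi z) =
    \int[leb2]_(z in Qhat) (pd l phi z * psi z).
  by congr (Rintegral _ _ _); apply/funext => z; rewrite mulrC.
have {}H : \int[leb2]_(z in Qhat) (psi z * pd l phi z) =
    - \int[leb2]_(z in Qhat) (phi z * pd l psi z).
  apply: H.
  - by move=> t y t01 Iy; apply: is_derive_smooth_closure => //; exact: I01_le.
  - by move=> t y t01 Iy; apply: continuous_smooth_closure => //; exact: I01_le.
by rewrite -E H opprK.
Qed.

(** The H^s norm of phi - u c is made of [wderiv] of this difference, a function selected by [xget].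
    An explicit weak derivative ensures that the selected one satisfies its specification. *)
Lemma is_wderiv_smooth_sub l phi u W c : smooth_closure phi -> in_L2 u ->
  is_wderiv (dirx l) (diry l) u W ->
  is_wderiv (dirx l) (diry l) (fun z => phi z - u z * c) (fun z => pd l phi z - W z * c).
Proof.
move=> sp uL [WL WE]; have sd := smooth_closure_pd l sp; have mQ := @measurable_Qhat R.
split; first by apply: in_L2_sub => //; exact: smooth_closure_in_L2.
move=> psi tp; rewrite dir_sum expr1 mulN1r pderiv_dir.
have mp := continuous_measurable_Qhat (test_fun_continuous tp).
have md := continuous_measurable_Qhat (test_fun_pd_continuous (j := l) tp).
have [M M0 pM] := test_fun_bounded tp; have [M' M0' dM] := test_fun_pd_bounded l tp.
have i1 := integrable_L2_bounded (smooth_closure_in_L2 sp) md M0' dM.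
have i2 := integrable_L2_bounded uL md M0' dM.
have i3 := integrable_L2_bounded (smooth_closure_in_L2 sd) mp M0 pM.
have i4 := integrable_L2_bounded WL mp M0 pM.
have c2 := @integrableZl _ (RR * RR)%type R leb2 _ mQ c _ i2.
have c4 := @integrableZl _ (RR * RR)%type R leb2 _ mQ c _ i4.
have Z2 := @RintegralZl _ (RR * RR)%type R leb2 _ _ c mQ i2.
have Z4 := @RintegralZl _ (RR * RR)%type R leb2 _ _ c mQ i4.
have B2 := @RintegralB _ (RR * RR)%type R leb2 _ _ _ mQ i1 c2.
have B4 := @RintegralB _ (RR * RR)%type R leb2 _ _ _ mQ i3 c4.
have E2 : \int[leb2]_(z in Qhat) ((phi z - u z * c) * pd l psi z) =
    \int[leb2]_(z in Qhat) (phi z * pd l psi z) - c * \int[leb2]_(z in Qhat) (u z * pd l psi z).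
  have E : \int[leb2]_(z in Qhat) ((phi z - u z * c) * pd l psi z) =
     \int[leb2]_(z in Qhat) (phi z * pd l psi z - c * (u z * pd l psi z)).
    by congr (Rintegral _ _ _); apply/funext => z; ring.
  by apply: (etrans E); apply: (etrans B2); exact (congr1 (fun X => _ - X) Z2).
have E4 : \int[leb2]_(z in Qhat) ((pd l phi z - W z * c) * psi z) =
    \int[leb2]_(z in Qhat) (pd l phi z * psi z) - c * \int[leb2]_(z in Qhat) (W z * psi z).
  have E : \int[leb2]_(z in Qhat) ((pd l phi z - W z * c) * psi z) =
     \int[leb2]_(z in Qhat) (pd l phi z * psi z - c * (W z * psi z)).
    by congr (Rintegral _ _ _); apply/funext => z; ring.
  by apply: (etrans E); apply: (etrans B4); exact (congr1 (fun X => _ - X) Z4).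
have WE' := WE psi tp; rewrite dir_sum expr1 mulN1r pderiv_dir in WE'.
rewrite E2 E4 (smooth_closure_by_parts l sp tp) WE'.
by rewrite opprB mulrN opprK addrC.
Qed.

End IntegerTrace.

Section GreenTrace.
Context {R : realType}.
Notation mu := (@lebesgue_measure R).
Notation RR := (measurableTypeR R).
Implicit Types (s x y t r c : R) (z w : R * R) (u v phi psi : R * R -> R) (e : edge).
Implicit Types (j l : 'I_2) (U : 'I_2 -> R * R -> R) (b : bool).

Lemma is_wderiv_wderiv (p q : nat) u : (0 < p + q)%N -> (exists W, is_wderiv p q u W) ->
  is_wderiv p q u (wderiv p q u).
Proof.
move=> pq ex; rewrite /wderiv eqn0Ngt pq /=; exact: (xgetPex (fun=> 0) ex).
Qed.

Lemma measurable_lam_coord l b : measurable_fun Qhat (fun z : R * R => lam b (xcoord l z)).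
Proof. exact: (@measurable_lam R _ _ _ b _ (@measurable_xcoord R l Qhat)). Qed.

Lemma lam_coord_le1 l b z : Qhat z -> `|lam b (xcoord l z)| <= 1.
Proof.
move=> Qz; have /andP[l0 l1] := @lam_bounds R b _ (I01_le (Qhat_xcoord l Qz)).
by rewrite ger0_norm.
Qed.

(** Inside the integral, the derivative of phi is split into that of phi - u c and c W. The explicit
    derivative of the difference is then exchanged for the selected [wderiv] by comparing their
    integrals against [psi]. *)
Lemma pd_test_fun_le l phi u W c psi : `|c| <= 1 -> smooth_closure phi -> in_L2 u ->
  is_wderiv (dirx l) (diry l) u W -> test_fun psi ->
  (forall z, Qhat z -> `|psi z| <= 1) ->
  (`|\int[leb2]_(z in Qhat) (pd l phi z * psi z)|%:E <=
   2%:E * L2norm (wderiv (dirx l) (diry l) (fun z => phi z - u z * c)%R) + 2%:E * L2norm W)%E.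
Proof.
move=> c1 sp uL hW tp p1; have mQ := @measurable_Qhat R; have [WL WE] := hW.
set w := wderiv _ _ _.
have hd := is_wderiv_smooth_sub c sp uL hW; have [dL dE] := hd.
have dir0 : (0 < dirx l + diry l)%N by rewrite dir_sum.
have [wL wE] : is_wderiv (dirx l) (diry l) (fun z => phi z - u z * c)%R w.
  by apply: is_wderiv_wderiv => //; eexists; exact: hd.
have mp := continuous_measurable_Qhat (test_fun_continuous tp).
have i3 := integrable_L2_bounded (smooth_closure_in_L2 (smooth_closure_pd l sp)) mp ltr01 p1.
have i4 := integrable_L2_bounded WL mp ltr01 p1.
have i5 := integrable_L2_bounded dL mp ltr01 p1.
have c4 := @integrableZl _ (RR * RR)%type R leb2 _ mQ c _ i4.
have Z4 := @RintegralZl _ (RR * RR)%type R leb2 _ _ c mQ i4.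
have D4 := @RintegralD _ (RR * RR)%type R leb2 _ _ _ mQ i5 c4.
have E : \int[leb2]_(z in Qhat) (pd l phi z * psi z) =
    \int[leb2]_(z in Qhat) (w z * psi z) + c * \int[leb2]_(z in Qhat) (W z * psi z).
  have E1 : \int[leb2]_(z in Qhat) (pd l phi z * psi z) =
      \int[leb2]_(z in Qhat) ((pd l phi z - W z * c) * psi z + c * (W z * psi z)).
    by congr (Rintegral _ _ _); apply/funext => z; ring.
  apply: (etrans E1); apply: (etrans D4); apply: f_equal2; last exact: Z4.
  have := dE psi tp; rewrite (wE psi tp) dir_sum expr1 !mulN1r => /oppr_inj H.
  exact: esym.
rewrite E; apply: (@le_trans _ _ (`|\int[leb2]_(z in Qhat) (w z * psi z)|%:E +
   `|\int[leb2]_(z in Qhat) (W z * psi z)|%:E)%E).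
  rewrite -EFinD lee_fin; apply: (le_trans (ler_normD _ _)); rewrite lerD2l normrM.
  by rewrite ler_piMl.
by apply: leeD; exact: le_abs_Rintegral_bounded.
Qed.

(** The bound of [pd_test_fun_le] is the same for all cutoffs. For a fixed phi the derivative is
    bounded, so dominated convergence carries the bound over to the linear weight. *)
Lemma pd_lam_le l b phi u W c : `|c| <= 1 -> smooth_closure phi -> in_L2 u ->
  is_wderiv (dirx l) (diry l) u W ->
  (`|\int[leb2]_(z in Qhat) (pd l phi z * lam b (xcoord l z))|%:E <=
   2%:E * L2norm (wderiv (dirx l) (diry l) (fun z => phi z - u z * c)%R) + 2%:E * L2norm W)%E.
Proof.
move=> c1 sp uL hW; have mQ := @measurable_Qhat R.
have sd := smooth_closure_pd l sp; have dL := smooth_closure_in_L2 sd.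
have md := smooth_closure_measurable sd.
have [M M0 dM] := smooth_closure_bounded sd.
have ml := measurable_lam_coord l b.
have mc n : measurable_fun Qhat (@cutoff R n l b).
  exact: continuous_measurable_Qhat (test_fun_continuous (cutoff_test_fun n l b)).
pose D n z := pd l phi z * (lam b (xcoord l z) - cutoff n l b z).
have mD n : measurable_fun Qhat (D n) by apply: measurable_funM => //; exact: measurable_funB.
have DB n z : Qhat z -> `|D n z| <= M * 2.
  move=> Qz; rewrite normrM; apply: ler_pM => //; first by apply: dM; exact: Qhat_sub_bar.
  apply: (le_trans (ler_normB _ _)).
  by have := lam_coord_le1 l b Qz; have := cutoff_le1 n l b Qz; lra.
have Dc : (fun n => \int[leb2]_(z in Qhat) (`|D n z|)%:E)%E @ \oo --> 0%E.
  have mF n : measurable_fun Qhat (fun z => (`|D n z|)%:E).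
    by apply/measurable_EFinP; exact: measurable_norm.
  have H := @dominated_cvg0 _ (RR * RR)%type R leb2 Qhat
    (fun n z => (`|D n z|)%:E) (cst (M * 2)%:E) mQ mF.
  apply: H.
  - exact: measurable_cst.
  - by move=> n z _; rewrite lee_fin.
  - by move=> z _; rewrite lee_fin mulr_ge0// ltW.
  - move=> z Qz; apply/fine_cvgP; split; first by near=> n.
    have H1 : (fun n => lam b (xcoord l z) - cutoff n l b z) @ \oo -->
        lam b (xcoord l z) - lam b (xcoord l z).
      by apply: cvgB; [exact: cvg_cst|exact: cutoff_cvg].
    have H2 := cvg_norm (cvgM (cvg_cst (pd l phi z)) H1).
    by rewrite subrr mulr0 normr0 in H2; exact: H2.
  - exists set0; split; [exact: measurable0|exact (measure0 leb2)|].
    by move=> z Hz; apply: Hz => Qz n; rewrite lee_fin; exact: DB.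
  - have mcst : measurable_fun Qhat (cst (M * 2) : R * R -> R) by exact: measurable_cst.
    have B z : Qhat z -> `|(cst (M * 2) : R * R -> R) z| <= M * 2.
      by move=> _; rewrite ger0_norm// mulr_ge0// ltW.
    have /integrableP[_ Hi] := measurable_bounded_integrable mcst B.
    apply: le_lt_trans Hi; apply: le_integral_ge0 => z _.
      by rewrite lee_fin mulr_ge0// ltW.
    by rewrite /= lee_fin ler_norm.
apply/lee_addgt0Pr => d d0.
(* The square root because [cvg0_sqrte_le] bounds by eta^2. *)
pose eta := Num.sqrt d; have eta0 : 0 < eta by rewrite sqrtr_gt0.
have [N _ HN] := cvg0_sqrte_le eta0 Dc.
have {}HN := HN N (leqnn N); rewrite /= sqr_sqrtr ?(ltW d0)// in HN.
have tp := @cutoff_test_fun R N l b.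
have i1 := integrable_L2_bounded dL (mc N) ltr01 (@cutoff_le1 R N l b).
have iD : leb2.-integrable Qhat (EFin \o D N).
  exact: (measurable_bounded_integrable (mD N) (DB N)).
have E : \int[leb2]_(z in Qhat) (pd l phi z * lam b (xcoord l z)) =
    \int[leb2]_(z in Qhat) (pd l phi z * cutoff N l b z) + \int[leb2]_(z in Qhat) (D N z).
  have E1 : \int[leb2]_(z in Qhat) (pd l phi z * lam b (xcoord l z)) =
      \int[leb2]_(z in Qhat) (pd l phi z * cutoff N l b z + D N z).
    by congr (Rintegral _ _ _); apply/funext => z; rewrite /D; ring.
  apply: (etrans E1); exact: (@RintegralD _ (RR * RR)%type R leb2 _ _ _ mQ i1 iD).
have H1 := pd_test_fun_le c1 sp uL hW tp (@cutoff_le1 R N l b).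
have H2 : (`|\int[leb2]_(z in Qhat) D N z|%:E <= d%:E)%E.
  have E2 := @EFin_normr_Rintegral _ (RR * RR)%type R leb2 _ _ mQ iD.
  apply: (@le_trans _ _ `|\int[leb2]_(z in Qhat) (D N z)%:E|%E).
    exact (eqW_le E2).
  have mDE : measurable_fun Qhat (fun z => (D N z)%:E) by exact/measurable_EFinP.
  by apply: (le_trans (le_abse_integral leb2 mQ mDE)); exact: HN.
rewrite E; apply: le_trans (leeD H1 H2).
by rewrite -EFinD lee_fin ler_normD.
Unshelve. all: by end_near.
Qed.

(** The product of phi and [lam b] is phi on the edge and 0 on the opposite one. So its derivative
    in direction l integrates over the square to the moment, up to the sign [lsgn b]. *)
Lemma edge_green phi l b : smooth_closure phi ->
  (`|\int[mu]_(t in I01) phi (edge_pt (l, b) t)|%:E <=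
   `|\int[leb2]_(z in Qhat) (pd l phi z * lam b (xcoord l z))|%:E +
   \int[leb2]_(z in Qhat) (`|phi z|)%:E)%E.
Proof.
move=> sp; have mQ := @measurable_Qhat R; have mI := @measurable_I01 R.
have sd := smooth_closure_pd l sp.
have pL := smooth_closure_in_L2 sp.
have i1 := integrable_L2_bounded (smooth_closure_in_L2 sd) (measurable_lam_coord l b) ltr01
  (@lam_coord_le1 l b).
have ms : measurable_fun Qhat (fun _ : R * R => lsgn b : R) by exact: measurable_cst.
have s1 (z : R * R) : Qhat z -> `|lsgn b : R| <= 1.
  by move=> _; rewrite /lsgn; case: b {i1 ms}; rewrite ?normrN normr1.
have i2 := integrable_L2_bounded pL ms ltr01 s1.
have i12 := @integrableD _ (RR * RR)%type R leb2 _ mQ _ _ i1 i2.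
have D12 := @RintegralD _ (RR * RR)%type R leb2 _ _ _ mQ i1 i2.
have H := @integral_fiber_derive R l (fun z => phi z * lam b (xcoord l z))
  (fun z => pd l phi z * lam b (xcoord l z) + phi z * lsgn b) i12.
have {}H : (\int[leb2]_(z in Qhat) (pd l phi z * lam b (xcoord l z) + phi z * lsgn b)%:E =
    \int[mu]_(y in I01) (phi (mkpt l 1 y) * lam b (xcoord l (mkpt l 1 y)) -
      phi (mkpt l 0 y) * lam b (xcoord l (mkpt l 0 y)))%:E)%E.
  apply: H => t y t01 Iy; have y01 := I01_le Iy.
    have d1 := is_derive_smooth_closure l sp t01 y01.
    have dM := is_deriveM d1 (is_derive_lam b t).
    have E : (fun t => phi (mkpt l t y) * lam b (xcoord l (mkpt l t y))) =
        (fun t => phi (mkpt l t y)) * lam b.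
      by apply/funext => r; rewrite !fctE xcoord_mkpt.
    rewrite E; apply: (is_derive_eq dM); rewrite /GRing.scale/= xcoord_mkpt; ring.
  have c1 := @continuous_smooth_closure _ _ l _ _ sp t01 y01.
  have c2 := @continuous_smooth_closure _ _ l _ _ sd t01 y01.
  have c3 : {for t, continuous (@lam R b)} :=
    @is_derive_continuous _ (cst (lsgn b)) _ _ (is_derive_lam b t).
  have E : (fun t => lam b (xcoord l (mkpt l t y))) = lam b.
    by apply/funext => r; rewrite xcoord_mkpt.
  apply: cvgD; apply: cvgM; [exact: c2| |exact: c1|exact: cvg_cst].
  by rewrite E xcoord_mkpt; exact: c3.
have Eb : (\int[mu]_(y in I01) (phi (mkpt l 1 y) * lam b (xcoord l (mkpt l 1 y)) -
      phi (mkpt l 0 y) * lam b (xcoord l (mkpt l 0 y)))%:E =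
    \int[mu]_(y in I01) (lsgn b * phi (edge_pt (l, b) y))%:E)%E.
  apply: eq_integral => y _; rewrite !xcoord_mkpt /edge_pt /lam /lsgn /=; congr (_%:E).
  by case: (b) => /=; ring.
have [M M0 pM] := smooth_closure_bounded sp.
have me := measurable_smooth_closure_edge (l, b) sp.
have ie : mu.-integrable I01 (EFin \o (fun t => phi (edge_pt (l, b) t))).
  apply: (@integrable_I01_bounded _ _ M) => // t It; apply: pM.
  by apply: Qhat_bar_mkpt; [exact: bool_le01|exact: I01_le].
have Ze := @RintegralZl _ RR R mu _ _ (lsgn b) mI ie.
have Hfin : \int[leb2]_(z in Qhat) (pd l phi z * lam b (xcoord l z) + phi z * lsgn b) =
    lsgn b * \int[mu]_(t in I01) phi (edge_pt (l, b) t).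
  apply: (etrans (congr1 fine H)); apply: (etrans (congr1 fine Eb)); exact: Ze.
have nl : `|lsgn b : R| = 1 by rewrite /lsgn; case: (b); rewrite ?normrN normr1.
have -> : `|\int[mu]_(t in I01) phi (edge_pt (l, b) t)| =
    `|lsgn b * \int[mu]_(t in I01) phi (edge_pt (l, b) t)|.
  by rewrite normrM nl mul1r.
rewrite -Hfin.
have B2 : (`|\int[leb2]_(z in Qhat) (phi z * lsgn b)|%:E <=
    \int[leb2]_(z in Qhat) (`|phi z|)%:E)%E.
  have E2 := @EFin_normr_Rintegral _ (RR * RR)%type R leb2 _ _ mQ i2.
  apply: (@le_trans _ _ `|\int[leb2]_(z in Qhat) (phi z * lsgn b)%:E|%E).
    exact (eqW_le E2).
  have mDE : measurable_fun Qhat (fun z => (phi z * lsgn b)%:E).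
    by apply/measurable_EFinP; apply: measurable_funM => //; exact: smooth_closure_measurable.
  apply: (le_trans (le_abse_integral leb2 mQ mDE)).
  apply: le_integral_ge0 => z _; first exact: abse_ge0.
  by rewrite /= lee_fin normrM nl mulr1.
have E3 : (`|\int[leb2]_(z in Qhat) (pd l phi z * lam b (xcoord l z) + phi z * lsgn b)| <=
    `|\int[leb2]_(z in Qhat) (pd l phi z * lam b (xcoord l z))| +
    `|\int[leb2]_(z in Qhat) (phi z * lsgn b)|)%R.
  apply: le_trans (ler_normD _ _); rewrite le_eqVlt; apply/orP; left; apply/eqP.
  exact: (congr1 Num.norm D12).
apply: (@le_trans _ _ (`|\int[leb2]_(z in Qhat) (pd l phi z * lam b (xcoord l z))|%:E +
    `|\int[leb2]_(z in Qhat) (phi z * lsgn b)|%:E)%E).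
  by rewrite -EFinD lee_fin.
by apply: leeD.
Qed.

Lemma L1_triangle u v : measurable_fun Qhat u -> measurable_fun Qhat v ->
  (\int[leb2]_(z in Qhat) (`|u z|)%:E <=
   2%:E * L2norm (fun z => u z - v z)%R + 2%:E * L2norm v)%E.
Proof.
move=> mu_ mv; have mQ := @measurable_Qhat R.
have md : measurable_fun Qhat (fun z => u z - v z)%R by exact: measurable_funB.
have ma (f : R * R -> R) : measurable_fun Qhat f -> measurable_fun Qhat (fun z => (`|f z|)%:E).
  by move=> mf; exact/measurable_EFinP/measurable_norm.
have a0 (f : R * R -> R) z : Qhat z -> (0 <= (`|f z|)%:E)%E by rewrite lee_fin.
have E1 := ge0_integralD leb2 mQ (a0 _) (ma _ md) (a0 _) (ma _ mv).
apply: le_trans (leeD (L1_le_L2 md) (L1_le_L2 mv)).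
apply: (@le_trans _ _ (\int[leb2]_(z in Qhat) ((`|u z - v z|)%:E + (`|v z|)%:E))%E).
  apply: le_integral_ge0 => z _; first by rewrite lee_fin.
  by rewrite -EFinD lee_fin -{1}(subrK (v z) (u z)) ler_normD.
exact (eqW_le E1).
Qed.

(** The l-th derivative and the function itself contribute a factor 2 each; the L^2 norms of both
    are part of the H^s norm because the integer part of s is at least 1. *)
Lemma trace_moment_le_ge1 s U l b : 1 <= s -> in_Hs_vec s U ->
  (`|trace_moment s U (l, b)|%:E <= 4%:E * Hs_norm s (U l))%E.
Proof.
move=> s1 hU; set e : edge := (l, b).
have n1 : (1 <= Num.truncn s)%N by rewrite truncn_gt0.
have H0 v : (0 <= Hs_norm s v)%E by exact: sqrte_ge0.
rewrite /trace_moment /edge_trace; case: xgetP => [g _ [[mg g2] [phi [sp Xc Tc]]]|_]; last first.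
  rewrite /Rintegral integral0_eq//= normr0 mule_ge0 ?lee_fin//.
have [UL Uex _] := hU l; have mUl := in_Hs_measurable (hU l).
pose c : R := if b then 1 else -1.
have c1 : `|c| <= 1 by rewrite /c; case: (b); rewrite ?normrN normr1.
have vE : normal_comp U e = (fun z => U l z * c) := normal_compE U e.
rewrite vE in Xc.
have dir1 : (0 < dirx l + diry l <= Num.truncn s)%N by rewrite dir_sum n1.
have hW : is_wderiv (dirx l) (diry l) (U l) (wderiv (dirx l) (diry l) (U l)).
  by apply: is_wderiv_wderiv; [rewrite dir_sum|exact: Uex].
have d1 : (dirx l + diry l <= Num.truncn s)%N by rewrite dir_sum.
have four : 0 < (4 : R) by [].
apply: (trace_moment_limit four _ mg g2 sp Xc Tc) => // k.
have mphi := smooth_closure_measurable (sp k).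
have mv : measurable_fun Qhat (fun z => U l z * c).
  by apply: measurable_funM => //; exact: measurable_cst.
apply: (le_trans (edge_green l b (sp k))).
have B1 := pd_lam_le b c1 (sp k) UL hW.
have B2 := L1_triangle mphi mv.
have Lv : L2norm (fun z => U l z * c)%R = L2norm (U l).
  rewrite /L2norm; congr sqrte; apply: eq_integral => z _.
  by rewrite exprMn (_ : c ^+ 2 = 1) ?mulr1// /c; case: (b); rewrite ?sqrrN expr1n.
rewrite Lv in B2.
have N1 := @L2norm_wderiv_le R s (fun z => phi k z - U l z * c)%R _ _ d1.
have N2 := @L2norm_wderiv_le R s (U l) _ _ d1.
have N3 := @L2norm_wderiv_le R s (fun z => phi k z - U l z * c)%R 0 0 (leq0n _).
have N4 := @L2norm_wderiv_le R s (U l) 0 0 (leq0n _).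
have two0 : (0 <= (2%:E : \bar R))%E by [].
have L := leeD (leeD (lee_wpmul2l two0 N1) (lee_wpmul2l two0 N2))
  (leeD (lee_wpmul2l two0 N3) (lee_wpmul2l two0 N4)).
apply: (le_trans (leeD B1 B2)); apply: (le_trans L).
set A := Hs_norm s (fun z => phi k z - U l z * c)%R; set B := Hs_norm s (U l).
have A0 : (0 <= A)%E by exact: sqrte_ge0.
have B0 : (0 <= B)%E by exact: sqrte_ge0.
rewrite -(ge0_muleDr _ A0 B0) -ge0_muleDl//.
by rewrite -EFinD; apply: eqW_le; congr (_%:E * _)%E; ring.
Qed.

Lemma part_one s : 2^-1 < s ->
  exists C : R, 0 < C /\
    forall U, in_Hs_vec s U -> forall l : 'I_2,
      (L2norm (RT_interp s U l) <= C%:E * Hs_norm s (U l))%E.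
Proof.
move=> s0; have [s1|s1] := ltP s 1.
  have C0 := trace_cst_gt0 s0.
  exists (2 * trace_cst s); split; first by rewrite mulr_gt0.
  move=> U hU l; rewrite EFinM -muleA; apply: RT_interp_le.
    by rewrite mule_ge0 ?lee_fin ?(ltW C0)// sqrte_ge0.
  move=> b; rewrite /edge_moment s0; apply: trace_moment_le_frac => //.
  by rewrite s0 s1.
exists (2 * 4); split; first by rewrite mulr_gt0.
move=> U hU l; rewrite EFinM -muleA; apply: RT_interp_le.
  by rewrite mule_ge0 ?lee_fin// sqrte_ge0.
by move=> b; rewrite /edge_moment s0; exact: trace_moment_le_ge1.
Qed.

End GreenTrace.

Local Close Scope classical_set_scope.

Theorem theorem5p1 (R : realType) :
  (forall s : R, 2^-1 < s ->
     exists C : R, 0 < C /\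
       forall U : 'I_2 -> R * R -> R, in_Hs_vec s U ->
       forall l : 'I_2,
         (L2norm (RT_interp s U l) <= C%:E * Hs_norm s (U l))%E) /\
  (forall s : R, 0 < s <= 2^-1 ->
     exists C : R, 0 < C /\
       forall U : 'I_2 -> R * R -> R, in_Hs_vec s U -> in_Hdiv U ->
       forall l m : 'I_2, m = rev_ord l ->
         (L2norm (RT_interp s U l) <=
          C%:E * (Hs_norm s (U l) + AHs_seminorm m s (U m)
                  + L2norm (divg U)))%E).
Proof. by split; [exact: part_one|exact: part_two]. Qed.
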